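(* Let $\mathbb K$ be algebraically closed of characteristic $0$, $n\ge2$, $\mathfrak g=\mathfrak{gl}_n$, and let $e$ be an arbitrary nilpotent element of $\mathfrak g$. Then all irreducible components of the null-cone $\mathcal N(e)\subset\mathfrak g_e^*$ have codimension $n$ in $\mathfrak g_e^*$, and hence ${}^{e}\!F_1,\dots,{}^{e}\!F_n$ is a regular sequence in $\mathcal S(\mathfrak g_e)$.
   Context: $\mathcal N(e)$ is the set of $\xi\in\mathfrak g_e^*$ with $\varphi(\xi)=0$ for all $\varphi\in\mathcal S(\mathfrak g_e)^{\mathfrak g_e}$ with $\varphi(0)=0$ (identifying $\mathcal S(\mathfrak g_e)=\mathbb K[\mathfrak g_e^*]$). $F_i=\kappa^{-1}(\Delta_i)$, where $\Delta_i$ is the sum of the principal $i\times i$ minors of the generic matrix, $(\cdot,\cdot)$ is a nonzero multiple of the trace form, and $\kappa:\mathcal S(\mathfrak g)\to\mathbb K[\mathfrak g]$ extends $x\mapsto(x,\cdot)$. If $e\ne0$, include $e$ in an $\mathfrak{sl}_2$-triple $(e,h,f)$ and normalise $(e,f)=1$; if $e=0$ put $f=0$. $\mathfrak g_e,\mathfrak g_f$ are centralisers and $\kappa_e:\mathcal S(\mathfrak g_e)\to\mathbb K[\mathfrak g_f]$ extends $x\mapsto(x,\cdot)|_{\mathfrak g_f}$. ${}^{e}\!F:=\kappa_e^{-1}(\mathrm{in}(\psi_F))$ with $\psi_F(x)=\kappa(F)(e+x)$ on $\mathfrak g_f$ and $\mathrm{in}$ the lowest-degree nonzero homogeneous component.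 *)

(* Defs.v *)
From HB Require Import structures.
From mathcomp Require Import all_boot all_order all_algebra.
From mathcomp Require Import mpoly.

Set Implicit Arguments.
Unset Strict Implicit.
Unset Printing Implicit Defensive.

Import Order.TTheory GRing.Theory.
Local Open Scope ring_scope.

Definition centralizes (R : ringType) (n : nat) (e x : 'M[R]_n) : Prop :=
  x *m e = e *m x.

Definition mxnilpotent (R : ringType) (n : nat) (e : 'M[R]_n) : Prop :=
  exists k : nat, iter k (fun x => e *m x) 1%:M = 0.

Definition lie (R : ringType) (n : nat) (x y : 'M[R]_n) : 'M[R]_n :=
  x *m y - y *m x.

Definition is_basis_of (R : fieldType) (n : nat) (P : 'M[R]_n -> Prop)
    (d : nat) (b : 'I_d -> 'M[R]_n) : Prop :=
  [/\ forall i, P (b i),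
      forall a : 'I_d -> R, \sum_i a i *: b i = 0 -> forall i, a i = 0 &
      forall x, P x -> exists a : 'I_d -> R, x = \sum_i a i *: b i].

Definition struct_consts (R : fieldType) (n d : nat) (b : 'I_d -> 'M[R]_n)
    (gam : 'I_d -> 'I_d -> 'I_d -> R) : Prop :=
  forall i j, lie (b i) (b j) = \sum_k gam i j k *: b k.

(* S(g_e) is identified with K[X_0..X_{d-1}] via b_k |-> X_k, and      *)
(* g_e^* with K^d via xi |-> (xi(b_k))_k.                              *)

(* phi is in S(g_e)^{g_e}: annihilated by the derivations ad(b_i),     *)
(* which send X_j to [b_i,b_j] = sum_k gam i j k X_k.                  *)
Definition is_invariant (R : fieldType) (d : nat)
    (gam : 'I_d -> 'I_d -> 'I_d -> R) (phi : {mpoly R[d]}) : Prop :=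
  forall i : 'I_d,
    \sum_j (\sum_k gam i j k *: 'X_k) * mderiv j phi = 0.

Definition nullcone (R : fieldType) (d : nat)
    (gam : 'I_d -> 'I_d -> 'I_d -> R) : ('I_d -> R) -> Prop :=
  fun xi => forall phi : {mpoly R[d]},
    is_invariant gam phi -> phi.@[fun _ => 0] = 0 -> phi.@[xi] = 0.

Definition aset (R : ringType) (d : nat) := ('I_d -> R) -> Prop.

Definition asubset (R : ringType) (d : nat) (V W : aset R d) : Prop :=
  forall x, V x -> W x.

Definition zariski_closed (R : ringType) (d : nat) (V : aset R d) : Prop :=
  exists S : {mpoly R[d]} -> Prop,
    forall x, V x <-> (forall p, S p -> p.@[x] = 0).

Definition irreducible_closed (R : ringType) (d : nat) (V : aset R d) : Prop :=
  [/\ zariski_closed V, exists x, V x &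
      forall Z1 Z2 : aset R d, zariski_closed Z1 -> zariski_closed Z2 ->
        asubset V (fun x => Z1 x \/ Z2 x) -> asubset V Z1 \/ asubset V Z2].

Definition chain_in (R : ringType) (d : nat) (V : aset R d) (m : nat) : Prop :=
  exists Y : nat -> aset R d,
    [/\ forall k, (k <= m)%N -> irreducible_closed (Y k),
        forall k, (k < m)%N ->
          asubset (Y k) (Y k.+1) /\ exists x, Y k.+1 x /\ ~ Y k x &
        asubset (Y m) V].

Definition dim_is (R : ringType) (d : nat) (V : aset R d) (m : nat) : Prop :=
  chain_in V m /\ ~ chain_in V m.+1.

Definition irreducible_component (R : ringType) (d : nat) (V Z : aset R d) : Prop :=
  [/\ irreducible_closed Z, asubset Z V &
      forall Z', irreducible_closed Z' -> asubset Z Z' -> asubset Z' V ->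
        asubset Z' Z].

Definition has_codim (R : ringType) (d : nat) (Z : aset R d) (c : nat) : Prop :=
  exists m D, [/\ dim_is Z m, dim_is (fun _ : 'I_d -> R => True) D & (m + c)%N = D].

Definition in_ideal (R : ringType) (d n : nat) (k : nat)
    (fs : 'I_n -> {mpoly R[d]}) (p : {mpoly R[d]}) : Prop :=
  exists q : 'I_n -> {mpoly R[d]}, p = \sum_(i < n | (i < k)%N) q i * fs i.

Definition regular_seq (R : ringType) (d n : nat) (fs : 'I_n -> {mpoly R[d]}) : Prop :=
  (forall (i : 'I_n) (p : {mpoly R[d]}), in_ideal i fs (p * fs i) -> in_ideal i fs p)
  /\ ~ in_ideal n fs 1.

Definition pminors_sum (R : comRingType) (n : nat) (i : nat) (A : 'M[R]_n) : R :=
  \sum_(S : {set 'I_n} | #|S| == i)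
     \det (\matrix_(a < #|S|, b < #|S|) A (enum_val a) (enum_val b)).

Definition mhomcomp (R : ringType) (d : nat) (k : nat) (p : {mpoly R[d]}) : {mpoly R[d]} :=
  \sum_(m <- msupp p | mdeg m == k) p@_m *: 'X_[m].

Definition mlowdeg (R : ringType) (d : nat) (p : {mpoly R[d]}) : nat :=
  \big[minn/msize p]_(m <- msupp p) mdeg m.

Definition minit (R : ringType) (d : nat) (p : {mpoly R[d]}) : {mpoly R[d]} :=
  mhomcomp (mlowdeg p) p.

(* psi_{F_i}(x) = kappa(F_i)(e + x) = Delta_i(e + x) for x = sum_j t_j c_j in g_f,
   as a polynomial in the coordinates t *)
Definition psiF (R : comRingType) (n d' : nat) (e : 'M[R]_n)
    (c : 'I_d' -> 'M[R]_n) (i : nat) : {mpoly R[d']} :=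
  pminors_sum i (map_mx (fun a => a%:MP) e
                 + \sum_j 'X_j *: map_mx (fun a => a%:MP) (c j)).

(* P = ^eF_i, i.e. kappa_e(P) = in(psi_{F_i}), where (x,y) = c0 tr(xy) and
   kappa_e(P)(sum_j t_j c_j) = P(((b_k, sum_j t_j c_j))_k). *)
Definition is_eF (R : comRingType) (n d d' : nat) (c0 : R) (e : 'M[R]_n)
    (b : 'I_d -> 'M[R]_n) (c : 'I_d' -> 'M[R]_n) (i : nat) (P : {mpoly R[d]}) : Prop :=
  comp_mpoly [tuple \sum_j (c0 * \tr (b k *m c j))%:MP * 'X_j | k < d] P
  = minit (psiF e c i).

(* Main.v *)
(* After conjugation e is a Jordan matrix J. The lowest power of s in Delta_(i+1)(J + s Y) is
   s^(j+1), where j is the index of the block containing the vertex i; let R_i(Y) be its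
   coefficient. By sl2-theory gl_n = g_f + [gl_n, J], and R_i is invariant under translation by
   [gl_n, J], hence ^eF_(i+1) becomes R_i under the surjection gl_n -> g_e^*, x |-> (x, .).

   On matrices whose blocks are built in a Hankel fashion from one vector v of length n the R_i
   successively split into products of linear forms, and their only common zero is v = 0. Thus
   the ^eF_i and d - n linear forms are a homogeneous regular sequence in K[g_e^*], whose zero
   set is the origin. This gives regularity of ^eF_1, .., ^eF_n, and a transcendence degree
   count shows that the components of their zero set have codimension n.

   That zero set is N(e): on a slice of companion matrices the R_i are coordinates up to
   nonzero scalars, and at its base point the slice is transversal to the orbit under g_e, so an
   invariant vanishing on the slice is zero. Hence every invariant is a polynomial in the
   ^eF_i. *)
Require Import Defs.
From HB Require Import structures.
From mathcomp Require Import all_boot all_order all_algebra.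
From mathcomp Require Import fingroup perm mpoly.
From mathcomp Require boolp classical_sets.
From mathcomp Require Import zify ring.

Set Implicit Arguments.
Unset Strict Implicit.
Unset Printing Implicit Defensive.

Import Order.TTheory GRing.Theory.
Local Open Scope ring_scope.

(** * Principal minors *)

(** The Hankel shape makes the relevant minors triangular. The entry for the blocks [i], [j] is
    [v_(i+j)(X + c_j)], where [v_q] is the part of [v] in block [q], read as a polynomial of degree
    below the block size. Once [v_q = 0] for all [q > r], only the product of the [v_r(X + c_j)]
    with [j <= r] survives, and its lowest coefficient is a product of Taylor coefficients of [v_r].
    Each split thus raises the order of [v_r] at one point [c_j] by one; when the orders add up to
    the block size, [v_r = 0] and the next block follows. With equal points all orders would rise
    together and some [R_i] could vanish identically on a branch, hence the distinct shifts.

    The tree of splits uses the polynomials from the last to the first; homogeneous regular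
    sequences can be permuted, which restores the given order. Dimension is handled directly with
    chains of irreducible sets: long chains come from primes that fix the values of the linear forms
    one at a time, and longer ones are excluded by the algebraic dependence of [N + 1] polynomials
    in [N] variables. *)

Lemma det_1addM_comm (R : comNzRingType) m n (X : 'M[R]_(m, n)) (Y : 'M[R]_(n, m)) :
  \det (1%:M + X *m Y) = \det (1%:M + Y *m X).
Proof.
pose B := block_mx (1%:M : 'M[R]_m) (- X) Y 1%:M.
have E1 : B *m block_mx 1%:M X 0 1%:M = block_mx 1%:M 0 Y (1%:M + Y *m X).
  by rewrite mulmx_block !mulmx0 !mul1mx !mulmx1 !addr0 subrr addrC.
have E2 : block_mx 1%:M X 0 1%:M *m B = block_mx (1%:M + X *m Y) 0 Y 1%:M.
  by rewrite mulmx_block !mul0mx !mul1mx !mulmx1 !add0r addNr.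
have /(congr1 determinant) := E1; have /(congr1 determinant) := E2.
by rewrite !det_mulmx !det_ublock !det_lblock !det1 !mul1r !mulr1 => -> ->.
Qed.

Section PrincipalMinors.
Variable R : comNzRingType.

(** With [Q] the 0-1 matrix selecting the rows in [S], the minor is the determinant of
    [1 + (Q A - Q) Q^T]. Exchanging the two factors turns it into an n by n determinant whose rows
    outside [S] are those of the identity. *)
Lemma det_principal_minor n (S : {set 'I_n}) (A : 'M[R]_n) :
  \det (\matrix_(a < #|S|, b < #|S|) A (enum_val a) (enum_val b)) =
  \det (\matrix_(a, b) (if a \in S then A a b else (a == b)%:R)).
Proof.
pose Q : 'M[R]_(#|S|, n) := \matrix_(a, j) (enum_val a == j)%:R.
have QA (B : 'M[R]_n) a b : (Q *m B) a b = B (enum_val a) b.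
  rewrite mxE (bigD1 (enum_val a)) //= big1 ?mxE ?eqxx ?mul1r ?addr0 // => j ne.
  by rewrite !mxE eq_sym (negbTE ne) mul0r.
have BQ k (B : 'M[R]_(k, n)) i b : (B *m Q^T) i b = B i (enum_val b).
  rewrite mxE (bigD1 (enum_val b)) //= big1 ?mxE ?eqxx ?mulr1 ?addr0 // => j ne.
  by rewrite !mxE eq_sym (negbTE ne) mulr0.
have QtB k (B : 'M[R]_(#|S|, k)) (a : 'I_n) b (Sa : a \in S) :
    (Q^T *m B) a b = B (enum_rank_in Sa a) b.
  rewrite mxE (bigD1 (enum_rank_in Sa a)) //= big1 ?mxE ?addr0 => [|j ne].
    by rewrite enum_rankK_in // eqxx mul1r.
  rewrite !mxE; case: eqP => [E|]; last by rewrite mul0r.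
  by case/eqP: ne; apply: enum_val_inj; rewrite E enum_rankK_in.
have -> : \matrix_(a < #|S|, b < #|S|) A (enum_val a) (enum_val b)
    = 1%:M + (Q *m A - Q) *m Q^T.
  apply/matrixP => a b; rewrite [RHS]mxE BQ [X in _ = _ + X]mxE QA.
  rewrite !mxE (inj_eq enum_val_inj); ring.
rewrite det_1addM_comm; congr (\det _); apply/matrixP => a b.
rewrite [RHS]mxE; case: ifPn => [Sa|nSa]; rewrite mxE.
  rewrite QtB [X in _ + X]mxE QA enum_rankK_in // !mxE enum_rankK_in //; ring.
rewrite [X in _ + X]mxE big1 ?addr0 ?mxE // => j _; rewrite !mxE.
case: eqP => [E|]; last by rewrite mul0r.
by case/negP: nSa; rewrite -E enum_valP.
Qed.

Definition pmin n (S : {set 'I_n}) (A : 'M[R]_n) : R :=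
  \det (\matrix_(a < #|S|, b < #|S|) A (enum_val a) (enum_val b)).

Lemma pminors_sumE n i (A : 'M[R]_n) :
  pminors_sum i A = \sum_(S : {set 'I_n} | #|S| == i) pmin S A.
Proof. by []. Qed.

Lemma pminE n (S : {set 'I_n}) (A : 'M[R]_n) :
  pmin S A = \sum_(s : 'S_n) (-1) ^+ s *
    \prod_i (if i \in S then A i (s i) else (i == s i)%:R).
Proof.
rewrite /pmin det_principal_minor; apply: eq_bigr => s _; congr (_ * _).
by apply: eq_bigr => i _; rewrite mxE.
Qed.

Lemma det_1addZ n (z : R) (A : 'M[R]_n) :
  \det (1%:M + z *: A) = \sum_(S : {set 'I_n}) z ^+ #|S| * pmin S A.
Proof.
under eq_bigr do rewrite pminE mulr_sumr.
rewrite exchange_big; apply: eq_bigr => s _ /=.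
rewrite [RHS](eq_bigr _ (fun S _ => mulrCA _ _ _)) -mulr_sumr; congr (_ * _).
under eq_bigr do rewrite mxE addrC.
rewrite bigA_distr; apply: eq_big => // S _.
rewrite -prodr_const [X in X * _]big_mkcond -big_split /=; apply: eq_bigr => i _.
by rewrite !mxE; case: ifP; rewrite ?mul1r.
Qed.

Lemma det_1addZE n (z : R) (A : 'M[R]_n) :
  \det (1%:M + z *: A) = \sum_(i < n.+1) z ^+ i * pminors_sum i A.
Proof.
rewrite det_1addZ (partition_big (fun S : {set 'I_n} => inord #|S| : 'I_n.+1) xpredT) //=.
apply: eq_bigr => i _; rewrite pminors_sumE mulr_sumr; apply: eq_big => [S|S].
  by rewrite -val_eqE /= inordK // ltnS -[X in (_ <= X)%N]card_ord max_card.
by move/eqP <-; rewrite inordK // ltnS -[X in (_ <= X)%N]card_ord max_card.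
Qed.

Lemma pminors_sum_oversize n i (A : 'M[R]_n) : (n < i)%N -> pminors_sum i A = 0.
Proof.
move=> lt_ni; rewrite /pminors_sum big_pred0 // => S.
apply/negP => /eqP E; move: lt_ni; rewrite -E ltnNge.
by rewrite -[X in (_ <= X)%N]card_ord max_card.
Qed.

End PrincipalMinors.

Lemma pminors_sum_map (R R' : comNzRingType) (f : {rmorphism R -> R'}) n i
    (A : 'M[R]_n) : pminors_sum i (map_mx f A) = f (pminors_sum i A).
Proof.
rewrite /pminors_sum rmorph_sum; apply: eq_bigr => S _.
rewrite -det_map_mx; congr (\det _); by apply/matrixP => a b; rewrite !mxE.
Qed.

(** Through this description every identity for determinants of [1 + z A] passes to all the minor
    sums at once, in particular the invariance under cyclic exchange and conjugation. *)
Lemma pminors_sum_coef (R : comNzRingType) n i (A : 'M[R]_n) :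
  pminors_sum i A = (\det (1%:M + 'X *: map_mx polyC A))`_i.
Proof.
rewrite det_1addZE coef_sum.
under eq_bigr do rewrite pminors_sum_map mulrC coefCM coefXn.
case: (ltnP i n.+1) => [lt_in|lt_ni].
  rewrite (bigD1 (Ordinal lt_in)) //= eqxx mulr1 big1 ?addr0 // => j.
  by rewrite -val_eqE /= eq_sym => /negbTE->; rewrite mulr0.
rewrite pminors_sum_oversize // big1 // => j _.
by rewrite gtn_eqF ?mulr0 // (leq_trans (ltn_ord j)).
Qed.

Lemma pminors_sumMC (R : comNzRingType) m n i (X : 'M[R]_(m, n)) (Y : 'M[R]_(n, m)) :
  pminors_sum i (X *m Y) = pminors_sum i (Y *m X).
Proof.
rewrite !pminors_sum_coef !map_mxM; congr (_`_i).
by rewrite scalemxAl det_1addM_comm scalemxAr.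
Qed.

Lemma pminors_sum_conj (R : comNzRingType) n i (A g g' : 'M[R]_n) :
  g' *m g = 1%:M -> pminors_sum i (g *m A *m g') = pminors_sum i A.
Proof. by move=> gK; rewrite pminors_sumMC mulmxA gK mul1mx. Qed.

(** * Lowest terms of minors near a Jordan matrix *)

Section JordanIndex.
Variables (lam : seq nat) (n : nat).
Hypothesis lam_sum : sumn lam = n.
Hypothesis lam_sorted : sorted geq lam.

(** For the Jordan block sizes [lam], the basis vector of index [a] sits at position [ps a] of block
    [bl a], both counted from 0. *)
Definition bl (a : nat) := reshape_index lam a.
Definition ps (a : nat) := reshape_offset lam a.

Lemma bl_lt (a : 'I_n) : (bl a < size lam)%N.
Proof. by apply: reshape_indexP; rewrite lam_sum. Qed.

Lemma ps_lt (a : 'I_n) : (ps a < nth 0%N lam (bl a))%N.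
Proof. by apply: reshape_offsetP; rewrite lam_sum. Qed.

Lemma bl_ps_inj (a b : 'I_n) : bl a = bl b -> ps a = ps b -> a = b.
Proof.
move=> Eb Ep; apply: val_inj => /=.
by rewrite -(reshape_indexK lam a) -(reshape_indexK lam b) -/(bl a) -/(bl b) Eb -/(ps a) Ep.
Qed.

Lemma vtx_subproof j p : (p < nth 0%N lam j)%N -> (flatten_index lam j p < n)%N.
Proof. by rewrite -lam_sum; apply: flatten_indexP. Qed.

Definition vtx j p (lt_p : (p < nth 0%N lam j)%N) : 'I_n := Ordinal (vtx_subproof lt_p).

Lemma bl_vtx j p (lt_p : (p < nth 0%N lam j)%N) : bl (vtx lt_p) = j.
Proof. exact: flatten_indexKl. Qed.

Lemma ps_vtx j p (lt_p : (p < nth 0%N lam j)%N) : ps (vtx lt_p) = p.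
Proof. exact: flatten_indexKr. Qed.

Lemma vtxE (a : 'I_n) : a = vtx (ps_lt a).
Proof. by apply: bl_ps_inj; rewrite ?bl_vtx ?ps_vtx. Qed.

Lemma val_bl_ps (a : 'I_n) : (a = \sum_(j < bl a) nth 0 lam j + ps a :> nat)%N.
Proof.
rewrite -[LHS](reshape_indexK lam a) /flatten_index -/(bl a) -/(ps a); congr addn.
rewrite sumnE (big_nth 0%N) size_takel ?(ltnW (bl_lt a)) // big_mkord.
by apply: eq_bigr => j _; rewrite nth_take.
Qed.

Lemma nth_lam_anti i j : (i <= j)%N -> (nth 0 lam j <= nth 0 lam i)%N.
Proof.
move=> le_ij; case: (ltnP j (size lam)) => [lt_j|ge_j]; last by rewrite nth_default.
have trans_geq : transitive geq by move=> x y z; rewrite /geq /=; lia.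
have refl_geq : reflexive geq by move=> x; rewrite /geq /=.
by apply: (sorted_leq_nth trans_geq refl_geq) => //; rewrite inE // (leq_ltn_trans le_ij).
Qed.

Definition jedge (a b : 'I_n) := (bl b == bl a) && (ps b == (ps a).+1).

(* The vertices of S without a successor in S: at these rows of the principal
   minor on S the Jordan matrix contributes nothing. *)
Definition jlast (S : {set 'I_n}) := [set a in S | [forall b in S, ~~ jedge a b]].

Lemma card_le_blocks (S : {set 'I_n}) (B : {set 'I_(size lam)}) :
  (forall a, a \in S -> Ordinal (bl_lt a) \in B) ->
  (#|S| <= \sum_(j in B) nth 0 lam j)%N.
Proof.
move=> SB; rewrite -sum1_card (partition_big (fun a => Ordinal (bl_lt a)) (mem B)) //=.
apply: leq_sum => j _; rewrite sum1dep_card.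
have lt_j a : a \in [set a in S | Ordinal (bl_lt a) == j] -> (ps a < nth 0 lam j)%N.
  by rewrite inE => /andP[_ /eqP <-]; apply: ps_lt.
case E: (nth 0 lam j)%N => [|l].
  by rewrite leqn0 cards_eq0; apply/eqP/setP => a; rewrite in_set0; apply/negP => /lt_j; rewrite E.
rewrite -(card_in_imset (f := fun a : 'I_n => inord (ps a) : 'I_l.+1)).
  by rewrite -[X in (_ <= X)%N](card_ord l.+1) max_card.
move=> a b Ha Hb /(congr1 val) /=; rewrite !inordK -?E ?lt_j // => Ep.
apply: bl_ps_inj => //; move: Ha Hb; rewrite !inE => /andP[_ /eqP Ea] /andP[_ /eqP Eb].
by have /(congr1 val) : Ordinal (bl_lt a) = Ordinal (bl_lt b) by rewrite Ea Eb.
Qed.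

(** An index of [B] beyond the range contributes at most the last size in the range and is removed
    by induction; without such an index [B] lies inside the range. *)
Lemma sum_blocks_le (B : {set 'I_(size lam)}) r : (#|B| <= r)%N ->
  (\sum_(j in B) nth 0 lam j <= \sum_(j < r) nth 0 lam j)%N.
Proof.
elim: r B => [|r IH] B.
  by rewrite leqn0 cards_eq0 => /eqP->; rewrite big_set0.
move=> leB; case: (pickP [pred j | (j \in B) && (r <= j)%N]) => [j /andP[Bj ler]|none].
  rewrite (big_setD1 j) //= big_ord_recr /= addnC leq_add ?nth_lam_anti //.
  by apply: IH; move: leB; rewrite (cardsD1 j) Bj.
have noB j : j \in B -> (j < r)%N.
  by move=> Bj; have := none j; rewrite /= Bj /= leqNgt => /negbFE.
rewrite big_ord_recr /= (leq_trans _ (leq_addr _ _)) //.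
have -> : (\sum_(j < r) nth 0 lam j = \sum_(0 <= j < r) nth 0 lam j)%N by rewrite big_mkord.
have -> : (\sum_(j in B) nth 0 lam j = \sum_(0 <= j < size lam | [exists b in B, val b == j]) nth 0 lam j)%N.
  rewrite big_mkord; apply: eq_bigl => j; apply/idP/exists_inP => [Bj|[b Bb /eqP/val_inj<- //]].
  by exists j.
rewrite big_mkcond [X in (_ <= X)%N]big_mkcond /=.
case: (leqP r (size lam)) => le_r.
  rewrite (big_cat_nat _ le_r) //= [X in (_ + X)%N]big_nat_cond [X in (_ + X)%N]big1 ?addn0.
    by apply: leq_sum => j _; case: ifP.
  move=> j; rewrite andbT => /andP[le_rj _]; case: ifP => // /exists_inP[b Bb /eqP E].
  by have := noB _ Bb; rewrite ltnNge E le_rj.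
rewrite [X in (_ <= X)%N](big_cat_nat _ (ltnW le_r)) //= (leq_trans _ (leq_addr _ _)) //.
by apply: leq_sum => j _; case: ifP.
Qed.

(** In each block met by [S] the vertex of largest position belongs to [jlast S]. If there were at
    most [bl i] such blocks, [S] would have no more elements than the first [bl i] blocks together,
    which is at most [i]. *)
Lemma jlast_card (i : 'I_n) (S : {set 'I_n}) : #|S| = i.+1 -> (bl i < #|jlast S|)%N.
Proof.
move=> cS; rewrite ltnNge; apply/negP => leT.
pose B := [set Ordinal (bl_lt a) | a in jlast S].
have SB a : a \in S -> Ordinal (bl_lt a) \in B.
  move=> Sa; pose P := [pred b in S | bl b == bl a].
  have Pa : P a by rewrite /= Sa eqxx.
  case: (arg_maxnP (fun b : 'I_n => ps b) Pa) => b /andP[Sb /eqP Eb] maxb.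
  apply/imsetP; exists b; last by apply: val_inj; rewrite /= Eb.
  rewrite inE Sb /=; apply/forall_inP => c Sc; apply/negP => /andP[/eqP E1 /eqP E2].
  by have := maxb c; rewrite /= Sc E1 Eb eqxx /= E2 => /(_ isT); rewrite ltnn.
have := card_le_blocks SB; rewrite leqNgt cS => /negP; apply.
rewrite ltnS (leq_trans (sum_blocks_le (leq_trans (leq_imset_card _ _) leT))) //.
by rewrite [X in (_ <= X)%N]val_bl_ps leq_addr.
Qed.

Section OverRing.
Variable R : comNzRingType.

Definition Jmx : 'M[R]_n := \matrix_(a, b) (jedge a b)%:R.

(** This is [Delta_(i+1)(J + s Y)] divided by its guaranteed power of [s], written without division
    so that it makes sense over every ring and at [s = 0]. Each row of [jlast S] gives up one factor
    [s]. *)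
Definition Qmin (i : 'I_n) (s : R) (Y : 'M[R]_n) : R :=
  \sum_(S : {set 'I_n} | #|S| == i.+1) s ^+ (#|jlast S| - (bl i).+1) *
  \sum_(t : 'S_n) (-1) ^+ t * \prod_a
    (if a \in S then (if a \in jlast S then Y a (t a) else Jmx a (t a) + s * Y a (t a))
     else (a == t a)%:R).

Lemma pminors_sum_Jmx (i : 'I_n) (s : R) (Y : 'M[R]_n) :
  pminors_sum i.+1 (Jmx + s *: Y) = s ^+ (bl i).+1 * Qmin i s Y.
Proof.
rewrite pminors_sumE mulr_sumr; apply: eq_bigr => S /eqP cS.
rewrite mulrA -exprD subnKC; last exact: jlast_card.
rewrite pminE mulr_sumr; apply: eq_bigr => t _; rewrite mulrCA; congr (_ * _).
(* A permutation that does not preserve [S] contributes 0 to both sides. For the others a row of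
   [jlast S] meets no Jordan entry inside [S], hence is divisible by [s]. *)
case: (boolP [forall a in S, t a \in S]) => [/forall_inP St|].
  have -> : s ^+ #|jlast S| = \prod_a (if a \in jlast S then s else 1).
    by rewrite -big_mkcond prodr_const.
  rewrite -big_split; apply: eq_bigr => a _ /=.
  case: (boolP (a \in S)) => [Sa|nSa]; last by rewrite inE (negbTE nSa) /= mul1r.
  case: ifP => [|_]; last by rewrite mul1r !mxE.
  rewrite inE Sa /= => /forall_inP/(_ _ (St _ Sa)) /negbTE E.
  by rewrite !mxE E add0r.
have out : ~~ [forall a in S, t a \in S] -> exists2 b, b \notin S & t b != b.
  move=> /forall_inPn[a Sa nSta].
  exists (t a) => //; apply/negP => /eqP /perm_inj E.
  by rewrite E Sa in nSta.
move=> /out[b nSb ne]; rewrite (bigD1 b) //= (negbTE nSb) eq_sym (negbTE ne) mul0r.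
by rewrite [X in _ = _ * X](bigD1 b) //= (negbTE nSb) eq_sym (negbTE ne) mul0r mulr0.
Qed.

(* The coefficient of the lowest power of s in Delta_(i+1)(J + s Y); on g_f it is
   kappa_e(^eF_(i+1)). *)
Definition Rmin (i : 'I_n) (Y : 'M[R]_n) : R := Qmin i 0 Y.

End OverRing.

Lemma Jmx_map (R R' : comNzRingType) (f : {rmorphism R -> R'}) :
  map_mx f (Jmx R) = Jmx R'.
Proof. by apply/matrixP => a b; rewrite !mxE rmorph_nat. Qed.

Lemma Qmin_map (R R' : comNzRingType) (f : {rmorphism R -> R'}) i s (Y : 'M[R]_n) :
  Qmin i (f s) (map_mx f Y) = f (Qmin i s Y).
Proof.
rewrite /Qmin rmorph_sum; apply: eq_bigr => S _; rewrite rmorphM rmorphXn; congr (_ * _).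
rewrite rmorph_sum; apply: eq_bigr => t _; rewrite rmorphM rmorph_sign; congr (_ * _).
rewrite rmorph_prod; apply: eq_bigr => a _; case: ifP => _; last by rewrite rmorph_nat.
by case: ifP => _; rewrite -?(Jmx_map f) !mxE // rmorphD rmorphM.
Qed.

Lemma Rmin_map (R R' : comNzRingType) (f : {rmorphism R -> R'}) i (Y : 'M[R]_n) :
  Rmin i (map_mx f Y) = f (Rmin i Y).
Proof. by rewrite /Rmin -Qmin_map rmorph0. Qed.

End JordanIndex.

(** * Jordan normal form of a nilpotent matrix *)

Definition mxpow (R : pzRingType) n (e : 'M[R]_n) k := iter k (mulmx e) 1%:M.

Lemma mxpowS (R : pzRingType) n (e : 'M[R]_n) k : mxpow e k.+1 = e *m mxpow e k.
Proof. by []. Qed.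

Lemma mxpowSr (R : pzRingType) n (e : 'M[R]_n) k : mxpow e k.+1 = mxpow e k *m e.
Proof.
elim: k => [|k IH]; first by rewrite /mxpow /= mulmx1 mul1mx.
by rewrite mxpowS {1}IH mulmxA -mxpowS.
Qed.

Lemma mxpowD (R : pzRingType) n (e : 'M[R]_n) k l : mxpow e (k + l) = mxpow e k *m mxpow e l.
Proof.
elim: k => [|k IH]; first by rewrite mul1mx.
by rewrite addSn !mxpowS IH mulmxA.
Qed.

Lemma mxpow_eq0 (R : pzRingType) n (e : 'M[R]_n) k l :
  mxpow e k = 0 -> (k <= l)%N -> mxpow e l = 0.
Proof. by move=> e0 /subnKC <-; rewrite mxpowD e0 mul0mx. Qed.

Lemma mxpow_intertwine (R : pzRingType) m n (C : 'M[R]_(m, n)) e e' k :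
  C *m e = e' *m C -> C *m mxpow e k = mxpow e' k *m C.
Proof.
move=> CE; elim: k => [|k IH]; first by rewrite mulmx1 mul1mx.
by rewrite mxpowSr mulmxA IH -mulmxA CE mulmxA -mxpowSr.
Qed.

Lemma bl_lshift k lam (a : nat) : (a < k)%N -> bl (k :: lam) a = 0%N /\ ps (k :: lam) a = a.
Proof.
move=> lt_a; have E : flatten_index (k :: lam) 0 a = a by rewrite /flatten_index /=.
by rewrite /bl /ps -[in reshape_index _ _]E -[in reshape_offset _ _]E flatten_indexKl ?flatten_indexKr.
Qed.

Lemma bl_rshift k lam (a : nat) : (a < sumn lam)%N ->
  bl (k :: lam) (k + a) = (bl lam a).+1 /\ ps (k :: lam) (k + a) = ps lam a.
Proof.
move=> lt_a; have E : flatten_index (k :: lam) (bl lam a).+1 (ps lam a) = (k + a)%N.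
  by rewrite -[in RHS](reshape_indexK lam a) /flatten_index /= addnA.
have lt_p : (ps lam a < nth 0 (k :: lam) (bl lam a).+1)%N by apply: reshape_offsetP.
by rewrite -E /bl /ps flatten_indexKl ?flatten_indexKr.
Qed.

Lemma Jmx_cons (R : comNzRingType) k lam r : sumn lam = r ->
  Jmx (k :: lam) (k + r) R = block_mx (\matrix_(a, b) (b == a.+1 :> nat)%:R) 0 0 (Jmx lam r R).
Proof.
move=> sl; apply/matrixP => a b; rewrite !mxE /jedge.
have L (x : 'I_k) := bl_lshift lam (ltn_ord x).
have S (x : 'I_r) := @bl_rshift k lam x (eq_ind_r (fun z => (x < z)%N) (ltn_ord x) sl).
by case: (splitP a) => a' ->; rewrite mxE; case: (splitP b) => b' ->; rewrite !mxE;
   rewrite ?(proj1 (L _)) ?(proj2 (L _)) ?(proj1 (S _)) ?(proj2 (S _)) ?eqSS.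
Qed.

(** Induction on [n], splitting off a block of the largest size. For the nilpotency index [k] choose
    [w] and [xi] with [w e^(k-1) xi = 1]: the rows [w e^p] span a Jordan block, and the row vectors
    killing all [e^q xi] form an [e]-stable complement. The bound on the block sizes by any
    vanishing power is carried along because it makes the list sorted. *)
Theorem nilpotent_Jordan (K : fieldType) n (e : 'M[K]_n) k0 : mxpow e k0 = 0 ->
  exists lam, [/\ sumn lam = n, sorted geq lam, all (fun l => 0 < l)%N lam &
    (forall k, mxpow e k = 0 -> all (fun l => l <= k)%N lam) /\
    exists2 g : 'M[K]_n, g \in unitmx & g *m e = Jmx lam n K *m g].
Proof.
elim/ltn_ind: n e k0 => n IH e k0 e0.
have [n0|n_gt0] := posnP n.
  subst n; exists [::]; split=> //; split=> //; exists 1%:M; first exact: unitmx1.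
  by apply/matrixP => -[].
have [k ek kmin] : exists2 k, mxpow e k = 0 & forall l, mxpow e l = 0 -> (k <= l)%N.
  have ex : exists l, mxpow e l == 0 by exists k0; apply/eqP.
  by case: (ex_minnP ex) => k /eqP ek km; exists k => // l /eqP; apply: km.
have k_gt0 : (0 < k)%N.
  rewrite lt0n; apply/eqP => k0'; move: ek; rewrite k0' /= => /matrixP/(_ (Ordinal n_gt0) (Ordinal n_gt0)).
  by rewrite !mxE eqxx => /eqP; rewrite oner_eq0.
have [w [xi wxi]] : exists (w : 'rV[K]_n) (xi : 'cV[K]_n), w *m mxpow e k.-1 *m xi = 1%:M.
  have nz : mxpow e k.-1 != 0 by apply/eqP => /kmin; case: (k) k_gt0 => //= k' _; rewrite ltnn.
  case/matrix0Pn: nz => i [j nz]; exists (delta_mx 0 i), ((mxpow e k.-1 i j)^-1 *: delta_mx j 0).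
  rewrite -scalemxAr -rowE -colE; apply/matrixP => a b; rewrite !ord1 !mxE mulVf //.
pose U : 'M_(k, n) := \matrix_(p < k) (w *m mxpow e p).
pose V : 'M_(n, k) := \matrix_(i < n, q < k) (mxpow e (k.-1 - q) *m xi) i 0.
have rowU p : row p U = w *m mxpow e p by rewrite rowK.
have colV q : col q V = mxpow e (k.-1 - q) *m xi by apply/colP => i; rewrite !mxE.
have UVE p q : (U *m V) p q = (w *m mxpow e (p + (k.-1 - q)) *m xi) 0 0.
  have aux (A : 'M_(k, n)) (B : 'M_(n, k)) : (A *m B) p q = (row p A *m col q B) 0 0.
    by rewrite !mxE; apply: eq_bigr => j _; rewrite !mxE.
  by rewrite aux rowU colV mxpowD !mulmxA.
(* Entries with [p > q] contain a power of [e] of exponent at least [k], and the diagonal ones are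
   [w e^(k-1) xi = 1]. *)
have UV_unit : U *m V \in unitmx.
  rewrite unitmxE -det_tr det_trig.
    rewrite big1 ?unitr1 // => p _; rewrite mxE UVE subnKC; last by have := ltn_ord p; lia.
    by rewrite wxi mxE.
  apply/is_trig_mxP => q p lt_qp; rewrite mxE UVE (mxpow_eq0 ek) ?mulmx0 ?mul0mx ?mxE //.
  by have := ltn_ord p; lia.
pose N : 'M[K]_k := \matrix_(a, b) (b == a.+1 :> nat)%:R.
have UE : U *m e = N *m U.
  apply/row_matrixP => p; rewrite !row_mul rowU -mulmxA -mxpowSr.
  case: (ltnP p.+1 k) => [lt_p|ge_p].
    have -> : row p N = delta_mx 0 (Ordinal lt_p) by apply/rowP => b; rewrite !mxE.
    by rewrite -rowE rowU.
  rewrite (mxpow_eq0 ek) // mulmx0; have -> : row p N = 0; last by rewrite mul0mx.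
  apply/rowP => b; rewrite !mxE; case: eqP => // E; have := ltn_ord b; lia.
have kerVe : (kermx V *m e <= kermx V)%MS.
  apply/sub_kermxP/matrixP => i q; rewrite -mulmxA.
  suff /colP/(_ i) : col q (kermx V *m (e *m V)) = 0 by rewrite mxE => ->; rewrite !mxE.
  have -> : col q (kermx V *m (e *m V)) = kermx V *m (e *m col q V) by rewrite !colE !mulmxA.
  rewrite colV [e *m _]mulmxA -mxpowS.
  have [q0|q_gt0] := posnP q.
    have -> : (k.-1 - q).+1 = k by lia.
    by rewrite ek mul0mx mulmx0.
  have lt_q : (q.-1 < k)%N by have := ltn_ord q; lia.
  have -> : (k.-1 - q).+1 = (k.-1 - q.-1)%N by have := ltn_ord q; lia.
  by rewrite -(colV (Ordinal lt_q)) colE mulmxA mulmx_ker mul0mx.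
have rkV : \rank V = k.
  apply/eqP; rewrite eqn_leq rank_leq_col /=.
  by have := mxrankM_maxr U V; rewrite (mxrank_unit UV_unit).
have [r [C [En CV Cfree CE]]] : exists r (C : 'M[K]_(r, n)),
   [/\ (k + r)%N = n, C *m V = 0, row_free C & (C *m e <= C)%MS].
  exists (\rank (kermx V)), (row_base (kermx V)); split.
  - by rewrite mxrank_ker rkV subnKC // -{1}rkV rank_leq_row.
  - by apply/sub_kermxP; rewrite eq_row_base.
  - exact: row_base_free.
  - by rewrite eq_row_base (submx_trans _ kerVe) // submxMr ?eq_row_base.
clearbody U V; move: En => En; subst n.
pose G := col_mx U C.
have G_unit : G \in unitmx.
  rewrite -row_free_unit; apply/row_freeP.
  suff : row_free G by move/row_freeP.
  rewrite -kermx_eq0; apply/eqP/row_matrixP => i; rewrite row0.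
  set x := row i _; have : x *m G = 0 by rewrite -row_mul mulmx_ker row0.
  rewrite -[x]hsubmxK mul_row_col => E.
  have lx : lsubmx x = 0.
    have /(congr1 (mulmx^~ V)) := E; rewrite /= mulmxDl -!mulmxA CV mulmx0 addr0 mul0mx.
    by move/(congr1 (mulmx^~ (invmx (U *m V)))); rewrite /= mulmxK // mul0mx.
  move: E; rewrite lx mul0mx add0r => /(congr1 (mulmx^~ (pinvmx C))).
  by rewrite /= mul0mx mulmxKp // => ->; rewrite row_mx0.
pose e' := C *m e *m pinvmx C.
have CE' : C *m e = e' *m C by rewrite mulmxKpV.
have pow' l : mxpow e l = 0 -> mxpow e' l = 0.
  move=> el; have /(congr1 (mulmx^~ (pinvmx C))) := mxpow_intertwine l CE'.
  by rewrite /= el mulmx0 mul0mx mulmxKp.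
clearbody e'.
have [|lam [slam sort_lam pos_lam [le_lam [g g_unit gE]]]] := IH r _ e' k (pow' _ ek).
  by rewrite -[X in (X < _)%N]add0n ltn_add2r.
exists (k :: lam); split => /=.
- by rewrite slam.
- rewrite path_sortedE; last by move=> x y z; rewrite /geq /=; lia.
  by rewrite sort_lam andbT; apply: le_lam; apply: pow'.
- by rewrite k_gt0.
split=> [l el|].
  by rewrite kmin //=; apply: le_lam; apply: pow'.
exists (block_mx 1%:M 0 0 g *m G).
  rewrite unitmx_mul G_unit andbT unitmxE det_ublock det1 mul1r -unitmxE //.
rewrite (Jmx_cons _ k slam) -mulmxA /G mul_col_mx UE CE' !mul_block_col.
by rewrite !mul0mx !mul1mx ?mulmx1 ?mulmx0 ?addr0 !add0r !mulmxA gE.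
Qed.

(** * Substitution in multivariate polynomials *)

Lemma mpoly_ring_ind (R : comNzRingType) n (P : {mpoly R[n]} -> Prop) :
  (forall c, P c%:MP) -> (forall i, P 'X_i) ->
  (forall p q, P p -> P q -> P (p + q)) -> (forall p q, P p -> P q -> P (p * q)) ->
  forall p, P p.
Proof.
move=> PC PX PD PM p; elim/mpolyind: p => [|c m p _ _ IH]; first by rewrite -mpolyC0.
apply: (PD) => //; rewrite -mul_mpolyC; apply: (PM) => //.
rewrite mpolyXE_id; apply: (big_ind P) => [|q r|i _]; [by rewrite -mpolyC1|exact: PM|].
by elim: (m i) => [|k IHk]; rewrite ?expr0 -?mpolyC1 ?exprS //; apply: PM.
Qed.

Lemma mpoly_ext (R : comNzRingType) (S : comNzRingType) n (f g : {rmorphism {mpoly R[n]} -> S}) :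
  (forall c, f c%:MP = g c%:MP) -> (forall i, f 'X_i = g 'X_i) -> f =1 g.
Proof.
move=> eqC eqX; apply: mpoly_ring_ind => // p q Ep Eq.
  by rewrite !rmorphD Ep Eq.
by rewrite !rmorphM Ep Eq.
Qed.

Lemma mmapXU (R S : comNzRingType) n (h : 'I_n -> S) (f : {rmorphism R -> S}) i :
  mmap f h 'X_i = h i.
Proof. by rewrite mmapX mmap1U. Qed.

Lemma rmorph_mmap (R S S' : comNzRingType) n (h : 'I_n -> S) (f : {rmorphism R -> S})
    (g : {rmorphism S -> S'}) (h' : 'I_n -> S') (f' : {rmorphism R -> S'}) p :
  (forall c, g (f c) = f' c) -> (forall i, g (h i) = h' i) ->
  g (mmap f h p) = mmap f' h' p.
Proof.
move=> Ef Eh.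
apply: (mpoly_ext (f := g \o mmap f h) (g := mmap f' h')) => [c|i] /=.
  by rewrite !mmapC Ef.
by rewrite !mmapXU Eh.
Qed.

(* Locked, since otherwise unification unfolds it into a sum over the support. *)
HB.lock Definition msub (R : comNzRingType) n m (h : 'I_n -> {mpoly R[m]}) (p : {mpoly R[n]}) :
  {mpoly R[m]} := mmap (@mpolyC m R) h p.

Section MsubMorphism.
Variables (R : comNzRingType) (n m : nat) (h : 'I_n -> {mpoly R[m]}).

Fact msub_zmod_morphism : zmod_morphism (msub h).
Proof. by move=> p q; rewrite msub.unlock rmorphB. Qed.

Fact msub_monoid_morphism : monoid_morphism (msub h).
Proof. by split=> [|p q]; rewrite msub.unlock ?rmorph1 ?rmorphM. Qed.

HB.instance Definition _ := GRing.isZmodMorphism.Build _ _ (msub h) msub_zmod_morphism.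
HB.instance Definition _ := GRing.isMonoidMorphism.Build _ _ (msub h) msub_monoid_morphism.

End MsubMorphism.

Section Substitution.
Variable R : comNzRingType.

Lemma msubC n m (h : 'I_n -> {mpoly R[m]}) c : msub h c%:MP = c%:MP.
Proof. by rewrite msub.unlock mmapC. Qed.

Lemma msubX n m (h : 'I_n -> {mpoly R[m]}) i : msub h 'X_i = h i.
Proof. by rewrite msub.unlock mmapXU. Qed.

Lemma msubD n m (h : 'I_n -> {mpoly R[m]}) p q : msub h (p + q) = msub h p + msub h q.
Proof. exact: rmorphD. Qed.

Lemma msubM n m (h : 'I_n -> {mpoly R[m]}) p q : msub h (p * q) = msub h p * msub h q.
Proof. exact: rmorphM. Qed.

Lemma mevalXi n (v : 'I_n -> R) i : ('X_i).@[v] = v i.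
Proof. exact: mevalXU. Qed.

Lemma msub_meval n m (h : 'I_n -> {mpoly R[m]}) p v :
  (msub h p).@[v] = p.@[fun i => (h i).@[v]].
Proof.
apply: (mpoly_ext (f := meval v \o msub h) (g := meval (fun i => (h i).@[v]))) => [c|i] /=.
  by rewrite msubC !mevalC.
by rewrite msubX mevalXi.
Qed.

Lemma msub_comp n m l (h : 'I_n -> {mpoly R[m]}) (g : 'I_m -> {mpoly R[l]}) p :
  msub g (msub h p) = msub (fun i => msub g (h i)) p.
Proof.
apply: (mpoly_ext (f := msub g \o msub h) (g := msub (fun i => msub g (h i)))) => [c|i] /=.
  by rewrite !msubC.
by rewrite !msubX.
Qed.

Lemma msub_id n (h : 'I_n -> {mpoly R[n]}) p : (forall i, h i = 'X_i) -> msub h p = p.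
Proof.
by move=> E; apply: (mpoly_ext (f := msub h) (g := idfun)) => [c|i] /=; rewrite ?msubC ?msubX.
Qed.

Lemma eq_msub n m (h g : 'I_n -> {mpoly R[m]}) p : h =1 g -> msub h p = msub g p.
Proof.
by move=> E; apply: (mpoly_ext (f := msub h) (g := msub g)) => [c|i] /=; rewrite ?msubC ?msubX.
Qed.

Lemma comp_mpoly_msub n m (lq : n.-tuple {mpoly R[m]}) p : p \mPo lq = msub (tnth lq) p.
Proof. by rewrite msub.unlock. Qed.

(** The equation [zvar j G = G] serves throughout to say that ['X_j] does not occur in [G]. *)
Definition zvar n (j : 'I_n) : {mpoly R[n]} -> {mpoly R[n]} :=
  msub (fun i => if i == j then 0 else 'X_i).
HB.instance Definition _ n (j : 'I_n) :=
  GRing.RMorphism.copy (zvar j) (msub (fun i => if i == j then 0 else 'X_i : {mpoly R[n]})).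

Lemma zvarX n (j i : 'I_n) : zvar j 'X_i = if i == j then 0 else 'X_i.
Proof. exact: msubX. Qed.

Lemma zvarC n (j : 'I_n) c : zvar j c%:MP = c%:MP.
Proof. exact: msubC. Qed.

Lemma zvar_comm n (j i : 'I_n) p : zvar j (zvar i p) = zvar i (zvar j p).
Proof.
apply: (mpoly_ext (f := zvar j \o zvar i) (g := zvar i \o zvar j)) => [c|l] /=.
  by rewrite !zvarC.
rewrite !zvarX; case: eqP => [->|]; rewrite ?rmorph0 ?zvarX.
  by case: ifP => _; rewrite ?rmorph0 ?zvarX ?eqxx.
by move/eqP/negbTE=> ne; case: ifP => _; rewrite ?rmorph0 ?zvarX ?ne.
Qed.

Lemma zvar_idem n (j : 'I_n) p : zvar j (zvar j p) = zvar j p.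
Proof.
apply: (mpoly_ext (f := zvar j \o zvar j) (g := zvar j)) => [c|l] /=.
  by rewrite !zvarC.
by rewrite !zvarX; case: ifP => ne; rewrite ?rmorph0 ?zvarX ?ne.
Qed.

Lemma zvar_split n (j : 'I_n) p : exists H, p = zvar j p + 'X_j * H.
Proof.
apply: (mpoly_ring_ind (P := fun p => exists H, p = zvar j p + 'X_j * H)) => {p}.
- by move=> c; exists 0; rewrite zvarC mulr0 addr0.
- move=> i; rewrite zvarX; case: eqP => [->|_]; last by exists 0; rewrite mulr0 addr0.
  by exists 1; rewrite mulr1 add0r.
- move=> p q [H Ep] [H' Eq]; exists (H + H').
  rewrite rmorphD mulrDr {1}Ep {1}Eq; ring.
- move=> p q [H Ep] [H' Eq]; exists (zvar j p * H' + H * zvar j q + 'X_j * H * H').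
  rewrite rmorphM {1}Ep {1}Eq; ring.
Qed.

Lemma zvar_const n (G : {mpoly R[n]}) : (forall i, zvar i G = G) -> G = (G.@[fun=> 0])%:MP.
Proof.
move=> zG.
have E k : msub (fun i : 'I_n => if (i < k)%N then 0 else 'X_i : {mpoly R[n]}) G = G.
  elim: k => [|k IHk]; first by apply: msub_id.
  case: (ltnP k n) => [lt_k|ge_k]; last first.
    rewrite -[RHS]IHk; apply: eq_msub => i.
    by rewrite (leq_trans (ltn_ord i)) ?(leq_trans (ltn_ord i) ge_k) // ltnW // ltnS.
  rewrite -[RHS](zG (Ordinal lt_k)) // -[in RHS]IHk /zvar msub_comp; apply: eq_msub => i.
  rewrite ltnS leq_eqVlt; case: (ltnP i k) => [_|ge]; rewrite ?orbT ?rmorph0 // orbF msubX.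
  by rewrite -val_eqE.
rewrite -[LHS](E n).
apply: (mpoly_ext (f := msub (fun i : 'I_n => if (i < n)%N then 0 else 'X_i : {mpoly R[n]}))
  (g := @mpolyC n R \o meval (fun=> 0))) => [c|i] /=; first by rewrite msubC mevalC.
by rewrite msubX mevalXi ltn_ord mpolyC0.
Qed.

End Substitution.

Section Peel.
Variable K : fieldType.

(** The full power of ['X_j] is extracted, so that [G0] is a nonzero polynomial free of ['X_j];
    variables absent from [G] stay absent from [G0]. Inductions on the variables run through
    [G0]. *)
Lemma mpoly_peel n (j : 'I_n) (G : {mpoly K[n]}) : G != 0 ->
  exists a G0 H, [/\ G = 'X_j ^+ a * (G0 + 'X_j * H), G0 != 0, zvar j G0 = G0 &
    forall i, zvar i G = G -> zvar i G0 = G0].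
Proof.
elim: {G}_.+1 {-2}G (ltnSn (msize G)) => // s IH G lt_s nzG.
have [H E] := zvar_split j G.
have [z0|nz] := eqVneq (zvar j G) 0; last first.
  exists 0%N, (zvar j G), H; rewrite expr0 mul1r -E zvar_idem; split=> // i Ei.
  by rewrite zvar_comm Ei.
rewrite z0 add0r in E.
have nzH : H != 0 by apply: contraNneq nzG => H0; rewrite E H0 mulr0.
have nzX : 'X_j != 0 :> {mpoly K[n]} by rewrite -msupp_eq0 msuppX.
have [|a [G0 [H' [EH nz0 z0' zi]]]] := IH H _ nzH.
  by move: lt_s; rewrite {1}E msizeM // msizeX mdeg1 /=.
exists a.+1, G0, H'; split=> //; first by rewrite {1}E {1}EH exprS mulrA.
move=> i Ei; have [->//|ne] := eqVneq i j; apply: zi; apply: (mulfI nzX).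
by rewrite -[RHS]E -Ei E rmorphM /= zvarX eq_sym (negbTE ne).
Qed.

Hypothesis K_inf : exists u : nat -> K, injective u.

Lemma poly_nonroot (p : {poly K}) : p != 0 -> exists t, p.[t] != 0.
Proof.
move=> nz; have [u u_inj] := K_inf.
have [rts|] := boolP (all (root p) [seq u i | i <- iota 0 (size p)]).
  have := max_poly_roots nz rts; rewrite map_inj_uniq ?iota_uniq //.
  by rewrite size_map size_iota ltnn => /(_ isT).
by case/allPn => x _ nr; exists x.
Qed.

Lemma poly_all0 (p : {poly K}) : (forall t, p.[t] = 0) -> p = 0.
Proof.
move=> p0; apply/eqP; apply: contraT => /poly_nonroot[t].
by rewrite p0 eqxx.
Qed.

(** Induction on the variables that occur: at a point where [G0] does not vanish, the remaining
    factor becomes a univariate polynomial with nonzero constant term. *)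
Lemma mpoly_all0 n (p : {mpoly K[n]}) : (forall x, p.@[x] = 0) -> p = 0.
Proof.
suff aux (j : nat) (G : {mpoly K[n]}) : (forall i : 'I_n, (j <= i)%N -> zvar i G = G) ->
    G != 0 -> exists x, G.@[x] != 0.
  move=> p0; apply/eqP; apply: contraT => nz.
  have [i|x] := aux n p _ nz; first by rewrite leqNgt ltn_ord.
  by rewrite p0 eqxx.
elim: j G => [|j IH] G zG nzG.
  exists (fun=> 0); rewrite -(mpolyC_eq0 n).
  by rewrite -zvar_const // => i; apply: zG.
case: (ltnP j n) => [lt_j|ge_j]; last first.
  by apply: IH => // i le_ji; move: (leq_trans ge_j le_ji); rewrite leqNgt ltn_ord.
pose o := Ordinal lt_j.
have [a [G0 [H [E nz0 z0 zi]]]] := mpoly_peel o nzG.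
have [|x nzx] := IH G0 _ nz0.
  move=> i; rewrite leq_eqVlt => /orP[/eqP E'|lt_ji]; last by apply: zi; apply: zG.
  by have -> : i = o by apply: val_inj.
pose v i : {poly K} := if i == o then 'X else (x i)%:P.
pose g := mmap (@polyC K) v (G0 + 'X_o * H).
have gE t : g.[t] = (G0 + 'X_o * H).@[fun i => if i == o then t else x i].
  rewrite -[g.[t]]/(horner_eval t g); apply: rmorph_mmap => [c|i]; rewrite /= /horner_eval ?hornerC //.
  by rewrite /v; case: (i == o); rewrite ?hornerX ?hornerC.
have G0x t : G0.@[fun i => if i == o then t else x i] = G0.@[x].
  rewrite -z0 /zvar !msub_meval; apply: meval_eq => i.
  by case: ifP => ne; rewrite ?meval0 // !mevalXi ne.
have nzg : g != 0.
  apply: contraNneq nzx => g0; have := gE 0.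
  rewrite g0 horner0 rmorphD rmorphM /= mevalXi eqxx mul0r addr0 G0x => <- //.
(* The extra factor ['X] makes [t] nonzero, so that the extracted power of ['X_o] does not vanish
   either. *)
have [t nzt] : exists t, ('X * g).[t] != 0.
  by apply: poly_nonroot; rewrite mulf_neq0 ?polyX_eq0.
exists (fun i => if i == o then t else x i).
move: nzt; rewrite hornerM hornerX gE E rmorphM rmorphXn /= mevalXi eqxx mulf_eq0 negb_or.
by case/andP=> nzt nzg'; rewrite mulf_neq0 ?expf_neq0.
Qed.

End Peel.

(** * Regular sequences *)

Section Ideals.
Variable A : comNzRingType.
Implicit Types (I J : A -> Prop) (p q y : A) (ys : seq A).

Definition isid I := [/\ I 0, forall p q, I p -> I q -> I (p + q) & forall p q, I q -> I (p * q)].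

Lemma isidN I p : isid I -> I p -> I (- p).
Proof. by case=> _ _ IM Ip; rewrite -mulN1r; apply: IM. Qed.

Lemma isidB I p q : isid I -> I p -> I q -> I (p - q).
Proof. by move=> idI Ip Iq; case: (idI) => _ ID _; apply: ID => //; apply: isidN. Qed.

Lemma isid_sum I (T : Type) (r : seq T) (P : pred T) (F : T -> A) : isid I ->
  (forall i, P i -> I (F i)) -> I (\sum_(i <- r | P i) F i).
Proof. by move=> [I0 ID _] IF; apply: big_ind. Qed.

Lemma isid_congrD I p p' q q' : isid I -> I (p - p') -> I (q - q') -> I (p + q - (p' + q')).
Proof. by move=> [_ ID _] Ip Iq; rewrite opprD addrACA; apply: ID. Qed.

Lemma isid_congrM I p p' q q' : isid I -> I (p - p') -> I (q - q') -> I (p * q - p' * q').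
Proof.
move=> [_ ID IM] Ip Iq.
have -> : p * q - p' * q' = q * (p - p') + p' * (q - q') by ring.
by apply: ID; apply: IM.
Qed.

(** Ideals are predicates and quotients are never formed: [add1 I y] is the ideal [I + (y)], and
    properties of the quotient by [I] are stated modulo [I]. *)
Definition add1 I y p := exists q, I (p - q * y).
Definition addl I ys := foldl add1 I ys.
Definition nzd I y := forall p, I (p * y) -> I p.
(** Properness of the ideals is not part of the condition, so every sequence is regular modulo the
    unit ideal. This lets an induction over the factors of a product start with the empty
    product. *)
Fixpoint regl I ys := if ys is y :: ys' then nzd I y /\ regl (add1 I y) ys' else True.

Lemma add1_id I y : isid I -> isid (add1 I y).
Proof.
move=> [I0 ID IM]; split=> [|p q [r Ir] [s Is]|p q [r Ir]].
- by exists 0; rewrite mul0r subr0.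
- by exists (r + s); have -> : p + q - (r + s) * y = (p - r * y) + (q - s * y); [ring|apply: ID].
- by exists (p * r); rewrite -mulrA -mulrBr; apply: IM.
Qed.

Lemma add1_sub I y p : isid I -> I p -> add1 I y p.
Proof. by move=> _ Ip; exists 0; rewrite mul0r subr0. Qed.

Lemma add1_self I y : isid I -> add1 I y y.
Proof. by move=> [I0 _ _]; exists 1; rewrite mul1r subrr. Qed.

Lemma add1_ext I J y : (forall p, I p <-> J p) -> forall p, add1 I y p <-> add1 J y p.
Proof. by move=> E p; split=> -[q /E]; exists q. Qed.

Lemma regl_ext I J ys : (forall p, I p <-> J p) -> regl I ys -> regl J ys.
Proof.
elim: ys I J => //= y ys IH I J E [nz rg]; split; first by move=> p /E /nz /E.
by apply: IH rg; apply: add1_ext.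
Qed.

Lemma addl_ext I J ys : (forall p, I p <-> J p) -> forall p, addl I ys p <-> addl J ys p.
Proof. by elim: ys I J => //= y ys IH I J E; apply: IH; apply: add1_ext. Qed.

Lemma addl_id I ys : isid I -> isid (addl I ys).
Proof. by elim: ys I => //= y ys IH I idI; apply/IH/add1_id. Qed.

Lemma addl_sub I ys p : isid I -> I p -> addl I ys p.
Proof. by elim: ys I => //= y ys IH I idI Ip; apply: IH; [apply: add1_id|apply: add1_sub]. Qed.

Lemma addl_mem I ys y : isid I -> y \in ys -> addl I ys y.
Proof.
elim: ys I => //= z ys IH I idI; rewrite inE => /predU1P[->|]; last exact/IH/add1_id.
by apply: addl_sub; [apply: add1_id|apply: add1_self].
Qed.

Lemma addlP I ys p : isid I ->
  addl I ys p <-> exists q : nat -> A, I (p - \sum_(i < size ys) q i * ys`_i).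
Proof.
elim: ys I p => [|y ys IH] I p idI /=.
  by split=> [Ip|[q]]; [exists (fun=> 0)|]; rewrite big_ord0 subr0.
split=> [/(IH _ _ (add1_id y idI))[q [r Ir]]|[q]].
  exists (fun i => if i is i'.+1 then q i' else r); rewrite big_ord_recl /=.
  by rewrite opprD addrA addrAC.
rewrite big_ord_recl opprD addrA addrAC => Iq; apply/(IH _ _ (add1_id y idI)).
by exists (fun i => q i.+1), (q 0%N).
Qed.

Lemma add1C I a b p : add1 (add1 I a) b p <-> add1 (add1 I b) a p.
Proof. by split=> -[q [r Ir]]; exists r, q; rewrite addrAC. Qed.

Lemma add1_mulC_sub I a b p : isid I -> add1 I (a * b) p -> add1 I b p.
Proof. by move=> idI [q Iq]; exists (q * a); rewrite -mulrA. Qed.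

(** Exactness of [0 -> A/I -> A/L -> A/J -> 0], where the first map is multiplication by [b] and the
    second one the projection. *)
Definition ex3 (I J L : A -> Prop) b :=
  [/\ forall p, L p -> J p, forall q, L (b * q) <-> I q, forall q, J (b * q) &
      forall p, J p -> exists q, L (p - b * q)].

(** The snake lemma for multiplication by [y]: exactness survives reduction modulo [y] because [y]
    has no kernel on [A/J]. *)
Lemma ex3_add1 I J L b y : isid I -> isid J -> isid L -> ex3 I J L b -> nzd J y ->
  ex3 (add1 I y) (add1 J y) (add1 L y) b.
Proof.
move=> idI idJ idL [LJ bLI bJ JL] nzJ; split.
- by move=> p [q /LJ]; exists q.
- move=> q; split=> -[r].
    move=> Lr; have Jr : J r.
      apply: nzJ; rewrite -(subKr (b * q) (r * y)); apply: isidB => //; exact: LJ.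
    have [r' Lr'] := JL _ Jr; exists r'; apply/bLI.
    have -> : b * (q - r' * y) = (b * q - r * y) + y * (r - b * r') by ring.
    by case: idL => _ LD LM; apply: LD => //; apply: LM.
  by move=> /bLI Lr; exists (b * r); rewrite -mulrA -mulrBr.
- by move=> q; apply: add1_sub.
- move=> p [r /JL[q Lq]]; exists q, r; by rewrite addrAC.
Qed.

Lemma ex3_nzd I J L b y : isid J -> isid L -> ex3 I J L b -> nzd I y -> nzd J y -> nzd L y.
Proof.
move=> idJ idL [LJ bLI bJ JL] nzI nzJ p Lp.
have [q Lq] := JL _ (nzJ _ (LJ _ Lp)).
rewrite -(subrK (b * q) p); case: (idL) => _ LD LM; apply: LD => //; apply/bLI/nzI/bLI.
have -> : b * (q * y) = p * y - y * (p - b * q) by ring.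
by apply: isidB => //; apply: LM.
Qed.

Lemma ex3_regl I J L b ys : isid I -> isid J -> isid L -> ex3 I J L b ->
  regl I ys -> regl J ys -> regl L ys.
Proof.
elim: ys I J L => //= y ys IH I J L idI idJ idL E [nzI rI] [nzJ rJ].
split; first exact: (ex3_nzd idJ idL E).
by apply: (IH (add1 I y) (add1 J y)) => //; rewrite ?[isid _]add1_id //; try exact: add1_id; apply: ex3_add1.
Qed.

(** Once the sequence is reduced modulo [ys], [w] maps the middle term into the image of the left
    one, and [u] kills the left one. *)
Lemma ex3_mul I J L b ys u w : isid I -> isid J -> isid L -> ex3 I J L b ->
  regl J ys -> addl I ys u -> addl J ys w -> addl L ys (u * w).
Proof.
elim: ys I J L => [|y ys IH] I J L idI idJ idL E /=.
  move=> _ Iu Jw; case: E => _ bLI _ JL; have [q Lq] := JL _ Jw.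
  have -> : u * w = u * (w - b * q) + b * (q * u) by ring.
  case: (idI) => _ _ IM; case: (idL) => _ LD LM; apply: LD; first exact: LM.
  by apply/bLI/IM.
by move=> [nzJ rJ]; apply: IH => //; try exact: add1_id; apply: ex3_add1.
Qed.

Lemma ex3_prod I a b : isid I -> nzd I b -> ex3 (add1 I a) (add1 I b) (add1 I (a * b)) b.
Proof.
move=> idI nzb; split.
- by move=> p; apply: add1_mulC_sub.
- move=> q; split=> -[r Ir]; exists r.
    by apply: nzb; have -> : (q - r * a) * b = b * q - r * (a * b) by ring.
  have -> : b * q - r * (a * b) = b * (q - r * a) by ring.
  by case: idI => _ _; apply.
- by move=> q; exists q; rewrite mulrC subrr; case: idI.
- by move=> p [q Iq]; exists q, 0; rewrite mul0r subr0 mulrC.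
Qed.

(** Membership in the radical of [I]. *)
Definition pwin I p := exists D, I (p ^+ D).

Lemma regl_prod I a b ys : isid I -> regl I (a :: ys) -> regl I (b :: ys) -> regl I (a * b :: ys).
Proof.
move=> idI [nza ra] [nzb rb]; split=> [p|].
  by rewrite mulrA => /nzb /nza.
by apply: ex3_regl (ex3_prod a idI nzb) ra rb; apply: add1_id.
Qed.

Lemma pwin_prod I a b ys p : isid I -> regl I (a :: ys) -> regl I (b :: ys) ->
  pwin (addl I (a :: ys)) p -> pwin (addl I (b :: ys)) p -> pwin (addl I (a * b :: ys)) p.
Proof.
move=> idI [nza ra] [nzb rb] [D ID] [D' ID']; exists (D + D')%N; rewrite exprD.
by apply: ex3_mul (ex3_prod a idI nzb) rb ID ID'; apply: add1_id.
Qed.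

Definition isprime I := [/\ isid I, ~ I 1 & forall p q, I (p * q) -> I p \/ I q].

Lemma isprime_exp I p k : isprime I -> I (p ^+ k) -> I p.
Proof.
move=> [_ I1 Ip]; elim: k => [/I1//|k IH]; rewrite exprS => /Ip[]//.
Qed.

(* Zorn: an ideal maximal among those disjoint from a multiplicative set is prime. *)
Lemma prime_avoiding J (M : A -> Prop) : isid J -> M 1 ->
  (forall p q, M p -> M q -> M (p * q)) -> (forall p, J p -> ~ M p) ->
  exists Q, [/\ isprime Q, forall p, J p -> Q p & forall p, Q p -> ~ M p].
Proof.
move=> idJ M1 MM JM.
pose good (I : A -> Prop) := [/\ isid I, forall p, J p -> I p & forall p, I p -> ~ M p].
pose P (I : A -> Prop) := (forall p, ~ I p) \/ good I.
have [] := @classical_sets.Zorn_bigcup A P.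
  move=> F FP Ftot.
  case: (boolp.pselect (exists2 X, F X & good X)) => [[X FX gX]|noX]; last first.
    left=> p [Y FY Yp]; case: (FP _ FY) => [/(_ p)//|gY]; by apply: noX; exists Y.
  have gF Y p : F Y -> Y p -> good Y by move=> FY Yp; case: (FP _ FY) => // /(_ p).
  right; split.
  - split.
    + by exists X => //; case: gX => -[].
    + move=> p q [Y FY Yp] [Z FZ Zq].
      have [[_ YD _] _ _] := gF _ _ FY Yp; have [[_ ZD _] _ _] := gF _ _ FZ Zq.
      by case: (Ftot _ _ FY FZ) => sub; [exists Z => //; apply: ZD; auto|exists Y => //; apply: YD; auto].
    + by move=> p q [Y FY Yq]; exists Y => //; have [[_ _ YM] _ _] := gF _ _ FY Yq; apply: YM.
  - by move=> p Jp; exists X => //; case: gX => _ /(_ _ Jp).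
  - by move=> p [Y FY Yp]; have [_ _] := gF _ _ FY Yp; apply.
move=> Q [PQ maxQ].
have gJ : good J by split.
have gQ : good Q.
  case: PQ => // Q0; case: (maxQ J); last by right.
  by split=> [p /Q0//|/(_ 0)]; case: idJ => J0 _ _ /(_ J0) /Q0.
have [idQ JQ QM] := gQ; exists Q; split=> //; split=> //; first by move=> /QM.
have step p : ~ Q p -> exists2 r, M r & add1 Q p r.
  move=> nQp; apply: boolp.contrapT => none; apply: (maxQ (add1 Q p)).
    split=> [r|sub]; first exact: add1_sub.
    by apply: nQp; apply: sub; apply: add1_self.
  right; split=> [|r /JQ Qr|r Qr Mr]; [exact: add1_id|exact: add1_sub|by apply: none; exists r].
move=> p q Qpq; apply: boolp.contrapT => /boolp.not_orP[/step[r Mr [x Qx]] /step[s Ms [y Qy]]].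
apply: (QM (r * s)); last exact: MM.
have -> : r * s = s * (r - x * p) + x * p * (s - y * q) + x * y * (p * q) by ring.
case: (idQ) => _ QD QMul; apply: (QD); [apply: (QD)|]; exact: QMul.
Qed.

End Ideals.

(** * Homogeneous ideals and permutation of regular sequences *)

Section Graded.
Variables (K : fieldType) (d : nat).
Local Notation S := {mpoly K[d]}.
Implicit Types (p q y : S) (I : S -> Prop).

Definition hc k p : S := pihomog mdeg k p.

Lemma hc_partition p r : (msize p <= r)%N -> p = \sum_(k < r) hc k p.
Proof. exact: pihomog_partitionE. Qed.

Lemma hc_homog k p : hc k p \is k.-homog.
Proof. exact: pihomogP. Qed.

Lemma hcM_homog k e q y : y \is e.-homog -> hc k (q * y) = if (e <= k)%N then hc (k - e) q * y else 0.
Proof.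
move=> hy; rewrite {1}(hc_partition (leqnn (msize q))) mulr_suml /hc raddf_sum /=.
have E (j : 'I_(msize q)) : hc k (hc j q * y) = if (j + e == k)%N then hc j q * y else 0.
  have h := dhomogM (hc_homog j q) hy.
  by case: eqP => [<-|/eqP ne]; [exact: pihomog_dE|exact: (pihomog_ne0 ne h)].
rewrite (eq_bigr _ (fun j _ => E j)); case: leqP => [le_ek|lt_ke]; last first.
  by rewrite big1 // => j _; case: eqP => // H; have := leq_addl j e; lia.
case: (ltnP (k - e) (msize q)) => [lt|ge].
  rewrite (bigD1 (Ordinal lt)) //= subnK // eqxx big1 ?addr0 // => j.
  by rewrite -val_eqE /= => ne; case: eqP => // H; case/eqP: ne; lia.
rewrite big1 => [|j _].
  rewrite -/(hc _ _); suff -> : hc (k - e) q = 0 by rewrite mul0r.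
  rewrite /hc pihomogE big_seq_cond big1 // => m /andP[/msize_mdeg_lt lt /eqP E'].
  by move: lt; rewrite /= in E'; rewrite E'; lia.
by case: eqP => // H; have := ltn_ord j; lia.
Qed.

Definition homI I := forall p k, I p -> I (hc k p).

Lemma homI_add1 I y e : homI I -> y \is e.-homog -> homI (add1 I y).
Proof.
move=> hI hy p k [q Iq]; exists (if (e <= k)%N then hc (k - e) q else 0).
have := hI _ k Iq; rewrite /hc raddfB /= -/(hc k p) -/(hc k (q * y)) (hcM_homog _ _ hy).
by case: ifP; rewrite ?mul0r.
Qed.

Lemma hc_inP I p : isid I -> (forall k, I (hc k p)) -> I p.
Proof.
by move=> idI Ih; rewrite (hc_partition (leqnn (msize p))); apply: isid_sum => // k _.
Qed.

(* Graded Krull intersection: degree k components of multiples of y^r vanish for k < r. *)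
Lemma homI_krull I y e p : isid I -> homI I -> y \is e.-homog -> (0 < e)%N ->
  (forall r, exists q, I (p - q * y ^+ r)) -> I p.
Proof.
move=> idI hI hy e_gt0 Ir; have [q Iq] := Ir (msize p).
apply: hc_inP => // k; case: (ltnP k (msize p)) => [lt_k|ge_k].
  have := hI _ k Iq; rewrite /hc raddfB /= -/(hc k p) -/(hc k (q * _)).
  rewrite (hcM_homog _ _ (dhomogMn _ hy)).
  rewrite [(_ <= k)%N]leqNgt (leq_trans lt_k) ?subr0 //; exact: leq_pmull.
rewrite /hc pihomogE big_seq_cond big1; first by case: idI.
by move=> m /andP[/msize_mdeg_lt lt /eqP E']; rewrite /= in E'; lia.
Qed.

(** If [p b] is in [I], then [p] is a multiple of [a] modulo [I] with a cofactor that is again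
    killed by [b]. Iteration puts [p] into [I + (a^r)] for every [r], and the graded Krull
    intersection applies. *)
Lemma regl_swap I a b ea eb : isid I -> homI I -> a \is ea.-homog -> b \is eb.-homog ->
  (0 < ea)%N -> nzd I a -> nzd (add1 I a) b -> nzd I b /\ nzd (add1 I b) a.
Proof.
move=> idI hI ha hb ea_gt0 nza nzb.
have nzb' : nzd I b.
  move=> p Ipb; apply: (homI_krull idI hI ha ea_gt0) => r.
  suff [q [Iq _]] : exists q, I (p - q * a ^+ r) /\ I (q * b) by exists q.
  elim: r => [|r [q [Iq Iqb]]]; first by exists p; rewrite expr0 mulr1 subrr; case: idI.
  have [q' Iq'] : add1 I a q by apply: nzb; apply: add1_sub.
  exists q'; split.
    have -> : p - q' * a ^+ r.+1 = p - q * a ^+ r + a ^+ r * (q - q' * a) by rewrite exprS; ring.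
    by case: (idI) => _ ID IM; apply: (ID) => //; apply: IM.
  apply: nza; have -> : q' * b * a = q * b - b * (q - q' * a) by ring.
  by apply: isidB => //; case: idI => _ _; apply.
split=> // p [q Iq].
have [r Ir] : add1 I a q.
  apply: nzb; exists p; have -> : q * b - p * a = - (p * a - q * b) by ring.
  exact: isidN.
exists r; apply: nza; have -> : (p - r * b) * a = p * a - q * b + b * (q - r * a) by ring.
by case: (idI) => _ ID IM; apply: (ID) => //; apply: IM.
Qed.

Definition homs (ys : seq S) := forall y, y \in ys -> exists2 e, (0 < e)%N & y \is e.-homog.

Lemma regl_move I xs b ys : isid I -> homI I -> homs (xs ++ b :: ys) ->
  regl I (xs ++ b :: ys) -> regl I (b :: xs ++ ys).
Proof.
elim: xs I => //= x xs IH I idI hI hs [nzx rx].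
have [ex ex_gt0 hx] : exists2 e, (0 < e)%N & x \is e.-homog by apply: hs; rewrite inE eqxx.
have [eb eb_gt0 hb] : exists2 e, (0 < e)%N & b \is e.-homog.
  by apply: hs; rewrite inE mem_cat inE eqxx !orbT.
have [|nzb rb] := IH _ (add1_id x idI) (homI_add1 hI hx) _ rx.
  by move=> y y_in; apply: hs; rewrite inE y_in orbT.
have [nzb' nzx'] := regl_swap idI hI hx hb ex_gt0 nzx nzb.
by split=> //; split=> //; apply: regl_ext rb => p; apply: add1C.
Qed.

Lemma regl_perm I xs ys : isid I -> homI I -> homs xs -> perm_eq xs ys -> regl I xs -> regl I ys.
Proof.
elim: ys xs I => [|y ys IH] xs I idI hI hs pe rx //.
have : y \in xs by rewrite (perm_mem pe) inE eqxx.
move=> y_in; have E := perm_to_rem y_in.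
case/splitPr: y_in pe hs rx E => xs1 xs2 pe hs rx _.
have [nzy ry] := regl_move idI hI hs rx.
have [e _ hy] : exists2 e, (0 < e)%N & y \is e.-homog.
  by apply: hs; rewrite mem_cat inE eqxx orbT.
split=> //; apply: IH ry; [exact: add1_id|exact: homI_add1 hy| |].
  by move=> z; rewrite mem_cat => z_in; apply: hs; rewrite mem_cat inE orbCA z_in orbT.
by move: pe; rewrite perm_catC /= perm_cons perm_catC.
Qed.

(** The quotient by [I] is torsion-free over the polynomials in a regular sequence. In
    [G = X_j^a (G0 + X_j H)] the power cancels, and [G0] acts injectively modulo [ys j] by
    induction; hence everything killed by the second factor is divisible by [ys j] arbitrarily
    often. *)
Lemma regl_free N I (ys : 'I_N -> S) (G : {mpoly K[N]}) p : isid I -> homI I ->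
  (forall i, exists2 e, (0 < e)%N & ys i \is e.-homog) ->
  regl I [seq ys i | i <- enum 'I_N] -> G != 0 -> I (p * msub ys G) -> I p.
Proof.
move=> idI hI hys.
suff aux (s : seq 'I_N) : forall (J : S -> Prop) G p, isid J -> homI J -> regl J [seq ys i | i <- s] ->
    (forall i, i \notin s -> zvar i G = G) -> G != 0 -> J (p * msub ys G) -> J p.
  by move=> rg; apply: (aux (enum 'I_N)) => // i; rewrite mem_enum.
elim: s => [|j s IH] J {}G {}p idJ hJ /=.
  move=> _ zG nz; have [c Ec] : exists c, G = c%:MP.
    by exists G.@[fun=> 0]; apply: zvar_const => i; apply: zG.
  rewrite Ec msubC => Jp; rewrite Ec mpolyC_eq0 in nz.
  have -> : p = c^-1%:MP * (p * c%:MP) by rewrite mulrCA -mpolyCM mulVf ?mulr1.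
  by case: idJ => _ _; apply.
move=> [nzj rj] zG nzG Jp.
have [a [G0 [H [EG nz0 z0 zi]]]] := mpoly_peel j nzG.
have [e e_gt0 he] := hys j.
have {Jp} Jp : J (p * msub ys (G0 + 'X_j * H)).
  move: Jp; rewrite EG rmorphM rmorphXn /= msubX; elim: (a) => [|k IHk]; first by rewrite expr0 mul1r.
  by rewrite exprS -mulrA mulrCA mulrC => /nzj.
have step q : J (q * msub ys (G0 + 'X_j * H)) -> exists q', J (q - q' * ys j) /\ J (q' * msub ys (G0 + 'X_j * H)).
  move=> Jq; have [q' Jq'] : add1 J (ys j) q.
    apply: (IH (add1 J (ys j)) G0) => //; [exact: add1_id|exact: homI_add1 he| |].
      move=> i nsi; have [->//|ne] := eqVneq i j; apply: zi; apply: zG.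
      by rewrite inE negb_or ne.
    exists (- q * msub ys H).
    have -> : q * msub ys G0 - - q * msub ys H * ys j = q * msub ys (G0 + 'X_j * H).
      by rewrite rmorphD rmorphM /= msubX; ring.
    exact: Jq.
  exists q'; split=> //; apply: nzj.
  have -> : q' * msub ys (G0 + 'X_j * H) * ys j =
     q * msub ys (G0 + 'X_j * H) - msub ys (G0 + 'X_j * H) * (q - q' * ys j) by ring.
  by apply: isidB => //; case: idJ => _ _; apply.
apply: (homI_krull idJ hJ he e_gt0) => r.
suff [q [Iq _]] : exists q, J (p - q * ys j ^+ r) /\ J (q * msub ys (G0 + 'X_j * H)) by exists q.
elim: r => [|r [q [Jq Jqb]]]; first by exists p; rewrite expr0 mulr1 subrr; case: idJ.
have [q' [J1 J2]] := step _ Jqb; exists q'; split=> //.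
have -> : p - q' * ys j ^+ r.+1 = p - q * ys j ^+ r + ys j ^+ r * (q - q' * ys j) by rewrite exprS; ring.
by case: (idJ) => _ ID IM; apply: (ID) => //; apply: IM.
Qed.

End Graded.

(** * Linear forms *)

Section RegularHead.
Variable A : comNzRingType.

Lemma regl_total (I : A -> Prop) ys : (forall p, I p) -> regl I ys.
Proof. by elim: ys I => //= y ys IH I It; split=> //; apply: IH => p; exists 0. Qed.

Lemma add1_equiv (I : A -> Prop) y y' c c' : isid I -> I (y - c * y') -> c * c' = 1 ->
  forall p, add1 I y' p <-> add1 I y p.
Proof.
move=> idI Iy cc p; split=> -[q Iq].
  exists (q * c').
  have -> : p - q * c' * y = p - q * y' - q * c' * (y - c * y') - q * (1 - c * c') * - y' by ring.
  rewrite cc subrr mulr0 mul0r subr0; apply: isidB => //; case: idI => _ _; exact.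
exists (q * c); have -> : p - q * c * y' = p - q * y + q * (y - c * y') by ring.
by case: (idI) => _ ID IM; apply: (ID) => //; apply: IM.
Qed.

Lemma nzd_equiv (I : A -> Prop) y y' c c' : isid I -> I (y - c * y') -> c * c' = 1 ->
  nzd I y' -> nzd I y.
Proof.
move=> idI Iy cc nz p Ipy; apply: nz.
have -> : p * y' = c' * (p * y) - c' * p * (y - c * y') + p * y' * (1 - c * c') by ring.
rewrite cc subrr mulr0 addr0; case: (idI) => _ _ IM.
by apply: isidB => //; apply: IM.
Qed.

End RegularHead.

Section LinearTree.
Variables (K : fieldType) (d : nat).
Hypothesis K_inf : exists u : nat -> K, injective u.
Local Notation S := {mpoly K[d]}.
Local Notation pt := ('I_d -> K).

Definition lf (a : pt) (x : pt) : K := \sum_j a j * x j.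
Definition lfp (a : pt) : S := \sum_j a j *: 'X_j.

Lemma meval_lfp a x : (lfp a).@[x] = lf a x.
Proof. by rewrite /lfp rmorph_sum; apply: eq_bigr => j _ /=; rewrite mevalZ mevalXi. Qed.

Lemma lfp_homog a : lfp a \is 1.-homog.
Proof. by apply: rpred_sum => j _; apply: rpredZ; rewrite dhomogX; apply/eqP; exact: mdeg1. Qed.

Lemma lf_line a x y t : lf a (fun i => x i + t * y i) = lf a x + t * lf a y.
Proof. by rewrite /lf mulr_sumr -big_split; apply: eq_bigr => j _ /=; ring. Qed.

Definition vanish (E : pt -> Prop) (p : S) := forall x, E x -> p.@[x] = 0.

Lemma vanish_id E : isid (vanish E).
Proof.
split=> [x _|p q Vp Vq x Ex|p q Vq x Ex]; first exact: meval0.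
  by rewrite rmorphD /= Vp ?Vq ?addr0.
by rewrite rmorphM /= Vq ?mulr0.
Qed.

Definition lin (E : pt -> Prop) := forall x y t, E x -> E y -> E (fun i => x i + t * y i).

Lemma lin_cut E a : lin E -> lin (fun x => E x /\ lf a x = 0).
Proof. by move=> lE x y t [Ex x0] [Ey y0]; rewrite lf_line x0 y0 mulr0 addr0; split=> //; apply: lE. Qed.

(** On the line through [x] in direction [w] the form becomes a nonzero polynomial in the parameter,
    so [p] vanishes identically on that line. *)
Lemma vanish_nzd E a w : lin E -> E w -> lf a w != 0 -> nzd (vanish E) (lfp a).
Proof.
move=> lE Ew nzw p Vp x Ex.
pose line t : pt := fun i => x i + t * w i.
pose g := mmap (@polyC K) (fun i => (x i)%:P + 'X * (w i)%:P) p.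
have gE t : g.[t] = p.@[line t].
  rewrite -[g.[t]]/(horner_eval t g); apply: rmorph_mmap => [c|i]; rewrite /= /horner_eval ?hornerC //.
  by rewrite hornerD hornerM !hornerC hornerX.
suff g0 : g = 0.
  by rewrite -(meval_eq (v1 := line 0)) -?gE ?g0 ?horner0 // => i; rewrite /line mul0r addr0.
pose q := (lf a x)%:P + 'X * (lf a w)%:P.
have nzq : q != 0.
  apply: contraNneq nzw => q0; have := hornerD (lf a x)%:P ('X * (lf a w)%:P) 1.
  have := hornerD (lf a x)%:P ('X * (lf a w)%:P) 0.
  rewrite -/q q0 !horner0 !hornerM !hornerC !hornerX mul0r addr0 mul1r => <-.
  by rewrite add0r => <-.
have : g * q = 0.
  apply: (poly_all0 K_inf) => t; rewrite hornerM gE hornerD hornerM !hornerC hornerX -lf_line.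
  by rewrite -meval_lfp -mevalM; apply: Vp; apply: lE.
by move/eqP; rewrite mulf_eq0 (negbTE nzq) orbF => /eqP.
Qed.

(** The substitution [h] projects along [w] onto the hyperplane and changes [p] only by a multiple
    of [lfp a]; if [p] vanishes on the section, the substituted polynomial vanishes on [E]. *)
Lemma vanish_add1 E a w : lin E -> E w -> lf a w != 0 ->
  forall p, add1 (vanish E) (lfp a) p <-> vanish (fun x => E x /\ lf a x = 0) p.
Proof.
move=> lE Ew nzw p; split=> [[q Vq] x [Ex x0]|Vp].
  by have := Vq _ Ex; rewrite rmorphB rmorphM /= meval_lfp x0 mulr0 subr0.
pose h i : S := 'X_i - (w i / lf a w) *: lfp a.
have [r Er] : exists r, p - msub h p = r * lfp a.
  apply: (mpoly_ring_ind (P := fun p => exists r, p - msub h p = r * lfp a)) => {p Vp}.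
  - by move=> c; exists 0; rewrite msubC subrr mul0r.
  - by move=> i; exists (w i / lf a w)%:MP; rewrite msubX /h mul_mpolyC opprB addrC subrK.
  - move=> p q [r Er] [s Es]; exists (r + s); rewrite rmorphD mulrDl -Er -Es /=; ring.
  - move=> p q [r Er] [s Es]; exists (r * q + msub h p * s).
    rewrite rmorphM /= mulrDl -[_ * s * _]mulrA -Es [r * q * _]mulrAC -Er; ring.
exists r => x Ex; rewrite -Er subKr msub_meval; set z := fun i => _.
have Ez : z = fun i => x i + (- (lf a x / lf a w)) * w i.
  by apply: boolp.funext => i; rewrite /z /h rmorphB /= mevalZ mevalXi meval_lfp; field.
rewrite Ez; apply: Vp; split; first exact: lE.
by rewrite lf_line; field.
Qed.

(* On E each y is a product of linear forms, and this persists for the remaining ys on each of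
   the hyperplane sections of E cut out by these forms; in the end only the origin is left. *)
Fixpoint good (E : pt -> Prop) (ys : seq S) : Prop :=
  if ys is y :: ys' then
    exists (c : K) m (al : 'I_m -> pt),
      [/\ c != 0, forall x, E x -> y.@[x] = c * \prod_i lf (al i) x,
          forall i, exists2 w, E w & lf (al i) w != 0 &
          forall i, good (fun x => E x /\ lf (al i) x = 0) ys']
  else forall x, E x -> forall i, x i = 0.

(** Modulo the vanishing ideal the head is a scalar times a product of linear forms. Each form
    passes to a hyperplane section, where the induction hypothesis holds, and the exact sequences
    for products put the factors together again. *)
Theorem good_regl E ys : lin E -> good E ys ->
  regl (vanish E) ys /\ forall j, pwin (addl (vanish E) ys) 'X_j.
Proof.
elim: ys E => [|y ys IH] E lE.
  by move=> E0; split=> // j; exists 1%N => x Ex; rewrite expr1 mevalXi E0.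
move=> [c [m [al [nzc yE nzal gd]]]].
pose q := \prod_(i <- index_enum 'I_m) lfp (al i).
have idE := vanish_id E.
suff [rq pq] : regl (vanish E) (q :: ys) /\ forall j, pwin (addl (vanish E) (q :: ys)) 'X_j.
  have Vy : vanish E (y - c%:MP * q).
    move=> x Ex; rewrite rmorphB rmorphM /= mevalC yE // /q rmorph_prod /=.
    by rewrite -[X in _ - _ * X](eq_bigr _ (fun i _ => esym (meval_lfp (al i) x))) subrr.
  have cc : c%:MP * (c^-1)%:MP = 1 :> S by rewrite -mpolyCM mulfV.
  have E1 := add1_equiv idE Vy cc.
  split=> [|j].
    by case: rq => nzq rq; split; [exact: nzd_equiv cc nzq|exact: regl_ext rq].
  by have [D HD] := pq j; exists D; apply/(addl_ext ys E1).
(* The empty product generates the unit ideal, where both claims are trivial. *)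
rewrite /q; elim: (index_enum _) => [|i s [IHr IHp]].
  rewrite big_nil.
  have t1 p : add1 (vanish E) 1 p by exists p; rewrite mulr1 subrr; case: idE.
  split=> [|j]; first by split=> [p|]; rewrite ?mulr1 //; apply: regl_total.
  by exists 0%N; exact: (addl_sub ys (add1_id 1 idE) (t1 _)).
have [w Ew nzw] := nzal i.
have [ri pi] : regl (vanish E) (lfp (al i) :: ys) /\
    forall j, pwin (addl (vanish E) (lfp (al i) :: ys)) 'X_j.
  have [r p] := IH _ (lin_cut (a := al i) lE) (gd i).
  have E1 := vanish_add1 lE Ew nzw.
  split=> [|j]; first by split; [exact: vanish_nzd Ew nzw|apply: regl_ext r => z; split=> /E1].
  by have [D HD] := p j; exists D; apply/(addl_ext ys E1).
rewrite big_cons; split=> [|j]; first exact: regl_prod.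
by apply: pwin_prod.
Qed.

End LinearTree.

(** * Integrality and algebraic dependence *)

Section Integrality.
Variables (K : fieldType) (d : nat).
Local Notation S := {mpoly K[d]}.
Variable ys : 'I_d -> S.
Hypothesis hys : forall i, exists2 e, (0 < e)%N & ys i \is e.-homog.
Hypothesis pys : forall j, pwin (addl (fun p => p = 0) [seq ys i | i <- enum 'I_d]) 'X_j.

(** Integrality over [K[ys]]. The coefficients are kept as polynomials before the substitution of
    [ys], so that some of the variables can later be specialized. *)
Definition integ (f : S) := exists2 p : {poly {mpoly K[d]}}, p \is monic &
  (map_poly (msub ys) p).[f] = 0.

Lemma zero_id : isid (fun p : S => p = 0).
Proof. by split=> [//|p q -> ->|p q ->]; rewrite ?addr0 ?mulr0. Qed.

Lemma addl_zero_sum (p : S) : addl (fun p => p = 0) [seq ys i | i <- enum 'I_d] p ->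
  exists q : 'I_d -> S, p = \sum_i q i * ys i.
Proof.
move/(addlP _ _ zero_id) => [q /eqP]; rewrite subr_eq0 => /eqP ->.
rewrite size_map size_enum_ord; exists q; apply: eq_bigr => i _.
by rewrite (nth_map i) ?size_enum_ord // nth_ord_enum.
Qed.

Lemma uniform_power : exists D, forall j, exists q : 'I_d -> S, 'X_j ^+ D.+1 = \sum_i q i * ys i.
Proof.
have [D HD] := fin_all_exists pys; exists (\sum_j D j)%N => j.
apply: addl_zero_sum; rewrite (bigD1 j) //= -addnS exprD mulrC.
by case: (addl_id [seq ys i | i <- enum 'I_d] zero_id) => _ _; apply.
Qed.

(** By induction on the degree the monomials with all exponents at most [D] span the ring over
    [K[ys]]; the Cayley-Hamilton argument for multiplication by [f] then gives a monic equation. *)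
Theorem integral_all f : integ f.
Proof.
have [D HD] := uniform_power.
pose B := {ffun 'I_d -> 'I_D.+1}.
pose mono (b : B) : S := \prod_i 'X_i ^+ (b i).
pose sp (f : S) := exists g : B -> {mpoly K[d]}, f = \sum_b msub ys (g b) * mono b.
have sp0 : sp 0 by exists (fun=> 0); rewrite big1 // => b _; rewrite rmorph0 mul0r.
have spD p q : sp p -> sp q -> sp (p + q).
  move=> [g ->] [g' ->]; exists (fun b => g b + g' b); rewrite -big_split; apply: eq_bigr => b _ /=.
  by rewrite rmorphD mulrDl.
have spM G p : sp p -> sp (msub ys G * p).
  move=> [g ->]; exists (fun b => G * g b); rewrite mulr_sumr; apply: eq_bigr => b _ /=.
  by rewrite rmorphM mulrA.
have sp_sum (T : Type) (r : seq T) (P : pred T) (F : T -> S) :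
    (forall i, P i -> sp (F i)) -> sp (\sum_(i <- r | P i) F i) by move=> H; apply: big_ind.
have spX k m : (mdeg m < k)%N -> sp 'X_[m].
  elim: k m => // k IH m lt_m.
  case: (boolP [forall i, m i < D.+1]%N) => [/forallP small|/forallPn[i ]].
    exists (fun b => (b == [ffun i => inord (m i)])%:R).
    rewrite (bigD1 [ffun i => inord (m i)]) //= eqxx rmorph1 mul1r big1 ?addr0.
      rewrite mpolyXE_id; apply: eq_bigr => i _; rewrite ffunE inordK //.
    by move=> b /negbTE ->; rewrite rmorph0 mul0r.
  rewrite -leqNgt => big_m; have [q Eq] := HD i.
  have le_m : (U_(i) *+ D.+1 <= m)%MM.
    apply/mnm_lepP => j; rewrite mulmnE mnm1E; case: eqP => [<-|]; rewrite ?mul0n ?mul1n //.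
  pose m' := (m - U_(i) *+ D.+1)%MM.
  have Em : 'X_[m] = \sum_l ('X_[m'] * q l) * ys l :> S.
    rewrite -(submK le_m) mpolyXD -mpolyXn Eq mulr_sumr; apply: eq_bigr => l _.
    by rewrite mulrA.
  (* Only the component of degree [mdeg m] counts. There the cofactor of [ys l] has degree
     [mdeg m - e] with [e > 0], so the induction applies to it. *)
  have -> : 'X_[m] = hc (mdeg m) 'X_[m] :> S by rewrite /hc pihomogX eqxx.
  rewrite Em /hc raddf_sum; apply: (sp_sum) => l _ /=.
  have [e e_gt0 he] := hys l; rewrite -/(hc _ _) (hcM_homog _ _ he); case: ifP => // le_e.
  rewrite mulrC -{1}(msubX ys l); apply: (spM).
  rewrite /hc pihomogE; apply: (sp_sum) => m'' /eqP dm''.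
  rewrite -mul_mpolyC -(msubC ys); apply: (spM); apply: IH.
  by rewrite /= in dm''; rewrite dm''; lia.
have spA p : sp p.
  rewrite [p]mpolyE; apply: sp_sum => m _; rewrite -mul_mpolyC -(msubC ys); apply: (spM).
  exact: (spX (mdeg m).+1).
have [M HM] := fin_all_exists (fun b => spA (f * mono b)).
pose Mx : 'M[{mpoly K[d]}]_#|B| := \matrix_(i, j) M (enum_val i) (enum_val j).
pose w : 'cV[S]_#|B| := \col_i mono (enum_val i).
(* Evaluated at [f], the characteristic matrix annihilates the vector [w] of monomials. Its
   determinant therefore annihilates [w] too, and one entry of [w] is 1. *)
exists (char_poly Mx); first exact: char_poly_monic.
pose phi : {rmorphism {poly {mpoly K[d]}} -> S} := horner_eval f \o map_poly (msub ys).
have -> : (map_poly (msub ys) (char_poly Mx)).[f] = phi (char_poly Mx) by [].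
rewrite /char_poly -det_map_mx; set C := map_mx _ _.
have CE : C = f%:M - map_mx (msub ys) Mx.
  apply/matrixP => i j; rewrite !mxE /= rmorphB /= map_polyC /= /horner_eval hornerD hornerN hornerC.
  by case: (i == j); rewrite ?mulr1n ?mulr0n ?map_polyX ?hornerX ?rmorph0 ?horner0.
have Cw : C *m w = 0.
  apply/colP => i; rewrite CE mulmxBl mul_scalar_mx !mxE HM.
  rewrite (reindex (enum_val : 'I_#|B| -> B)) /=; last first.
    by exists enum_rank => b _; rewrite ?enum_rankK ?enum_valK.
  apply/eqP; rewrite subr_eq0; apply/eqP/eq_bigr => j _; by rewrite !mxE.
have : \det C *: w = 0 by rewrite -mul_scalar_mx -mul_adj_mx -mulmxA Cw mulmx0.
move/colP/(_ (enum_rank [ffun=> 0])); rewrite !mxE enum_rankK /mono big1 ?mulr1 // => i _.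
by rewrite ffunE expr0.
Qed.

End Integrality.

(** * Algebraic dependence of [N + 1] polynomials in [N] variables *)

Section AlgDep.
Variable K : fieldType.

Lemma msize_mul_deg n (p q : {mpoly K[n]}) a b : (msize p <= a.+1)%N -> (msize q <= b.+1)%N ->
  (msize (p * q) <= (a + b).+1)%N.
Proof.
move=> pa qb; have [->|nzp] := eqVneq p 0; first by rewrite mul0r msize0.
have [->|nzq] := eqVneq q 0; first by rewrite mulr0 msize0.
by rewrite msizeM //; move: pa qb; move: (msize p) (msize q) => x y; lia.
Qed.

(** A dimension count: the [r^(N+1)] products of powers of the [g k] with exponents below [r] have
    degree below [T = C r], so their coefficient vectors have [T^N] entries. The choice
    [r = C^N + 1] makes [r^(N+1) > (C r)^N]. *)
Lemma algebraic_dependence N (g : 'I_N.+1 -> {mpoly K[N]}) :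
  exists2 G : {mpoly K[N.+1]}, G != 0 & msub g G = 0.
Proof.
pose D := (\max_k msize (g k)).+1.
pose C := (N.+2 * D)%N; pose r := (C ^ N).+1; pose T := (C * r)%N.
pose rows := {ffun 'I_N.+1 -> 'I_r}; pose cols := {ffun 'I_N -> 'I_T}.
pose mon (e : rows) : 'X_{1..N.+1} := [multinom (e k : nat) | k < N.+1].
pose prodg (e : rows) := \prod_k g k ^+ e k.
pose M : 'M[K]_(#|rows|, #|cols|) :=
  \matrix_(i, j) (prodg (enum_val i))@_[multinom ((enum_val j : cols) k : nat) | k < N].
have lt_rc : (#|cols| < #|rows|)%N.
  rewrite !card_ffun !card_ord /T expnMn expnSr mulnC ltn_mul2l ltnSn andbT.
  by rewrite expn_gt0.
have [u nzu uM] : exists2 u : 'rV_#|rows|, u != 0 & u *m M = 0.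
  have nzk : kermx M != 0.
    by rewrite -mxrank_eq0 mxrank_ker -lt0n subn_gt0 (leq_ltn_trans (rank_leq_col M)).
  have /rowV0Pn[u /sub_kermxP uM nzu] := nzk; by exists u.
have D_gt0 : (0 < D)%N by [].
have size_prodg e : (msize (prodg e) <= T)%N.
  have size_pow k (l : 'I_r) : (msize (g k ^+ l) <= (D * l).+1)%N.
    elim: (l : nat) => [|l' IHl]; first by rewrite expr0 msize1.
    rewrite exprS mulnS; apply: msize_mul_deg IHl.
    by apply: leqW; apply: leqW; apply: (leq_bigmax (F := fun k => msize (g k))).
  have : (msize (prodg e) <= (\sum_k D * e k).+1)%N.
    rewrite /prodg; apply: (big_rec2 (fun (p : {mpoly K[N]}) s => (msize p <= s.+1)%N)).
      by rewrite msize1.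
    by move=> k s p _ IHs; apply: msize_mul_deg.
  move/leq_trans; apply; rewrite -big_distrr /=.
  have /leq_sum : forall k : 'I_N.+1, true -> (e k <= r)%N by move=> k _; apply/ltnW/ltn_ord.
  move=> /(_ (index_enum _)); rewrite sum_nat_const card_ord => le_s.
  have E : T = (D * (N.+1 * r) + D * r)%N by rewrite /T /C [(N.+2 * D)%N]mulnC -mulnA mulSn addnC mulnDr.
  have h1 : (D * \sum_k e k <= D * (N.+1 * r))%N by rewrite leq_mul2l le_s orbT.
  have h2 : (0 < D * r)%N by rewrite muln_gt0.
  by rewrite E -addn1 leq_add.
exists (\sum_i u 0 i *: 'X_[mon (enum_val i)]).
  have [i nzi] : exists i, u 0 i != 0 by move/rV0Pn: nzu.
  apply: contraNneq nzi => /(congr1 (mcoeff (mon (enum_val i)))).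
  rewrite mcoeff0 raddf_sum /= (bigD1 i) //= mcoeffZ mcoeffX eqxx mulr1 big1 ?addr0 => [->//|j ne].
  rewrite mcoeffZ mcoeffX; case: eqP => [E|]; last by rewrite mulr0.
  case/eqP: ne; apply: enum_val_inj; apply/ffunP => k; apply: val_inj.
  by have := congr1 (fun m : 'X_{1..N.+1} => m k) E; rewrite !mnmE.
rewrite raddf_sum /=; apply/mpolyP => m; rewrite mcoeff0 raddf_sum /=.
have E i : msub g (u 0 i *: 'X_[mon (enum_val i)]) = u 0 i *: prodg (enum_val i).
  rewrite -mul_mpolyC rmorphM /= msubC mul_mpolyC; congr (_ *: _).
  by rewrite msub.unlock mmapX /mmap1 /prodg; apply: eq_bigr => k _; rewrite mnmE.
under eq_bigr do rewrite E mcoeffZ.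
have [lt_m|ge_m] := ltnP (mdeg m) T.
  have ltk k : (m k < T)%N by rewrite (leq_ltn_trans _ lt_m) // mdegE (bigD1 k) //= leq_addr.
  pose b : cols := [ffun k => Ordinal (ltk k)].
  have H : (u *m M) 0 (enum_rank b) = 0 by rewrite uM mxE.
  rewrite mxE in H; rewrite -[RHS]H; apply: eq_bigr => i _.
  rewrite mxE enum_rankK; congr (_ * _@__); apply/mnmP => k; by rewrite mnmE ffunE.
rewrite big1 // => i _; rewrite memN_msupp_eq0 ?mulr0 //.
by apply: msize_mdeg_ge; apply: leq_trans ge_m.
Qed.

End AlgDep.

(** * Dimension of affine sets *)

Section Descent.
Variables (K : closedFieldType) (d : nat).
Hypothesis K_inf : exists u : nat -> K, injective u.
Local Notation S := {mpoly K[d]}.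
Local Notation pt := ('I_d -> K).
Variable ys : 'I_d -> S.
Hypothesis ys_int : forall f, integ ys f.

(** The equation [sb a i G = G] says that [G] involves only the variables of index below [i]. *)
Definition sb (a : pt) i : S -> S := msub (fun j : 'I_d => if (j < i)%N then 'X_j else (a j)%:MP).
HB.instance Definition _ a i := GRing.RMorphism.copy (sb a i)
  (msub (fun j : 'I_d => if (j < i)%N then 'X_j else (a j)%:MP : S)).

(* K[y_0,..,y_(i-1)] embeds in the quotient by Q, while y_j = a_j there for j >= i. *)
Definition lev (Q : S -> Prop) a i := (forall j : 'I_d, (i <= j)%N -> Q (ys j - (a j)%:MP)) /\
  (forall G, sb a i G = G -> Q (msub ys G) -> G = 0).

Lemma sbX a i j : sb a i 'X_j = if (j < i)%N then 'X_j else (a j)%:MP.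
Proof. exact: msubX. Qed.

Lemma sbC a i c : sb a i c%:MP = c%:MP.
Proof. exact: msubC. Qed.

Lemma sbD a i p q : sb a i (p + q) = sb a i p + sb a i q.
Proof. exact: msubD. Qed.

Lemma sbM a i p q : sb a i (p * q) = sb a i p * sb a i q.
Proof. exact: msubM. Qed.

Lemma sb_comp a i i' G : (i <= i')%N -> sb a i' (sb a i G) = sb a i G.
Proof.
move=> le; apply: (mpoly_ext (f := sb a i' \o sb a i) (g := sb a i)) => [c|j] /=.
  by rewrite !sbC.
rewrite !sbX; case: ifP => lt; last by rewrite sbC.
by rewrite sbX (leq_trans lt).
Qed.

Lemma sb_eq a a' i G : (forall j : 'I_d, (i <= j)%N -> a j = a' j) -> sb a i G = sb a' i G.
Proof. by move=> E; apply: eq_msub => j; case: ltnP => // /E->. Qed.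

Lemma lev_mod Q a i G : isid Q -> lev Q a i -> Q (msub ys G - msub ys (sb a i G)).
Proof.
move=> idQ [Qa _]; apply: (mpoly_ring_ind (P := fun G => Q (msub ys G - msub ys (sb a i G)))) => {G}.
- by move=> c; rewrite sbC !msubC subrr; case: idQ.
- move=> j; rewrite sbX; case: ltnP => [_|/Qa]; first by rewrite subrr; case: idQ.
  by rewrite msubX msubC.
- by move=> p q Qp Qq; rewrite sbD !msubD; apply: isid_congrD.
- by move=> p q Qp Qq; rewrite sbM !msubM; apply: isid_congrM.
Qed.

Definition relat Q a i (r : {poly S}) f :=
  [/\ r != 0, forall l, sb a i r`_l = r`_l & Q (map_poly (msub ys) r).[f]].

Lemma horner_map_sum (r : {poly S}) f k : (size r <= k)%N ->
  (map_poly (msub ys) r).[f] = \sum_(l < k) msub ys r`_l * f ^+ l.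
Proof.
move=> le_k; rewrite (horner_coef_wide _ (leq_trans (size_poly _ _) le_k)).
by apply: eq_bigr => l _; rewrite coef_map.
Qed.

Lemma lev_relation Q a i f : isid Q -> lev Q a i ->
  exists2 r, r \is monic & relat Q a i r f.
Proof.
move=> idQ lQ; have [p mp p0] := ys_int f.
have mr : map_poly (sb a i) p \is monic by apply: monic_map.
exists (map_poly (sb a i) p) => //; split.
- exact: monic_neq0.
- by move=> l; rewrite coef_map /= sb_comp.
have -> : (map_poly (msub ys) (map_poly (sb a i) p)).[f] =
    (map_poly (msub ys) (map_poly (sb a i) p)).[f] - (map_poly (msub ys) p).[f] by rewrite p0 subr0.
rewrite (horner_map_sum _ (size_poly _ _ : (size (map_poly (sb a i) p) <= size p)%N)).
rewrite (horner_map_sum _ (leqnn _)) -sumrB; apply: isid_sum => // l _.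
rewrite coef_map /= -mulrBl mulrC; case: (idQ) => _ _; apply.
by rewrite -opprB; apply: isidN => //; apply: lev_mod.
Qed.

(** As [f] lies outside the prime [P], an equation modulo [P] whose constant coefficient is in [P]
    can be divided by [f]. This stops because some coefficient is not in [P]. *)
Lemma relation_reduce Q P a i r f : isprime P -> (forall p, Q p -> P p) -> isid Q -> lev Q a i ->
  ~ P f -> relat Q a i r f -> ~ (forall l, P (msub ys r`_l)) ->
  exists2 r : {poly S}, [/\ r != 0, forall l, sb a i r`_l = r`_l & P (map_poly (msub ys) r).[f]] & ~ P (msub ys r`_0).
Proof.
move=> prP QP idQ lQ nPf [nzr fr /QP Pr] nall; have [idP P1 Pmul] := prP.
elim: {r}_.+1 {-2}r (ltnSn (size r)) nzr fr Pr nall => // s IH r lt_s nzr fr Pr nall.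
case: (boolp.pselect (P (msub ys r`_0))) => [P0|nP0]; last by exists r.
pose r1 : {poly S} := \poly_(l < size r) r`_(l.+1).
have coef_r1 l : r1`_l = r`_(l.+1).
  by rewrite coef_poly; case: ltnP => // ge; rewrite nth_default // ltnW.
have Er : r = r1 * 'X + (r`_0)%:P.
  apply/polyP => l; rewrite coefD coefMX coefC; case: l => [|l] /=; first by rewrite add0r.
  by rewrite coef_r1 addr0.
have nall1 : ~ (forall l, P (msub ys r1`_l)).
  by move=> H; apply: nall => -[//|l]; rewrite -coef_r1.
have nz1 : r1 != 0.
  by apply/eqP => r10; apply: nall1 => l; rewrite r10 coef0 rmorph0; case: idP.
apply: (IH r1) => //.
- move: lt_s; rewrite Er size_MXaddC (negbTE nz1) /= !ltnS; exact: leq_trans.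
- by move=> l; rewrite coef_r1.
have : P ((map_poly (msub ys) r1).[f] * f).
  rewrite -[X in P X](addrK (msub ys r`_0)); apply: isidB => //.
  by move: Pr; rewrite {1}Er rmorphD rmorphM /= map_polyX map_polyC hornerD hornerMX hornerC.
by case/Pmul.
Qed.

(** The prime must contain [u = y_i - a_i] and meet [K[y_0,..,y_(i-1)]] only in 0. If [G(ys) = s u]
    modulo [Q], the integral equation of [s], multiplied by [u^k], is a relation [H] between the
    independent [y_0,..,y_i]. So [H = 0], and setting [u = 0] in it leaves [G^k = 0]. *)
Lemma lev_step Q a (i : nat) : (i < d)%N -> isprime Q -> lev Q a i.+1 ->
  exists Q', [/\ isprime Q', forall p, Q p -> Q' p & lev Q' a i].
Proof.
move=> lt_i prQ lQ; have [idQ Q1 Qmul] := prQ; pose o := Ordinal lt_i.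
pose u := ys o - (a o)%:MP.
pose M x := exists G, [/\ sb a i G = G, G != 0 & x = msub ys G].
have [||||Q' [prQ' JQ' MQ']] := @prime_avoiding _ (add1 Q u) M.
- exact: add1_id.
- by exists 1; rewrite !rmorph1 oner_eq0.
- move=> _ _ [G [fG nzG ->]] [H [fH nzH ->]]; exists (G * H).
  by rewrite !rmorphM /= fG fH mulf_neq0.
- move=> x [s Qs] [G [fG nzG E]]; subst x; case/eqP: nzG.
  have [r mr [nzr fr Qr]] := lev_relation s idQ lQ.
  pose k := (size r).-1; have size_r : size r = k.+1.
    by rewrite /k prednK // lt0n size_poly_eq0.
  pose U : S := 'X_o - (a o)%:MP.
  have yU : msub ys U = u by rewrite rmorphB /= msubX msubC.
  pose H := \sum_(l < k.+1) r`_l * U ^+ (k - l) * G ^+ l.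
  have fH : sb a i.+1 H = H.
    rewrite rmorph_sum; apply: eq_bigr => l _ /=.
    rewrite !rmorphM !rmorphXn /= fr -{1}fG sb_comp // fG rmorphB /= sbX sbC.
    by rewrite /= ltnSn.
  have /(congr1 (sb a i)) : H = 0.
    apply: (lQ.2) => //.
    have Eu : u ^+ k * (map_poly (msub ys) r).[s] =
        \sum_(l < k.+1) msub ys r`_l * u ^+ (k - l) * (s * u) ^+ l.
      rewrite (horner_map_sum _ (eq_leq size_r)) mulr_sumr; apply: eq_bigr => l _.
      rewrite exprMn -{1}(subnK (_ : l <= k)%N) ?exprD; last by rewrite -ltnS.
      by ring.
    rewrite -[X in Q X](subrK (u ^+ k * (map_poly (msub ys) r).[s])).
    case: (idQ) => _ QD QM; apply: (QD); last by apply: (QM).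
    rewrite Eu rmorph_sum -sumrB; apply: isid_sum => // l _.
    rewrite !rmorphM !rmorphXn /= yU -mulrBr; apply: (QM).
    by rewrite subrXX mulrC; apply: (QM).
  rewrite rmorph0 rmorph_sum big_ord_recr /= subnn expr0 mulr1.
  rewrite rmorphM rmorphXn /= fG -/(lead_coef r) (monicP mr).
  rewrite rmorph1 mul1r big1 ?add0r => [/eqP|l _].
    by rewrite expf_eq0 => /andP[_ /eqP].
  have -> : (k - l)%N = (k - l.+1).+1 by have := ltn_ord l; lia.
  rewrite exprS !rmorphM /= rmorphB /= sbX sbC ltnn subrr.
  by rewrite !(mul0r, mulr0).
exists Q'; split=> // [p Qp|]; first by apply: JQ'; apply: add1_sub.
split=> [j|G fG QG].
  rewrite leq_eqVlt => /orP[/eqP Ej|lt_ij]; last first.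
    by apply: JQ'; apply: add1_sub => //; apply: lQ.1.
  have -> : j = o by apply: val_inj; rewrite /= Ej.
  by apply: JQ'; apply: add1_self.
by apply/eqP; apply: contraT => nzG; case: (MQ' _ QG); exists G.
Qed.

Lemma lev_down Q a (i j : nat) : (i <= d)%N -> (j <= i)%N -> isprime Q -> lev Q a i ->
  exists Q', [/\ isprime Q', forall p, Q p -> Q' p & lev Q' a j].
Proof.
elim: i Q => [|i IH] Q le_i.
  by rewrite leqn0 => /eqP-> prQ lQ; exists Q.
rewrite leq_eqVlt ltnS => /orP[/eqP-> prQ lQ|le_j prQ lQ]; first by exists Q.
have [Q' [prQ' QQ' lQ']] := lev_step le_i prQ lQ.
have [Q'' [prQ'' QQ'' lQ'']] := IH _ (ltnW le_i) le_j prQ' lQ'.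
by exists Q''; split=> // p /QQ' /QQ''.
Qed.

Definition zeros (Q : S -> Prop) : aset K d := fun z => forall p, Q p -> p.@[z] = 0.

(** At level 0 each coordinate satisfies a monic equation over [K] modulo [Q]. It splits into linear
    factors, and the prime [Q] contains one of them. *)
Lemma lev0_point Q a : isprime Q -> lev Q a 0 -> exists2 z, zeros Q z & forall p, Q (p - (p.@[z])%:MP).
Proof.
move=> prQ lQ; have [idQ Q1 Qmul] := prQ.
have root j : exists z, Q ('X_j - z%:MP).
  have [r mr [nzr fr Qr]] := lev_relation 'X_j idQ lQ.
  pose r0 : {poly K} := map_poly (meval a) r.
  have Er : r = map_poly (@mpolyC d K) r0.
    apply/polyP => l; rewrite !coef_map /= -{1}fr.
    apply: (mpoly_ext (f := sb a 0) (g := @mpolyC d K \o meval a)) => [c|i] /=.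
      by rewrite sbC mevalC.
    by rewrite sbX mevalXi.
  have [rs Ers] := closed_field_poly_normal r0.
  have Q0 : Q (\prod_(z <- rs) ('X_j - z%:MP)).
    move: Qr; rewrite Er -map_poly_comp.
    have -> : map_poly (msub ys \o @mpolyC d K) r0 = map_poly (@mpolyC d K) r0.
      by apply: eq_map_poly => c /=; rewrite msubC.
    have m0 : r0 \is monic by apply: monic_map.
    rewrite Ers (monicP m0) scale1r rmorph_prod /= horner_prod.
    rewrite (eq_bigr (fun z => 'X_j - z%:MP)) // => z _.
    by rewrite rmorphB /= map_polyX map_polyC hornerD hornerN hornerX hornerC.
  elim: rs {Ers} Q0 => [|z rs IH]; first by rewrite big_nil => /Q1.
  by rewrite big_cons => /Qmul[Qz|/IH//]; exists z.
have [z Hz] := fin_all_exists root.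
have Qp p : Q (p - (p.@[z])%:MP).
  apply: (mpoly_ring_ind (P := fun p => Q (p - (p.@[z])%:MP))) => {p}.
  - by move=> c; rewrite mevalC subrr; case: idQ.
  - by move=> i; rewrite mevalXi.
  - by move=> p q Qp Qq; rewrite mevalD mpolyCD; apply: isid_congrD.
  - by move=> p q Qp Qq; rewrite mevalM mpolyCM; apply: isid_congrM.
exists z => // p Qp'; apply/eqP; apply: contraT => nz; case: Q1.
have -> : 1 = (p.@[z]^-1)%:MP * (p - (p - (p.@[z])%:MP)) :> S.
  by rewrite subKr -mpolyCM mulVf.
by case: (idQ) => _ _; apply; apply: isidB.
Qed.

(** A reduced equation of [f] has a nonzero constant coefficient in [K[y_0,..,y_(i-1)]]. Values of
    the [y_j] at which it does not vanish are prescribed, and the descent to level 0 gives a point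
    with these values; [f] cannot vanish there. *)
Theorem nullstellensatz Q a i f : (i <= d)%N -> isprime Q -> lev Q a i -> ~ Q f ->
  exists2 z, zeros Q z & f.@[z] != 0.
Proof.
move=> le_i prQ lQ nQf; have [idQ Q1 Qmul] := prQ.
have [r mr rel] := lev_relation f idQ lQ.
have [|{mr rel}r [nzr fr Qr] nQ0] := relation_reduce prQ (fun p Qp => Qp) idQ lQ nQf rel.
  by move=> /(_ (size r).-1); rewrite -/(lead_coef r) (monicP mr) rmorph1.
have nz0 : r`_0 != 0 by apply/eqP => r0; apply: nQ0; rewrite r0 rmorph0; case: idQ.
have [al nzal] : exists al, (r`_0).@[al] != 0.
  apply: boolp.contrapT => none; case/eqP: nz0; apply: (mpoly_all0 K_inf) => x.
  by apply/eqP; apply: contraT => nz; case: none; exists x.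
pose a' (j : 'I_d) := if (j < i)%N then al j else a j.
have ea G : sb a i G = sb a' i G.
  by apply: sb_eq => j; rewrite /a' ltnNge => ->.
have lQ' : lev Q a' i.
  split=> [j le_j|G fG]; last by apply: lQ.2; rewrite ea.
  by rewrite /a' ltnNge le_j; apply: lQ.1.
have [Q0 [prQ0 QQ0 lQ0]] := lev_down le_i (leq0n i) prQ lQ'.
have [z Zz Qz] := lev0_point prQ0 lQ0.
exists z => [p /QQ0 /Zz//|].
have yz j : (ys j).@[z] = a' j.
  have /Zz := lQ0.1 j (leq0n _); rewrite rmorphB /= mevalC => /eqP.
  by rewrite subr_eq0 => /eqP.
apply: contraNneq nzal => fz0.
have -> : (r`_0).@[al] = (msub ys r`_0).@[z].
  rewrite msub_meval -{1}fr {1}/sb msub_meval; rewrite -[in RHS]fr {1}/sb msub_meval.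
  apply: meval_eq => j; case: ifP => lt; rewrite ?mevalXi ?mevalC // yz /a' lt //.
have := Zz _ (QQ0 _ Qr); rewrite (horner_map_sum _ (leqnn _)) rmorph_sum /=.
have s_gt0 : (0 < size r)%N by rewrite lt0n size_poly_eq0.
rewrite (bigD1 (Ordinal s_gt0)) //= expr0 mulr1 big1 ?addr0 => [->//|l].
rewrite -val_eqE /= -lt0n => l_gt0; rewrite rmorphM rmorphXn /= fz0.
by rewrite expr0n gtn_eqF // mulr0.
Qed.

Lemma zeros_irreducible Q a i : (i <= d)%N -> isprime Q -> lev Q a i -> irreducible_closed (zeros Q).
Proof.
move=> le_i prQ lQ; have [idQ Q1 Qmul] := prQ; split.
- by exists Q => x.
- by have [z Zz _] := nullstellensatz le_i prQ lQ Q1; exists z.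
move=> Z1 Z2 [S1 E1] [S2 E2] sub; apply: boolp.contrapT => /boolp.not_orP[n1 n2].
have out (Z : aset K d) (T : S -> Prop) : (forall x, Z x <-> forall p, T p -> p.@[x] = 0) ->
    ~ asubset (zeros Q) Z -> exists2 p, T p & ~ Q p.
  move=> E n; apply: boolp.contrapT => none; apply: n => x Vx; apply/E => p Tp; apply: Vx.
  by apply: boolp.contrapT => nQ; apply: none; exists p.
have [p1 S1p nQ1] := out _ _ E1 n1; have [p2 S2p nQ2] := out _ _ E2 n2.
have [|z Zz] := nullstellensatz le_i prQ lQ (f := p1 * p2); first by case/Qmul.
rewrite rmorphM /= mulf_eq0 => /norP[nz1 nz2].
by case: (sub _ Zz) => [/E1/(_ _ S1p)/eqP|/E2/(_ _ S2p)/eqP]; apply/negP.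
Qed.

(** Each descent imposes a condition [y_i = a_i], which fails somewhere on the larger zero set
    because [y_0,..,y_i] are algebraically independent there. *)
Lemma zeros_chain N Q a : (N <= d)%N -> isprime Q -> lev Q a N -> chain_in (zeros Q) N.
Proof.
suff aux : forall Q, (N <= d)%N -> isprime Q -> lev Q a N -> exists Y : nat -> aset K d,
    [/\ forall k, (k <= N)%N -> irreducible_closed (Y k),
        forall k, (k < N)%N -> asubset (Y k) (Y k.+1) /\ exists x, Y k.+1 x /\ ~ Y k x &
        Y N = zeros Q].
  by move=> le_N prQ lQ; have [Y [H1 H2 H3]] := aux Q le_N prQ lQ; exists Y; split=> //; rewrite H3.
elim: N => [|N IH] {}Q le_N prQ lQ.
  by exists (fun=> zeros Q); split=> // k _; apply: zeros_irreducible lQ.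
have [Q' [prQ' QQ' lQ']] := lev_step le_N prQ lQ.
have [Y [Y1 Y2 Y3]] := IH _ (ltnW le_N) prQ' lQ'.
exists (fun k => if (k <= N)%N then Y k else zeros Q); split.
- move=> k _; case: leqP => [/Y1//|_]; exact: zeros_irreducible lQ.
- move=> k le_k; have [->|ne] := eqVneq k N; last first.
    have lt_k : (k < N)%N by rewrite ltn_neqAle ne -ltnS.
    by rewrite (ltnW lt_k) lt_k; apply: Y2.
  rewrite leqnn ltnn Y3; split=> [x Zx p /QQ'/Zx//|].
  pose o := Ordinal le_N.
  have [|z Zz nz] := nullstellensatz le_N prQ lQ (f := ys o - (a o)%:MP).
    rewrite -(msubX ys) -(msubC ys) -rmorphB => /(lQ.2 _).
    rewrite rmorphB /= sbX sbC /= ltnSn => /(_ erefl) E.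
    have := congr1 (mcoeff U_(o)) E; rewrite mcoeffB mcoeffX eqxx mcoeffC mnm1_eq0 mulr0 subr0 mcoeff0.
    by move/eqP; rewrite oner_eq0.
  exists z; split=> // Zz'; case/eqP: nz; apply: Zz'; exact: (lQ'.1 o).
by rewrite ltnn.
Qed.

Definition ideal_of (Y : aset K d) p := forall x, Y x -> p.@[x] = 0.

Lemma ideal_of_prime Y : irreducible_closed Y -> isprime (ideal_of Y).
Proof.
move=> [cY [x0 Yx0] irr]; split.
- split=> [x _|p q Yp Yq x Yx|p q Yq x Yx]; first exact: meval0.
    by rewrite rmorphD /= Yp ?Yq ?addr0.
  by rewrite rmorphM /= Yq ?mulr0.
- by move=> /(_ _ Yx0)/eqP; rewrite meval1 oner_eq0.
move=> p q Ypq.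
have closed (p0 : S) : zariski_closed (fun x => p0.@[x] = 0).
  by exists (fun r => r = p0) => x; split=> [E r ->//|]; apply.
have [|H|H] := irr _ _ (closed p) (closed q); [|by left|by right].
move=> x /Ypq /eqP; rewrite rmorphM /= mulf_eq0 => /orP[/eqP|/eqP]; by [left|right].
Qed.

(** Each step of a chain yields a polynomial [g k] in the first [N] of the [ys] that vanishes on
    [Y k] but not on [Y k.+1]. These [N + 1] polynomials are dependent. In the relation a power of
    the last variable cancels on [Y k.+1], and restriction to [Y k] removes that variable; at the
    bottom a nonzero constant would vanish. *)
Lemma zeros_no_chain N Q a : (N <= d)%N -> isprime Q -> lev Q a N -> ~ chain_in (zeros Q) N.+1.
Proof.
move=> le_N prQ lQ [Y [Yirr Ylt Ytop]]; have [idQ _ _] := prQ.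
have Yle k : (k <= N.+1)%N -> asubset (Y k) (zeros Q).
  move=> le_k; rewrite -(subKn le_k); elim: (N.+1 - k)%N => [|l IHl]; first by rewrite subn0.
  case: (ltnP l N.+1) => [lt|ge]; last first.
    by have -> : (N.+1 - l.+1 = N.+1 - l)%N by lia.
  move=> x Yx; apply: IHl; have [|sub _] := Ylt (N.+1 - l.+1)%N; first by lia.
  have -> : (N.+1 - l = (N.+1 - l.+1).+1)%N by lia.
  exact: sub.
have QY k p : (k <= N.+1)%N -> Q p -> ideal_of (Y k) p by move=> le_k Qp x /(Yle _ le_k); apply.
have gam k : (k < N.+1)%N -> exists G, [/\ sb a N G = G, ideal_of (Y k) (msub ys G) & ~ ideal_of (Y k.+1) (msub ys G)].
  move=> lt_k; have [sub [x [Yx nYx]]] := Ylt _ lt_k.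
  have [[T ET] _ _] := Yirr _ (ltnW lt_k).
  have [g Tg ngx] : exists2 g, T g & g.@[x] <> 0.
    apply: boolp.contrapT => none; apply: nYx; apply/ET => g Tg.
    by apply: boolp.contrapT => n; apply: none; exists g.
  have prP := ideal_of_prime (Yirr _ lt_k); have [idP P1 _] := prP.
  have [r mr rel] := lev_relation g idQ lQ.
  have [||{mr rel}r [nzr fr Pr] nP0] := relation_reduce prP (QY k.+1 ^~ lt_k) idQ lQ _ rel.
  - by move=> /(_ _ Yx).
  - by move=> /(_ (size r).-1); rewrite -/(lead_coef r) (monicP mr) rmorph1.
  exists r`_0; split=> // z Yz; have := Pr _ (sub _ Yz).
  have gz : g.@[z] = 0 by move/ET: Yz; apply.
  have s_gt0 : (0 < size r)%N by rewrite lt0n size_poly_eq0.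
  rewrite (horner_map_sum _ (leqnn _)) rmorph_sum /= (bigD1 (Ordinal s_gt0)) //= expr0 mulr1.
  rewrite big1 ?addr0 // => l.
  rewrite -val_eqE /= -lt0n => l_gt0; rewrite rmorphM rmorphXn /= gz.
  by rewrite expr0n gtn_eqF // mulr0.
have [g Hg] := fin_all_exists (fun k : 'I_N.+1 => gam k (ltn_ord k)).
pose w := widen_ord le_N.
pose h (j : 'I_d) : {mpoly K[N]} := if insub (j : nat) is Some j' then 'X_j' else (a j)%:MP.
have [G nzG G0] := algebraic_dependence (fun k => msub h (g k)).
have {}G0 : msub g G = 0.
  rewrite -[RHS](rmorph0 (msub (fun j : 'I_N => 'X_(w j) : S))) -G0 /= msub_comp.
  apply: eq_msub => k; have [fk _ _] := Hg k; rewrite -{1}fk msub_comp; apply: eq_msub => j.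
  rewrite /h; case: insubP => [j' lt E|]; last by rewrite -leqNgt leqNgt => /negbTE ->; rewrite msubC.
  by rewrite lt msubX; congr 'X_(_); apply: val_inj; rewrite /= E.
have {}G0 : ideal_of (Y N.+1) (msub (fun k => msub ys (g k)) G).
  by rewrite -msub_comp G0 rmorph0; have [[]] := ideal_of_prime (Yirr _ (leqnn _)).
have zG (i : 'I_N.+1) : (N.+1 <= i)%N -> zvar i G = G by rewrite leqNgt ltn_ord.
suff aux k : (k <= N.+1)%N -> forall G, G != 0 -> ideal_of (Y k) (msub (fun k => msub ys (g k)) G) ->
    (forall i : 'I_N.+1, (k <= i)%N -> zvar i G = G) -> False.
  exact: (aux N.+1 (leqnn _) G).
elim: k => [|k IH] le_k {}G {}nzG {}G0 {}zG.
  have [_ P1 _] := ideal_of_prime (Yirr _ (leq0n _)).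
  have Ec := zvar_const (fun i => zG i (leq0n _)); move: nzG G0; rewrite Ec mpolyC_eq0 msubC => nzc Pc.
  have [_ [x Yx] _] := Yirr _ (leq0n N.+1).
  by have := Pc _ Yx; rewrite mevalC => E; move: nzc; rewrite E eqxx.
pose o := Ordinal le_k.
have [e [G1 [H [EG nz1 z1 zi]]]] := mpoly_peel o nzG.
have [_ P0 nP] := Hg o.
have prP := ideal_of_prime (Yirr _ le_k); have [_ _ Pmul] := prP.
apply: (IH (ltnW le_k) G1) => //; last first.
  move=> i; rewrite leq_eqVlt => /orP[/eqP E|lt]; last by apply: zi; apply: zG.
  by have -> : i = o by apply: val_inj.
move=> x Yx.
have : ideal_of (Y k.+1) (msub (fun k => msub ys (g k)) (G1 + 'X_o * H)).
  move: G0; rewrite EG rmorphM rmorphXn /= msubX => /Pmul[/(isprime_exp prP)//|//].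
have [sub _] := Ylt _ le_k.
move/(_ x (sub _ Yx)); rewrite !rmorphD !rmorphM /= msubX (P0 _ Yx) mul0r addr0 //.
Qed.

Theorem zeros_dim N Q a : (N <= d)%N -> isprime Q -> lev Q a N -> dim_is (zeros Q) N.
Proof. by move=> le prQ lQ; split; [apply: zeros_chain lQ|apply: zeros_no_chain lQ]. Qed.

End Descent.

(** * Codimension of the zero set of a regular family *)

Section RegularFamily.
Variables (K : closedFieldType) (d n N : nat).
Hypothesis K_inf : exists u : nat -> K, injective u.
Local Notation S := {mpoly K[d]}.
Local Notation pt := ('I_d -> K).
Variables (P : 'I_n -> S) (L : 'I_N -> pt).
Hypothesis dNn : (N + n = d)%N.
Hypothesis P_hom : forall i, exists2 e, (0 < e)%N & P i \is e.-homog.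
Let Ps := [seq P i | i <- enum 'I_n].
Let Ls := [seq lfp (L i) | i <- enum 'I_N].
Hypothesis tree : good (fun=> True) (Ls ++ rev Ps).
Let I0 (p : S) := p = 0.

Lemma addl_min (A : comNzRingType) (I J : A -> Prop) xs p : isid I -> isid J -> (forall q, I q -> J q) ->
  (forall y, y \in xs -> J y) -> addl I xs p -> J p.
Proof.
move=> idI idJ IJ xJ /(addlP _ _ idI)[q Iq]; rewrite -(subrK (\sum_(i < size xs) q i * xs`_i) p).
case: (idJ) => _ JD JM; apply: (JD); first exact: IJ.
by apply: isid_sum => // i _; apply/JM/xJ/mem_nth.
Qed.

Lemma regl_cat (A : comNzRingType) (I : A -> Prop) xs zs :
  regl I (xs ++ zs) <-> regl I xs /\ regl (addl I xs) zs.
Proof.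
elim: xs I => [|x xs IH] I /=; first by split=> // -[].
by split=> [[nz /IH[r1 r2]]|[[nz r1] r2]]; split=> //; apply/IH.
Qed.

Let idI0 : isid I0 := zero_id K d.

Let homI0 : homI I0.
Proof. by move=> p k ->; rewrite /I0 /hc raddf0. Qed.

(** The tree gives the order with the linear forms in front and the [P i] reversed. By homogeneity
    the sequence may be permuted so that the [P i] come first in their own order. *)
Lemma regl_pwin : regl I0 (Ps ++ Ls) /\ forall j, pwin (addl I0 (Ls ++ Ps)) 'X_j.
Proof.
have linT : lin (fun _ : pt => True) by [].
have [rg pw] := good_regl K_inf linT tree.
have E p : vanish (fun=> True) p <-> I0 p.
  split=> [V|-> x _]; last exact: meval0.
  by apply: (mpoly_all0 K_inf) => x; apply: V.
split; last first.
  move=> j; have [D HD] := pw j; exists D.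
  apply: (addl_min (vanish_id _) (addl_id _ idI0)) HD => [q /E ->|y].
    by case: (addl_id (Ls ++ Ps) idI0).
  by rewrite mem_cat mem_rev -mem_cat; apply: addl_mem.
have hs : homs (Ls ++ rev Ps).
  move=> y; rewrite mem_cat mem_rev => /orP[] /mapP[i _ ->]; last exact: P_hom.
  by exists 1%N => //; apply: lfp_homog.
apply: (regl_perm idI0 homI0 hs); last exact: regl_ext rg.
by rewrite perm_catC perm_cat2r perm_rev.
Qed.

Lemma in_idealE k p : (k <= n)%N -> in_ideal k P p <-> addl I0 (take k Ps) p.
Proof.
move=> le_k; have sz : size (take k Ps) = k.
  by rewrite size_takel // size_map size_enum_ord.
have nthP (i : 'I_n) : (i < k)%N -> (take k Ps)`_i = P i.
  by move=> lt_i; rewrite nth_take // (nth_map i) ?size_enum_ord // nth_ord_enum.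
split=> [[q Eq]|/(addlP _ _ idI0)[q /eqP]].
  rewrite Eq; apply: isid_sum => [|i lt_i]; first exact: addl_id.
  have [_ _] := addl_id (take k Ps) idI0; apply; apply: addl_mem => //.
  by rewrite -(nthP _ lt_i) mem_nth // sz.
rewrite subr_eq0 sz => /eqP ->; exists (fun i => q i).
rewrite (big_ord_widen n (fun i => q i * (take k Ps)`_i) le_k).
by apply: eq_bigr => i lt_i; rewrite nthP.
Qed.

Theorem regular_family : regular_seq P.
Proof.
have [/regl_cat[rP _] _] := regl_pwin; split=> [i p|].
  rewrite !in_idealE ?(ltnW (ltn_ord i)) //.
  have sz : (i < size Ps)%N by rewrite size_map size_enum_ord.
  move: rP; rewrite -{1}(cat_take_drop i Ps) (drop_nth 0 sz) => /regl_cat[_ [nz _]].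
  by rewrite (nth_map i) ?size_enum_ord // nth_ord_enum in nz; apply: nz.
move=> [q /(congr1 (meval (fun=> 0)))]; rewrite meval1 rmorph_sum /= big1 => [/eqP|i _].
  by rewrite oner_eq0.
have [e e_gt0 he] := P_hom i; rewrite rmorphM /= (_ : (P i).@[_] = 0) ?mulr0 //.
rewrite mevalE big_seq big1 // => m m_in.
have dm : mdeg m = e by apply: (dhomog_mf he).
have [j nzj] : exists j, (m j != 0)%N.
  apply/existsP; apply: contraT; rewrite negb_exists => /forallP H.
  move: e_gt0; rewrite -dm mdegE big1 // => j _; apply/eqP; by have := H j; rewrite negbK.
by rewrite (bigD1 j) //= expr0n (negbTE nzj) mul0r mulr0.
Qed.

Let ys (j : 'I_d) : S := (Ls ++ Ps)`_j.

Let sizeLs : size Ls = N. Proof. by rewrite size_map size_enum_ord. Qed.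
Let sizeLP : size (Ls ++ Ps) = d.
Proof. by rewrite size_cat sizeLs size_map size_enum_ord. Qed.

Let ysL (i : 'I_N) (j : 'I_d) : i = j :> nat -> ys j = lfp (L i).
Proof.
move=> E; rewrite /ys nth_cat sizeLs -E ltn_ord (nth_map i) ?size_enum_ord //.
by rewrite nth_ord_enum.
Qed.

Let ysP (j : 'I_d) : (N <= j)%N -> exists i, ys j = P i.
Proof.
move=> le_j; have lt_j : (j - N < n)%N by have := ltn_ord j; lia.
exists (Ordinal lt_j); rewrite /ys nth_cat sizeLs ltnNge le_j /=.
rewrite (nth_map (Ordinal lt_j)) ?size_enum_ord //.
by congr P; apply: val_inj; rewrite /= nth_enum_ord.
Qed.

Let ys_seq : [seq ys i | i <- enum 'I_d] = Ls ++ Ps.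
Proof.
apply: (@eq_from_nth _ 0) => [|i]; rewrite size_map size_enum_ord ?sizeLP // => lt_i.
by rewrite (nth_map (Ordinal lt_i)) ?size_enum_ord // /ys nth_enum_ord.
Qed.

Let ys_int f : integ ys f.
Proof.
apply: integral_all => [i|j]; last by rewrite ys_seq; apply: regl_pwin.2.
have : ys i \in Ls ++ Ps by apply: mem_nth; rewrite sizeLP.
rewrite mem_cat => /orP[] /mapP[k _ ->]; last exact: P_hom.
by exists 1%N => //; apply: lfp_homog.
Qed.

Variable V : aset K d.
Hypothesis VE : forall x, V x <-> forall i, (P i).@[x] = 0.

(** Modulo [J = (P)] nonzero polynomials in the linear forms are nonzerodivisors, so [J] avoids all
    products of such a polynomial with some [s] not vanishing on [Z]. A prime over [J] avoiding them
    lies in the ideal of [Z]; by maximality [Z] is its zero set, and the [N] linear forms stay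
    independent there. *)
Lemma component_dim Z : irreducible_component V Z -> dim_is Z N.
Proof.
move=> [irrZ ZV maxZ]; have prZ := ideal_of_prime irrZ; have [idZ Z1 Zmul] := prZ.
have le_N : (N <= d)%N by rewrite -dNn leq_addr.
pose J := addl I0 Ps; have idJ : isid J by apply: addl_id.
(* From index [N] on the [ys] are the [P i], which lie in [J]; their prescribed values are therefore
   0. *)
pose a : pt := fun=> 0.
pose M x := exists s G, [/\ ~ ideal_of Z s, G != 0, sb a N G = G & x = s * msub ys G].
have JZ p : J p -> ideal_of Z p.
  apply: (addl_min idI0 idZ) => [q ->|y]; first by case: idZ.
  by case/mapP => i _ -> x Zx; apply/VE: i; apply: ZV.
have homJ : homI J.
  have hs : homs Ps by move=> y /mapP[i _ ->]; apply: P_hom.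
  rewrite /J; move: {idJ JZ} homI0; clearbody Ps; move: (I0) => I.
  elim: Ps I hs => //= y s IH I hs hI; apply: IH => [z z_in|].
    by apply: hs; rewrite inE z_in orbT.
  by have [e _ he] := hs y (mem_head _ _); apply: homI_add1 he.
have [/regl_cat[_ rL] _] := regl_pwin.
pose h (j : 'I_d) : {mpoly K[N]} := if insub (j : nat) is Some j' then 'X_j' else 0.
have hG G : sb a N G = G -> msub (fun i : 'I_N => 'X_(widen_ord le_N i)) (msub h G) = G.
  move=> fG; rewrite -[RHS]fG msub_comp; apply: eq_msub => j.
  rewrite /h; case: insubP => [j' lt E|]; last by rewrite -leqNgt leqNgt => /negbTE ->; rewrite rmorph0.
  by rewrite lt msubX; congr 'X_(_); apply: val_inj; rewrite /= E.
have [||||Q [prQ JQ QM]] := @prime_avoiding _ J M.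
- exact: idJ.
- by exists 1, 1; rewrite !rmorph1 mulr1 oner_eq0.
- move=> _ _ [s [G [ns nzG fG ->]]] [t [H [nt nzH fH ->]]]; exists (s * t), (G * H).
  by rewrite sbM msubM fG fH mulf_neq0 // mulrACA; split=> // /Zmul[].
- move=> x Jx [s [G [ns nzG fG E]]]; apply: ns; apply: JZ; subst x.
  apply: (@regl_free K d N J (fun i => lfp (L i)) (msub h G)) => //.
  + by move=> i; exists 1%N => //; apply: lfp_homog.
  + by apply: contraNneq nzG => G0; rewrite -(hG _ fG) G0 rmorph0.
  move: Jx; rewrite -{1}(hG _ fG) msub_comp; congr (J (_ * _)).
  by apply: eq_msub => i; rewrite msubX; apply: ysL.
have lQ : lev ys Q a N.
  split=> [j /ysP[i E]|G fG QG].
    rewrite /a mpolyC0 subr0 E; apply: JQ; apply: addl_mem => //.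
    by apply: map_f; rewrite mem_enum.
  apply/eqP; apply: contraT => nzG; case: (QM _ QG); exists 1, G.
  by rewrite mul1r.
have QZ p : Q p -> ideal_of Z p.
  move=> Qp; apply: boolp.contrapT => nZ; apply: (QM _ Qp); exists p, 1.
  by rewrite !rmorph1 mulr1 oner_eq0.
have -> : Z = zeros Q.
  apply: boolp.funext => x; apply: boolp.propext; split=> [Zx p /QZ|]; first exact.
  apply: maxZ => [|z Zz p /QZ|z Zz]; [exact: zeros_irreducible lQ|exact|].
  by apply/VE => i; apply: Zz; apply: JQ; apply: addl_mem => //; apply: map_f; rewrite mem_enum.
exact: zeros_dim lQ.
Qed.

(** The dimension formula for the coordinate functions as [ys], with the zero ideal at level [d]. *)
Lemma affine_space_dim : dim_is (fun _ : pt => True) d.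
Proof.
pose X (i : 'I_d) : S := 'X_i.
have X_int f : integ X f.
  exists ('X - f%:P); first exact: monicXsubC.
  rewrite rmorphB /= map_polyX map_polyC hornerD hornerN hornerX hornerC /= msub_id //.
  exact: subrr.
have prI0 : isprime I0.
  split=> // [/eqP|p q /eqP]; first by rewrite oner_eq0.
  by rewrite mulf_eq0 => /orP[] /eqP; [left|right].
have lI0 : lev X I0 (fun=> 0) d.
  split=> [j|G _]; first by rewrite leqNgt ltn_ord.
  by rewrite /I0 msub_id.
have -> : (fun _ : pt => True) = zeros I0; last exact: (zeros_dim K_inf X_int (leqnn d) prI0 lI0).
apply: boolp.funext => x; apply: boolp.propext; split=> // _ p ->; exact: meval0.
Qed.

Theorem component_codim Z : irreducible_component V Z -> has_codim Z n.
Proof. by move=> /component_dim dimZ; exists N, d; split=> //; apply: affine_space_dim. Qed.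

End RegularFamily.

(** * Symmetries of the lowest terms *)

Section RminProperties.
Variables (K : fieldType) (lam : seq nat) (n : nat).
Hypothesis lam_sum : sumn lam = n.
Hypothesis lam_sorted : sorted geq lam.
Local Notation J R := (Jmx lam n R).
Local Notation Rm := (Rmin lam).
Local Notation Qm := (Qmin lam).

(** At [s = 0] only the sets [S] with exactly [(bl i).+1] elements in [jlast S] survive, and each of
    these rows is linear in [Y]. *)
Lemma RminZ (R : comNzRingType) (i : 'I_n) (t : R) (Y : 'M[R]_n) : Rm i (t *: Y) = t ^+ (bl lam i).+1 * Rm i Y.
Proof.
rewrite /Rmin /Qmin mulr_sumr; apply: eq_bigr => S /eqP cS.
rewrite mulrCA; have := jlast_card lam_sum lam_sorted cS.
rewrite leq_eqVlt => /orP[/eqP E|lt]; last first.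
  by rewrite expr0n gtn_eqF ?mul0r // subn_gt0.
congr (_ * _); rewrite mulr_sumr; apply: eq_bigr => s _; rewrite mulrCA; congr (_ * _).
have -> : t ^+ (bl lam i).+1 = \prod_a (if a \in jlast lam S then t else 1).
  by rewrite E -big_mkcond prodr_const.
rewrite -big_split; apply: eq_bigr => a _ /=.
case: ifP => Sa; last first.
  by rewrite inE Sa /= mul1r.
by case: ifP => Ta; rewrite ?mul1r !mxE // !mul0r.
Qed.

Lemma pminors_sum_cycle (R : comNzRingType) i (g A g' : 'M[R]_n) :
  pminors_sum i (g *m A *m g') = pminors_sum i (A *m (g' *m g)).
Proof. by rewrite pminors_sumMC mulmxA pminors_sumMC. Qed.

(** The matrix [1 - t w] replaces the inverse of [1 + t w], which need not exist over a polynomial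
    ring; the error is of second order in [t]. *)
Lemma mul_conj_inv (R : comNzRingType) (A w : 'M[R]_n) t :
  A *m ((1%:M - t *: w) *m (1%:M + t *: w)) = A + t ^+ 2 *: - (A *m (w *m w)).
Proof.
have -> : (1%:M - t *: w) *m (1%:M + t *: w) = 1%:M - t ^+ 2 *: (w *m w).
  rewrite mulmxBl mul1mx mulmxDr mulmx1 -!scalemxAl -!scalemxAr scalerA -expr2 opprD addrA addrK //.
by rewrite mulmxBr mulmx1 -scalemxAr scalerN.
Qed.

Lemma map_mx0X (R : comNzRingType) (M N : 'M[{poly R}]_n) :
  map_mx (horner_eval 0) (M + 'X *: N) = map_mx (horner_eval 0) M.
Proof. by apply/matrixP => a b; rewrite !mxE /= /horner_eval hornerD hornerM hornerX mul0r addr0. Qed.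

Lemma map_mx_hornerC (R : comNzRingType) t (M : 'M[R]_n) :
  map_mx (horner_eval t) (map_mx polyC M) = M.
Proof. by apply/matrixP => a b; rewrite !mxE /= /horner_eval hornerC. Qed.

Lemma Qmin_horner0 (R : comNzRingType) (i : 'I_n) (Y : 'M[{poly R}]_n) :
  (Qm i 'X Y).[0] = Rm i (map_mx (horner_eval 0) Y).
Proof.
rewrite -[LHS]/(horner_eval 0 (Qm i 'X Y)) -(Qmin_map lam (horner_eval 0 : {rmorphism {poly R} -> R})).
by rewrite /= /horner_eval hornerX.
Qed.

(** The lowest term of [J + X Y] sees only the constant part of [Y], so an identity between minor
    sums of two perturbations descends to it. *)
Lemma Rmin_of_pminors (R : comNzRingType) (i : 'I_n) (Y Y' : 'M[{poly R}]_n) :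
  pminors_sum i.+1 (J _ + 'X *: Y) = pminors_sum i.+1 (J _ + 'X *: Y') ->
  Rm i (map_mx (horner_eval 0) Y) = Rm i (map_mx (horner_eval 0) Y').
Proof.
rewrite !(pminors_sum_Jmx lam_sum lam_sorted) => E; rewrite -!Qmin_horner0; congr (_.[0]).
apply/polyP => l; have := congr1 (fun p : {poly R} => p`_((bl lam i).+1 + l)) E.
by rewrite !coefXnM ltnNge leq_addr addKn.
Qed.

(** Conjugation of [J + X x] by [1 + X w] alters the first-order term by [w J - J w], and the
    approximate inverse costs only multiples of [X^2]. *)
Lemma Rmin_translate (i : 'I_n) (x w : 'M[K]_n) : Rm i (x + (w *m J K - J K *m w)) = Rm i x.
Proof.
pose c := map_mx (@polyC K) : 'M[K]_n -> 'M_n.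
pose A := J _ + 'X *: c x.
pose Y1 := c x + (c w *m A - A *m c w) - 'X *: (c w *m A *m c w).
pose Y2 := c x - 'X *: (A *m (c w *m c w)).
have E1 : J _ + 'X *: Y1 = (1%:M + 'X *: c w) *m A *m (1%:M - 'X *: c w).
  rewrite mulmxBr mulmx1 -scalemxAr !mulmxDl !mul1mx -!scalemxAl {1}/A /Y1.
  move: (c w *m A) (A *m c w) (c w *m A *m c w) => u1 u2 u3.
  by apply/matrixP => a b; rewrite /A !mxE; ring.
have E2 : J _ + 'X *: Y2 = A *m ((1%:M - 'X *: c w) *m (1%:M + 'X *: c w)).
  by rewrite mul_conj_inv /Y2 expr2 -scalerA scalerBr scalerN /A addrA scalerN.
have := @Rmin_of_pminors K i Y1 Y2; rewrite E1 E2 pminors_sum_cycle => /(_ erefl).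
rewrite /Y1 /Y2 -!scalerN !map_mx0X map_mxD map_mxB !map_mxM /= /A !map_mx0X !map_mx_hornerC.
by rewrite !Jmx_map.
Qed.

Lemma pminors_sum_congr (R : comNzRingType) m i (eta : R) (M N : 'M[R]_m) :
  exists c, pminors_sum i (M + eta *: N) = pminors_sum i M + eta * c.
Proof.
pose p := pminors_sum i (map_mx polyC M + 'X *: map_mx polyC N).
have pE t : p.[t] = pminors_sum i (M + t *: N).
  rewrite -[LHS]/(horner_eval t p) -pminors_sum_map; congr pminors_sum.
  by apply/matrixP => a b; rewrite !mxE /= /horner_eval hornerD hornerM hornerX !hornerC.
have [c E] : exists c, p.[eta] = p.[0] + eta * c.
  elim/poly_ind: (p) => [|q a [c Ec]]; first by exists 0; rewrite !horner0 mulr0 addr0.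
  by exists q.[eta]; rewrite !hornerMXaddC mulr0 add0r addrC mulrC.
by exists c; rewrite -pE E pE scale0r addr0.
Qed.

(** Conjugation by [1 + ep b] fixes [J] to first order in [ep], because [b] commutes with it, and
    moves [x] by the commutator. The outer indeterminate is the perturbation parameter of [J], the
    inner one is [ep]; errors in [ep^2] are collected in the remainder. *)
Lemma Rmin_adjoint (i : 'I_n) (x b : 'M[K]_n) : b *m J K = J K *m b ->
  exists c, Rm i (map_mx polyC x + 'X *: map_mx polyC (b *m x - x *m b)) = (Rm i x)%:P + 'X ^+ 2 * c.
Proof.
move=> bJ; pose c := map_mx (@polyC {poly K} \o @polyC K) : 'M[K]_n -> 'M_n.
pose ep : {poly {poly K}} := 'X%:P.
pose A := J _ + 'X *: c x.
have cJ : c (J K) = J {poly {poly K}} by rewrite /c Jmx_map.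
have bJ' : c b *m J _ = J _ *m c b by rewrite -cJ -!map_mxM bJ.
have E : (1%:M + ep *: c b) *m A *m (1%:M - ep *: c b) =
    J _ + 'X *: (c x + ep *: c (b *m x - x *m b)) + ep ^+ 2 *: (- (c b *m A *m c b)).
  have -> : c (b *m x - x *m b) = c b *m c x - c x *m c b by rewrite /c map_mxB !map_mxM.
  have E1 : c b *m A = J _ *m c b + 'X *: (c b *m c x) by rewrite /A mulmxDr bJ' -scalemxAr.
  have E2 : A *m c b = J _ *m c b + 'X *: (c x *m c b) by rewrite /A mulmxDl -scalemxAl.
  rewrite mulmxBr mulmx1 -scalemxAr !mulmxDl !mul1mx -!scalemxAl E2.
  move: (c b *m A *m c b) => u; rewrite E1.
  move: (c b *m c x) (c x *m c b) (J _ *m c b) => u1 u2 u3.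
  by apply/matrixP => p q; rewrite /A !mxE; ring.
have [c1 H1] := pminors_sum_congr i.+1 (ep ^+ 2)
  (J _ + 'X *: (c x + ep *: c (b *m x - x *m b))) (- (c b *m A *m c b)).
have E' : A *m ((1%:M - ep *: c b) *m (1%:M + ep *: c b)) = A + ep ^+ 2 *: - (A *m (c b *m c b)).
  exact: mul_conj_inv.
have [c2 H2] := pminors_sum_congr i.+1 (ep ^+ 2) A (- (A *m (c b *m c b))).
have H : pminors_sum i.+1 (J _ + 'X *: (c x + ep *: c (b *m x - x *m b))) =
    pminors_sum i.+1 A + ep ^+ 2 * (c2 - c1).
  by move: H1; rewrite -E pminors_sum_cycle E' H2 mulrBr addrA => ->; rewrite addrK.
pose Y := map_mx polyC x + 'X *: map_mx polyC (b *m x - x *m b) : 'M[{poly K}]_n.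
have EY : c x + ep *: c (b *m x - x *m b) = map_mx polyC Y.
  by apply/matrixP => p q; rewrite !mxE polyCD polyCM.
have Ecx : c x = map_mx polyC (map_mx polyC x) by apply/matrixP => p q; rewrite !mxE.
move: H; rewrite EY /A Ecx !(pminors_sum_Jmx lam_sum lam_sorted).
set m := (bl lam i).+1 => H.
exists (c2 - c1)`_m.
have := congr1 (fun p : {poly {poly K}} => p`_m) H.
rewrite coefD !coefXnM ltnn subnn -!horner_coef0 !Qmin_horner0 !map_mx_hornerC.
rewrite /ep -rmorphXn /= coefCM => ->; congr (_ + _).
exact: Rmin_map.
Qed.

End RminProperties.

(** * Values on slices *)

Section Slices.
Variables (K : fieldType) (lam : seq nat) (n : nat).
Hypothesis K_inf : exists u : nat -> K, injective u.
Hypothesis lam_sum : sumn lam = n.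
Hypothesis lam_sorted : sorted geq lam.
Hypothesis lam_pos : all (fun l => 0 < l)%N lam.
Local Notation k := (size lam).
Local Notation lm j := (nth 0%N lam j).
Local Notation bl a := (bl lam a).
Local Notation ps a := (ps lam a).

(* The arrows of the slice matrix lead from the last vertex of block i to the p-th vertex
   of block j, weighted by the p-th coefficient of x i j. *)
Definition ymx (x : nat -> nat -> {poly K}) : 'M[K]_n :=
  \matrix_(a, b) if ps a == (lm (bl a)).-1 then (x (bl a) (bl b))`_(ps b) else 0.

(** For [f] of degree at most [l] this is [(-X)^l f(-1/X)]. The exponent [l - p] counts the arrows
    from the [p]-th vertex of a block of size [l] to its last vertex and on into the next block of a
    cycle. *)
Definition rv l (f : {poly K}) : {poly K} := \sum_(p < l.+1) f`_p *: (- 'X) ^+ (l - p).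

Definition xmx (x : nat -> nat -> {poly K}) : 'M[{poly K}]_k := \matrix_(i, j) - rv (lm j) (x i j).

Lemma jedge_lt (a b : 'I_n) : jedge lam a b -> (a < b)%N.
Proof.
case/andP=> /eqP Eb /eqP Ep.
by rewrite (val_bl_ps lam_sum a) (val_bl_ps lam_sum b) Eb ltn_add2l Ep.
Qed.

Lemma det_1addJmx (R : comNzRingType) (z : R) : \det (1%:M + z *: Jmx lam n R) = 1.
Proof.
rewrite -det_tr det_trig.
  rewrite big1 // => a _; rewrite !mxE eqxx; case E: (jedge lam a a).
    by have := jedge_lt E; rewrite ltnn.
  by rewrite mulr0 addr0.
apply/is_trig_mxP => a b lt_ab; rewrite !mxE; case E: (jedge lam b a).
  by have := jedge_lt E; rewrite ltnNge ltnW.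
by rewrite mulr0 addr0 -val_eqE /= gtn_eqF.
Qed.

Lemma lm_gt0 j : (j < k)%N -> (0 < lm j)%N.
Proof. by move=> lt_j; apply: (allP lam_pos); apply: mem_nth. Qed.

(** The slice matrix factors as [A B] through a space with one dimension per block, and [1 + z J] is
    unipotent. Exchanging the factors leaves a determinant of size [k] in which [W], an explicit
    geometric series, stands for [B (1 + z J)^-1]. *)
Lemma det_ymx (R : comNzRingType) (f : {rmorphism K -> R}) (z s : R) (x : nat -> nat -> {poly K}) :
  (forall i j, (i < k)%N -> (j < k)%N -> size (x i j) <= lm j)%N ->
  \det (1%:M + z *: (Jmx lam n R + s *: map_mx f (ymx x))) =
  \det (1%:M + s *: \matrix_(i < k, j < k) - (map_poly f (rv (lm j) (x i j))).[z]).
Proof.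
move=> size_x.
pose A : 'M[R]_(n, k) := \matrix_(a, j) ((bl a == j) && (ps a == (lm j).-1))%:R.
pose B : 'M[R]_(k, n) := \matrix_(i, b) f (x i (bl b))`_(ps b).
pose W : 'M[R]_(k, n) := \matrix_(i, b) \sum_(p < (ps b).+1) f (x i (bl b))`_p * (- z) ^+ (ps b - p).
have yE : map_mx f (ymx x) = A *m B.
  apply/matrixP => a b; rewrite !mxE (bigD1 (Ordinal (bl_lt lam_sum a))) //= !mxE eqxx /=.
  rewrite big1 ?addr0 => [|j]; first by case: ifP; rewrite ?mul1r ?rmorph0 ?mul0r.
  by rewrite -val_eqE /= eq_sym !mxE => /negbTE->; rewrite mul0r.
have WE : W *m (1%:M + z *: Jmx lam n R) = B.
  apply/matrixP => i b; rewrite mulmxDr mulmx1 -scalemxAr !mxE.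
  have [p0|p_gt0] := posnP (ps b).
    rewrite p0 big_ord1 subnn expr0 mulr1 big1 ?mulr0 ?addr0 // => a _.
    by rewrite !mxE /jedge p0 andbF mulr0.
  have lt_p : ((ps b).-1 < lm (bl b))%N by rewrite (leq_ltn_trans (leq_pred _)) ?ps_lt.
  pose a := vtx lam_sum lt_p.
  rewrite (bigD1 a) //= [X in _ + z * (_ + X)]big1 ?addr0 => [|c ne].
    rewrite !mxE /jedge bl_vtx ps_vtx prednK // !eqxx mulr1 big_ord_recr /= subnn expr0 mulr1.
    rewrite addrAC -[RHS]add0r; congr (_ + _); rewrite mulr_sumr -big_split big1 // => p _ /=.
    have -> : (ps b - p = ((ps b).-1 - p).+1)%N by have := ltn_ord p; lia.
    by rewrite exprS; ring.
  rewrite !mxE; case E: (jedge lam c b); last by rewrite mulr0.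
  case/andP: E => /eqP E1 /eqP E2; case/eqP: ne; apply: (bl_ps_inj (lam := lam)).
    by rewrite bl_vtx.
  by rewrite ps_vtx E2.
have -> : 1%:M + z *: (Jmx lam n R + s *: map_mx f (ymx x)) =
    (1%:M + (z * s) *: A *m W) *m (1%:M + z *: Jmx lam n R).
  rewrite mulmxDl mul1mx -mulmxA WE yE -scalemxAl scalerDr scalerA addrA //.
rewrite det_mulmx det_1addJmx mulr1 det_1addM_comm -scalemxAr; congr (\det (_ + _)).
rewrite -mulrC -scalerA; congr (_ *: _); apply/matrixP => i j; rewrite !mxE.
have lj := lm_gt0 (ltn_ord j).
have lt_p : ((lm j).-1 < lm j)%N by rewrite prednK.
pose a := vtx lam_sum lt_p.
rewrite (bigD1 a) //= !mxE bl_vtx ps_vtx !eqxx mulr1 [X in _ * (_ + X)]big1 ?addr0 => [|c ne]; last first.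
  rewrite !mxE; case: eqP => [E1|]; last by rewrite mulr0.
  case: eqP => [E2|]; last by rewrite mulr0.
  by case/eqP: ne; apply: (bl_ps_inj (lam := lam)); rewrite ?bl_vtx ?ps_vtx.
have xl0 : (x i j)`_(lm j) = 0 by rewrite nth_default // size_x.
rewrite /rv [in RHS]big_ord_recr /= xl0 scale0r addr0 prednK //.
rewrite rmorph_sum horner_sum /= mulr_sumr -sumrN; apply: eq_bigr => p _.
rewrite map_polyZ /= hornerZ rmorphXn horner_exp /= rmorphN /= map_polyX hornerN hornerX.
have -> : (lm j - p = ((lm j).-1 - p).+1)%N by have := ltn_ord p; lia.
by rewrite exprS; ring.
Qed.

(** In the preceding identity take two independent indeterminates for [z] and [s], and compare the
    coefficients of [z^(i+1) s^(bl i + 1)]. *)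
Theorem Rmin_ymx (i : 'I_n) (x : nat -> nat -> {poly K}) :
  (forall i j, (i < k)%N -> (j < k)%N -> size (x i j) <= lm j)%N ->
  Rmin lam i (ymx x) = (pminors_sum (bl i).+1 (xmx x))`_i.+1.
Proof.
move=> size_x.
pose f : {rmorphism K -> {poly {poly K}}} := polyC \o polyC.
have := @det_ymx _ f 'X 'X%:P x size_x.
have -> : 1%:M + 'X *: (Jmx lam n _ + ('X%:P : {poly {poly K}}) *: map_mx f (ymx x)) =
    1%:M + 'X *: map_mx polyC (Jmx lam n {poly K} + 'X *: map_mx polyC (ymx x)).
  congr (_ + _ *: _); apply/matrixP => a b; rewrite !mxE polyCD polyCM.
  by congr (_ + _); rewrite rmorph_nat.
move/(congr1 (fun p : {poly {poly K}} => p`_i.+1)).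
rewrite -pminors_sum_coef (pminors_sum_Jmx lam_sum lam_sorted).
have -> : \matrix_(i0 < k, j < k) - (map_poly f (rv (lm j) (x i0 j))).['X] =
    map_mx (map_poly polyC) (xmx x).
  apply/matrixP => p q; rewrite !mxE rmorphN; congr (- _).
  rewrite map_poly_comp; set g := map_poly polyC _.
  by rewrite -[RHS]comp_polyXr.
rewrite det_1addZE coef_sum => H.
have := congr1 (fun p : {poly K} => p`_(bl i).+1) H.
rewrite coefXnM ltnn subnn -horner_coef0 Qmin_horner0 map_mx_hornerC => ->.
rewrite coef_sum.
have E (l : 'I_k.+1) : (('X%:P ^+ l * pminors_sum l (map_mx (map_poly polyC) (xmx x)))`_i.+1)`_(bl i).+1
   = if (bl i).+1 == l :> nat then (pminors_sum l (xmx x))`_i.+1 else 0 :> K.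
  rewrite -rmorphXn /= coefCM pminors_sum_map coef_map /= coefMC coefXn.
  by case: eqP; rewrite ?mul1r ?mul0r.
rewrite (eq_bigr _ (fun l _ => E l)).
have lt_l : ((bl i).+1 < k.+1)%N by rewrite ltnS bl_lt.
rewrite (bigD1 (Ordinal lt_l)) //= eqxx big1 ?addr0 // => l.
by rewrite -val_eqE /= eq_sym => /negbTE->.
Qed.

Lemma rv_horner l (f : {poly K}) t : (size f <= l.+1)%N -> t != 0 -> (rv l f).[t] = (- t) ^+ l * f.[(- t)^-1].
Proof.
move=> size_f nzt; rewrite /rv horner_sum (horner_coef_wide _ size_f) mulr_sumr.
apply: eq_bigr => p _; rewrite hornerZ horner_exp hornerN hornerX exprVn mulrCA; congr (_ * _).
have lep : (p <= l)%N by rewrite -ltnS.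
have E : (- t) ^+ l = (- t) ^+ (l - p) * (- t) ^+ p by rewrite -exprD subnK.
by rewrite E mulfK // expf_neq0 // oppr_eq0.
Qed.

Lemma poly_nonzero_eq (p q : {poly K}) : (forall t, t != 0 -> p.[t] = q.[t]) -> p = q.
Proof.
move=> E; suff /eqP : 'X * (p - q) = 0.
  by rewrite mulf_eq0 polyX_eq0 subr_eq0 => /eqP.
apply: (poly_all0 K_inf) => t; rewrite hornerM hornerX hornerD hornerN.
by have [->|/E->] := eqVneq t 0; rewrite ?mul0r // subrr mulr0.
Qed.

Lemma rv_prod m (a : 'I_m -> nat) (f : 'I_m -> {poly K}) : (forall i, size (f i) <= (a i).+1)%N ->
  \prod_i rv (a i) (f i) = rv (\sum_i a i) (\prod_i f i).
Proof.
move=> size_f; apply: poly_nonzero_eq => t nzt.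
have size_prod : (size ((\prod_i f i)%R) <= (\sum_i a i).+1)%N.
  apply: (big_rec2 (fun (p : {poly K}) s => (size p <= s.+1)%N)); first by rewrite size_poly1.
  move=> i p s _ IH; apply: (leq_trans (size_polyMleq _ _)).
  by move: (size_f i) IH; move: (size (f i)) (size p) => u v; lia.
rewrite rv_horner // !horner_prod -prodrXr -big_split; apply: eq_bigr => i _.
by rewrite rv_horner.
Qed.

Lemma coef_NXn e r : ((- 'X : {poly K}) ^+ e)`_r = (-1) ^+ e *+ (r == e).
Proof.
have -> : - 'X = (-1)%:P * 'X :> {poly K} by rewrite polyCN mulN1r.
by rewrite exprMn -rmorphXn /= coefCM coefXn mulr_natr.
Qed.

Lemma coef_rv l (f : {poly K}) s : (s <= l)%N -> (rv l f)`_(l - s) = (-1) ^+ (l - s) * f`_s.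
Proof.
move=> le_s; rewrite /rv coef_sum (bigD1 (Ordinal (le_s : s < l.+1)%N)) //= big1 ?addr0 => [|p].
  by rewrite coefZ coef_NXn eqxx mulr1n mulrC.
rewrite -val_eqE /= => ne; rewrite coefZ coef_NXn; case: eqP => E; last by rewrite mulr0.
by case/eqP: ne; have := ltn_ord p; lia.
Qed.

(** If a single permutation contributes, the minor sum is a product of reversed polynomials. As [pi]
    preserves the blocks up to [bl i], their formal degrees add up to the total size of these
    blocks, which turns the coefficient at [i.+1] into the coefficient of the unreversed product at
    [(lm (bl i)).-1 - ps i]. *)
Lemma Rmin_ymx_perm (i : 'I_n) (pi : 'S_k) (eps : K) : eps != 0 ->
  (forall j : 'I_k, (j <= bl i)%N -> (pi j <= bl i)%N) ->
  exists2 u, u != 0 & forall x : nat -> nat -> {poly K},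
  (forall i j, (i < k)%N -> (j < k)%N -> size (x i j) <= lm j)%N ->
  pminors_sum (bl i).+1 (xmx x) = eps%:P * \prod_(j < k | (j <= bl i)%N) xmx x j (pi j) ->
  Rmin lam i (ymx x) =
    u * (\prod_(j < k | (j <= bl i)%N) x j (pi j))`_((lm (bl i)).-1 - ps i).
Proof.
move=> nz pi_le; pose sg : K := \prod_(j < k | (j <= bl i)%N) -1.
exists (eps * sg * (-1) ^+ i.+1) => [|x size_x E].
  rewrite !mulf_neq0 ?expf_neq0 ?oppr_eq0 ?oner_eq0 // /sg.
  by apply/prodf_neq0 => j _; rewrite oppr_eq0 oner_eq0.
rewrite Rmin_ymx // E.
pose a (j : 'I_k) := if (j <= bl i)%N then lm (pi j) else 0%N.
pose g (j : 'I_k) := if (j <= bl i)%N then x j (pi j) else 1.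
have size_g j : (size (g j) <= (a j).+1)%N.
  by rewrite /g /a; case: ifP => _; rewrite ?size_poly1 // leqW // size_x.
have rv01 : rv 0 1 = 1 by rewrite /rv big_ord1 coefC scale1r expr0.
have Ex : \prod_(j < k | (j <= bl i)%N) xmx x j (pi j) = sg%:P * rv (\sum_j a j) (\prod_j g j).
  rewrite -rv_prod // [X in _ * X](bigID (fun j : 'I_k => (j <= bl i)%N)) /=.
  rewrite [X in _ * (_ * X)]big1 => [|j nle]; last by rewrite /a /g (negbTE nle) rv01.
  rewrite mulr1 /sg rmorph_prod -big_split; apply: eq_bigr => j le_j /=.
  by rewrite /a /g le_j !mxE rmorphN rmorph1 mulN1r.
have pi_eq j : (pi j <= bl i)%N = (j <= bl i)%N.
  apply/idP/idP; last exact: pi_le.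
  pose D := [set j : 'I_k | (j <= bl i)%N].
  have /eqP ED : pi @: D == D.
    rewrite eqEcard card_imset ?leqnn ?andbT; last exact: perm_inj.
    by apply/subsetP => _ /imsetP[l Dl ->]; move: Dl; rewrite !inE; apply: pi_le.
  move=> le_pi; have : pi j \in pi @: D by rewrite ED inE.
  by rewrite mem_imset ?inE //; exact: perm_inj.
have sum_a : (\sum_j a j = i.+1 + ((lm (bl i)).-1 - ps i))%N.
  rewrite /a -big_mkcond (eq_bigl (fun j => (pi j <= bl i)%N)) => [|j]; last by rewrite pi_eq.
  rewrite -(reindex_inj (h := pi) (P := fun j => (j <= bl i)%N) (F := fun j : 'I_k => lm j)) /=; last exact: perm_inj.
  have lt_bl := bl_lt lam_sum i.
  rewrite -(big_ord_widen_cond _ xpredT (fun j => lm j) lt_bl) big_ord_recr /=.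
  rewrite [X in X.+1](val_bl_ps lam_sum i); move: (ps_lt lam_sum i).
  by move: (lm (bl i)) (ps i) (\sum_(j < bl i) lm j)%N => u v w; lia.
have prod_g : \prod_j g j = \prod_(j < k | (j <= bl i)%N) x j (pi j).
  by rewrite [RHS]big_mkcond.
have Ei : i.+1 = (\sum_j a j - ((lm (bl i)).-1 - ps i))%N by rewrite sum_a addnK.
by rewrite Ex mulrA -rmorphM /= coefCM [in (rv _ _)`_ _]Ei coef_rv ?sum_a ?leq_addl // addnK prod_g mulrA.
Qed.

End Slices.

(** * Minor sums with a single contributing permutation *)

Lemma pminors_sum_single (R : comNzRingType) k r (X : 'M[R]_k) (pi : 'S_k) : (r < k)%N ->
  (forall j : 'I_k, (r < j)%N -> pi j = j) ->
  (forall (S : {set 'I_k}) (s : 'S_k), #|S| = r.+1 -> (forall i, i \in S -> X i (s i) != 0) ->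
     (forall i, i \notin S -> s i = i) -> S = [set j : 'I_k | (j <= r)%N] /\ s = pi) ->
  pminors_sum r.+1 X = (-1) ^+ pi * \prod_(j < k | (j <= r)%N) X j (pi j).
Proof.
move=> lt_r pi_fix H; pose D := [set j : 'I_k | (j <= r)%N].
have cD : #|D| == r.+1.
  rewrite -sum1_card; under eq_bigl do rewrite inE -ltnS.
  by rewrite -(big_ord_widen k (fun=> 1%N) lt_r) sum_nat_const card_ord muln1.
have term0 (S : {set 'I_k}) (s : 'S_k) : #|S| == r.+1 -> (S, s) != (D, pi) ->
    \prod_i (if i \in S then X i (s i) else (i == s i)%:R) = 0.
  move=> /eqP cS; apply: contraNeq => nz.
  have nzS i : (i \in S -> X i (s i) != 0) /\ (i \notin S -> s i = i).
    split=> iS.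
      by apply: contraNneq nz => E; rewrite (bigD1 i) //= iS E mul0r.
    apply/eqP; apply: contraNT nz => E.
    by rewrite (bigD1 i) //= (negbTE iS) [i == _]eq_sym (negbTE E) mul0r.
  by have [-> ->] := H S s cS (fun i => (nzS i).1) (fun i => (nzS i).2).
rewrite pminors_sumE (bigD1 D) //= [X in _ + X]big1 ?addr0 => [|S /andP[cS ne]]; last first.
  rewrite pminE big1 // => s _; rewrite term0 ?mulr0 //.
  by rewrite xpair_eqE (negbTE ne).
rewrite pminE (bigD1 pi) //= [X in _ + X]big1 ?addr0 => [|s ne]; last first.
  by rewrite term0 ?mulr0 // xpair_eqE (negbTE ne) andbF.
congr (_ * _); rewrite [RHS]big_mkcond; apply: eq_bigr => j _; rewrite inE; case: leqP => // lt.
by rewrite pi_fix // eqxx.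
Qed.

Section AntiTriangular.
Variables (k r : nat).
Hypothesis lt_r : (r < k)%N.

Definition flip (i : 'I_k) : 'I_k := if (i <= r)%N then insubd i (r - i)%N else i.

Lemma val_flip (i : 'I_k) : (i <= r)%N -> flip i = (r - i)%N :> nat.
Proof. by move=> le_i; rewrite /flip le_i val_insubd (leq_ltn_trans (leq_subr _ _)). Qed.

Lemma flip_id (i : 'I_k) : (r < i)%N -> flip i = i.
Proof. by move=> lt_i; rewrite /flip leqNgt lt_i. Qed.

Lemma flipK : involutive flip.
Proof.
move=> i; case: (leqP i r) => [le_i|lt_i]; last by rewrite !flip_id.
by apply: val_inj; rewrite /= val_flip val_flip ?leq_subr // subKn.
Qed.

Definition flip_perm : 'S_k := perm (inv_inj flipK).

Lemma pminors_sum_antitriangular (R : comNzRingType) (X : 'M[R]_k) :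
  (forall i j : 'I_k, (r < i + j)%N -> X i j = 0) ->
  pminors_sum r.+1 X = (-1) ^+ flip_perm * \prod_(j < k | (j <= r)%N) X j (flip_perm j).
Proof.
move=> X0; apply: pminors_sum_single => //.
  by move=> j lt_j; rewrite permE /flip leqNgt lt_j.
move=> S s cS nzS fixS.
have leS i : i \in S -> (i + s i <= r)%N.
  by move=> iS; rewrite leqNgt; apply/negP => /X0 E; move: (nzS i iS); rewrite E eqxx.
have ES : S = [set j : 'I_k | (j <= r)%N].
  apply/eqP; rewrite eqEcard cS; apply/andP; split.
    by apply/subsetP => i /leS; rewrite inE; apply: leq_trans; rewrite leq_addr.
  rewrite -sum1_card; under eq_bigl do rewrite inE -ltnS.
  by rewrite -(big_ord_widen k (fun=> 1%N) lt_r) sum_nat_const card_ord muln1.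
split=> //; apply/permP => i; rewrite permE; case: (leqP i r) => [le_i|lt_i]; last first.
  by rewrite fixS ?ES ?inE -?ltnNge // /flip leqNgt lt_i.
apply: val_inj; rewrite /= val_flip //.
(* Induction from [i = r] downwards: a value of [s i] below [r - i] is already taken by a larger
   index. *)
move: {2}(r - i)%N (leqnn (r - i)) => m; elim: m i le_i => [|m IH] i le_i le_m.
  by have := leS i; rewrite ES inE => /(_ le_i); lia.
have := leS i; rewrite ES inE => /(_ le_i) le_s.
have [//|ne] := eqVneq (s i : nat) (r - i)%N; exfalso.
have lt_s : (s i < r - i)%N by rewrite ltn_neqAle ne; lia.
have lt_k : (r - s i < k)%N by lia.
have := IH (Ordinal lt_k) _ _; rewrite /= => /(_ ltac:(lia) ltac:(lia)) E.
have /perm_inj/(congr1 val) /= : s (Ordinal lt_k) = s i by apply: val_inj; rewrite /= E; lia.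
lia.
Qed.

End AntiTriangular.

Section Companion.
Variables (k r : nat).
Hypothesis lt_r : (r < k)%N.

Definition shift (i : 'I_k) : 'I_k :=
  if (i < r)%N then insubd i i.+1 else if i == r :> nat then insubd i 0%N else i.

Lemma val_shift (i : 'I_k) : shift i = (if (i < r)%N then i.+1 else if i == r :> nat then 0%N else i) :> nat.
Proof.
rewrite /shift; case: ifP => [lt_i|_]; first by rewrite val_insubd (leq_ltn_trans lt_i).
by case: ifP => // _; rewrite val_insubd (leq_trans _ lt_r).
Qed.

Lemma shift_inj : injective shift.
Proof.
move=> i j /(congr1 val) /=; rewrite !val_shift => E; apply: val_inj => /=; move: E.
by repeat case: ifP; lia.
Qed.

Definition shift_perm : 'S_k := perm shift_inj.

(** The nonzero entries are the arrows from [i] to 0 and to [i.+1]. On a set preserved by [s] only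
    the largest element can return to 0, so [s] is the cycle through [0,..,r]. *)
Lemma pminors_sum_companion (R : comNzRingType) (X : 'M[R]_k) :
  (forall i j : 'I_k, (j != 0 :> nat)%N -> (j != i.+1 :> nat)%N -> X i j = 0) ->
  pminors_sum r.+1 X = (-1) ^+ shift_perm * \prod_(j < k | (j <= r)%N) X j (shift_perm j).
Proof.
move=> X0; apply: pminors_sum_single => //.
  by move=> j lt_j; rewrite permE; apply: val_inj; rewrite /= val_shift; repeat case: ifP; lia.
move=> S s cS nzS fixS.
have sS i : i \in S -> s i \in S.
  by move=> iS; apply: contraT => nS; move: (fixS _ nS) => /perm_inj E; rewrite E iS in nS.
have sv i : i \in S -> s i = 0%N :> nat \/ s i = i.+1 :> nat.
  move=> iS; have := nzS i iS; case: (eqVneq (s i : nat) 0%N) => [->|n0]; first by left.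
  by case: (eqVneq (s i : nat) i.+1) => [->|n1]; [right|rewrite X0 ?eqxx].
have [i0 i0S] : exists i0, i0 \in S by apply/card_gt0P; rewrite cS.
case: (arg_maxnP (fun i : 'I_k => i : nat) i0S) => m mS maxm.
have sm : s m = 0%N :> nat.
  by case: (sv m mS) => // E; have := maxm _ (sS _ mS); rewrite /= E; lia.
have si i : i \in S -> i != m -> s i = i.+1 :> nat.
  move=> iS ne; case: (sv i iS) => // E; case/eqP: ne; apply: (@perm_inj _ s).
  by apply: val_inj; rewrite /= E sm.
have inS j (lt_j : (j < k)%N) : (j <= m)%N -> Ordinal lt_j \in S.
  elim: j lt_j => [|j IH] lt_j le_j.
    by rewrite (_ : Ordinal lt_j = s m) ?sS //; apply: val_inj; rewrite /= sm.
  have lt_j' : (j < k)%N by apply: ltnW.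
  have jS := IH lt_j' (ltnW le_j).
  have ne : Ordinal lt_j' != m by rewrite -val_eqE /= ltn_eqF.
  rewrite (_ : Ordinal lt_j = s (Ordinal lt_j')) ?sS //.
  by apply: val_inj; rewrite /= si.
have ES : S = [set j : 'I_k | (j <= m)%N].
  apply/setP => j; rewrite inE; apply/idP/idP => [/maxm//|le_j].
  by rewrite (_ : j = Ordinal (ltn_ord j)) ?inS //; apply: val_inj.
have Em : m = r :> nat.
  apply/eqP; rewrite -eqSS -cS ES -sum1_card; under eq_bigl do rewrite inE -ltnS.
  by rewrite -(big_ord_widen k (fun=> 1%N) (ltn_ord m)) sum_nat_const card_ord muln1.
rewrite ES Em; split=> //; apply/permP => i; rewrite permE; apply: val_inj; rewrite /= val_shift.
case: (ltnP i r) => [lt_i|ge_i].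
  by rewrite si // ?ES ?inE -?val_eqE /= Em; lia.
case: eqP => [E|ne]; first by rewrite -[RHS]sm; congr (val (s _)); apply: val_inj; rewrite /= Em.
by rewrite fixS // ES inE Em -ltnNge; lia.
Qed.

End Companion.

(** * Values on the Hankel and companion slices *)

Section SliceValues.
Variables (K : fieldType) (lam : seq nat) (n : nat).
Hypothesis K_inf : exists u : nat -> K, injective u.
Hypothesis lam_sum : sumn lam = n.
Hypothesis lam_sorted : sorted geq lam.
Hypothesis lam_pos : all (fun l => 0 < l)%N lam.
Local Notation k := (size lam).
Local Notation lm j := (nth 0%N lam j).
Local Notation bl a := (bl lam a).
Local Notation ps a := (ps lam a).

Definition hankel (v : nat -> {poly K}) (c : nat -> K) i j : {poly K} :=
  if (i + j < k)%N then v (i + j)%N \Po ('X + (c j)%:P) else 0.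

Lemma rv0 l : rv l 0 = 0 :> {poly K}.
Proof. by rewrite /rv big1 // => p _; rewrite coef0 scale0r. Qed.

(* Set v_q = 0 for the blocks q after the block of i: the minor of X then reduces to
   the product over the antidiagonal i + j = q. *)
Lemma Rmin_hankel (i : 'I_n) : exists2 u, u != 0 & forall (v : nat -> {poly K}) (c : nat -> K),
  (forall q, (size (v q) <= lm q)%N) -> (forall q, (bl i < q)%N -> v q = 0) ->
  Rmin lam i (ymx lam n (hankel v c)) =
    u * (\prod_(j < (bl i).+1) (v (bl i) \Po ('X + (c j)%:P)))`_((lm (bl i)).-1 - ps i).
Proof.
have lt_bl := bl_lt lam_sum i.
have nz : (-1) ^+ flip_perm lt_bl != 0 :> K by rewrite expf_neq0 // oppr_eq0 oner_eq0.
have ple (j : 'I_k) : (j <= bl i)%N -> (flip_perm lt_bl j <= bl i)%N.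
  by move=> le_j; rewrite permE val_flip ?leq_subr.
have [u nzu H] := Rmin_ymx_perm K_inf lam_sum lam_sorted lam_pos nz ple.
exists u => // v c size_v v0.
have size_x p q : (p < k)%N -> (q < k)%N -> (size (hankel v c p q) <= lm q)%N.
  move=> _ _; rewrite /hankel; case: ifP => _; last by rewrite size_poly0.
  rewrite size_comp_poly2 ?size_XaddC //.
  by apply: (leq_trans (size_v _)); apply: nth_lam_anti => //; rewrite leq_addl.
have pE : pminors_sum (bl i).+1 (xmx lam (hankel v c)) = ((-1) ^+ flip_perm lt_bl)%:P *
    \prod_(j < k | (j <= bl i)%N) xmx lam (hankel v c) j (flip_perm lt_bl j).
  rewrite rmorphXn rmorphN rmorph1; apply: pminors_sum_antitriangular => p q lt_pq.
  by rewrite mxE /hankel; case: ifP => _; rewrite ?v0 // ?comp_poly0 rv0 oppr0.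
rewrite (H _ size_x pE); congr (_ * (polyseq _)`__).
rewrite (reindex_inj (h := flip_perm lt_bl)) /=; last exact: perm_inj.
rewrite (big_ord_widen k (fun j => v (bl i) \Po ('X + (c j)%:P)) lt_bl).
apply: eq_big => [j|j].
  rewrite permE ltnS; case: (leqP j (bl i)) => [le_j|lt_j]; first by rewrite val_flip ?leq_subr.
  by rewrite flip_id // leqNgt lt_j.
rewrite permE => le_j; have le_j' : (j <= bl i)%N.
  by move: le_j; case: (leqP j (bl i)) => // lt_j; rewrite flip_id // leqNgt lt_j.
by rewrite permE (flipK lt_bl) /hankel (val_flip lt_bl le_j') subnK // lt_bl.
Qed.

Definition compan (z : nat -> {poly K}) i j : {poly K} :=
  if j == 0%N then z i else if j == i.+1 then 1 else 0.

(** Along the only cycle, [0 -> 1 -> .. -> bl i -> 0], all entries are 1 except the last, which is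
    [z (bl i)]. *)
Lemma Rmin_compan (i : 'I_n) : exists2 u, u != 0 & forall z : nat -> {poly K},
  (forall q, (size (z q) <= lm q)%N) ->
  Rmin lam i (ymx lam n (compan z)) = u * (z (bl i))`_((lm (bl i)).-1 - ps i).
Proof.
have lt_bl := bl_lt lam_sum i.
have nz : (-1) ^+ shift_perm lt_bl != 0 :> K by rewrite expf_neq0 // oppr_eq0 oner_eq0.
have ple (j : 'I_k) : (j <= bl i)%N -> (shift_perm lt_bl j <= bl i)%N.
  by move=> le_j; rewrite permE val_shift //; repeat case: ifP; lia.
have [u nzu H] := Rmin_ymx_perm K_inf lam_sum lam_sorted lam_pos nz ple.
exists u => // z size_z.
have size_x p q : (p < k)%N -> (q < k)%N -> (size (compan z p q) <= lm q)%N.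
  move=> _ lt_q; rewrite /compan; case: eqP => [->|_].
    by apply: (leq_trans (size_z _)); apply: nth_lam_anti.
  by case: eqP => _; rewrite ?size_poly0 // size_poly1 lm_gt0.
have pE : pminors_sum (bl i).+1 (xmx lam (compan z)) = ((-1) ^+ shift_perm lt_bl)%:P *
    \prod_(j < k | (j <= bl i)%N) xmx lam (compan z) j (shift_perm lt_bl j).
  rewrite rmorphXn rmorphN rmorph1; apply: pminors_sum_companion => p q n0 n1.
  by rewrite mxE /compan (negbTE n0) (negbTE n1) rv0 oppr0.
rewrite (H _ size_x pE); congr (_ * (polyseq _)`__).
rewrite (bigD1 (Ordinal lt_bl)) //= permE /compan val_shift //= ltnn eqxx /= big1 ?mulr1 // => j.
rewrite -val_eqE /= => /andP[le_j ne]; rewrite permE val_shift //.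
have -> : (j < bl i)%N by rewrite ltn_neqAle ne.
by rewrite eqxx.
Qed.

End SliceValues.

(** * Splitting into linear forms on the Hankel slice *)

Section HankelTree.
Variables (K : fieldType) (lam : seq nat) (n : nat).
Hypothesis K_inf : exists u : nat -> K, injective u.
Hypothesis lam_sum : sumn lam = n.
Hypothesis lam_sorted : sorted geq lam.
Hypothesis lam_pos : all (fun l => 0 < l)%N lam.
Local Notation k := (size lam).
Local Notation lm j := (nth 0%N lam j).
Local Notation bl a := (bl lam a).
Local Notation ps a := (ps lam a).
Variable c : nat -> K.
Hypothesis c_inj : injective c.

(** The part of [v] in block [q], read as a polynomial of degree below [lm q]. *)
Definition pv (v : 'I_n -> K) (q : nat) : {poly K} := \sum_(a < n | bl a == q) v a *: 'X^(ps a).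

Lemma size_pv v q : (size (pv v q) <= lm q)%N.
Proof.
apply: (leq_trans (size_sum _ _ _)); apply/bigmax_leqP => a /eqP <-.
by apply: (leq_trans (size_scale_leq _ _)); rewrite size_polyXn ps_lt.
Qed.

Lemma coef_pv v (a : 'I_n) : (pv v (bl a))`_(ps a) = v a.
Proof.
rewrite coef_sum (bigD1 a) //= coefZ coefXn eqxx mulr1 big1 ?addr0 // => b /andP[/eqP Eb ne].
rewrite coefZ coefXn; case: eqP => E; last by rewrite mulr0.
by case/eqP: ne; apply: (bl_ps_inj (lam := lam)).
Qed.

Lemma pvK (f : nat -> {poly K}) q : (forall q, (size (f q) <= lm q)%N) ->
  pv (fun a => (f (bl a))`_(ps a)) q = f q.
Proof.
move=> size_f; apply/polyP => p; case: (ltnP p (lm q)) => [lt_p|ge_p]; last first.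
  by rewrite !nth_default // (leq_trans _ ge_p) ?size_pv.
pose a := vtx lam_sum lt_p.
have := coef_pv (fun a => (f (bl a))`_(ps a)) a.
by rewrite (bl_vtx lam_sum lt_p) (ps_vtx lam_sum lt_p).
Qed.

Lemma pv_eq0 v : (forall q, pv v q = 0) -> forall a, v a = 0.
Proof. by move=> v0 a; rewrite -coef_pv v0 coef0. Qed.

(** Coefficients of the linear form that takes [v] to the [p]-th Taylor coefficient of [pv v q] at
    [c j]. *)
Definition taylor (q : nat) (j p : nat) (a : 'I_n) : K :=
  if bl a == q then ('X^(ps a) \Po ('X + (c j)%:P))`_p else 0.

Lemma lf_taylor q j p v : lf (taylor q j p) v = (pv v q \Po ('X + (c j)%:P))`_p.
Proof.
rewrite /lf /pv raddf_sum coef_sum [RHS]big_mkcond; apply: eq_bigr => a _ /=.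
rewrite /taylor; case: eqP => _; last by rewrite mul0r.
by rewrite linearZ /= coefZ mulrC.
Qed.

Definition Dp r (p : nat -> nat) : {poly K} := \prod_(j < r.+1) ('X - (c j)%:P) ^+ p j.

Definition cofac r (p : nat -> nat) (j : 'I_r.+1) : {poly K} :=
  \prod_(l < r.+1 | l != j) ('X - (c l)%:P) ^+ p l.

Lemma DpE r p (j : 'I_r.+1) : Dp r p = ('X - (c j)%:P) ^+ p j * cofac p j.
Proof. by rewrite /Dp (bigD1 j). Qed.

Lemma cofac_neq0 r p (j : 'I_r.+1) : (cofac p j).[c j] != 0.
Proof.
rewrite horner_prod; apply/prodf_neq0 => l ne; rewrite horner_exp hornerXsubC.
by rewrite expf_neq0 // subr_eq0 (inj_eq c_inj) eq_sym.
Qed.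

Lemma shiftXsub (j : nat) : ('X - (c j)%:P) \Po ('X + (c j)%:P) = 'X.
Proof. by rewrite raddfB /= comp_polyX comp_polyC addrK. Qed.

Lemma shift_Dp r p (j : 'I_r.+1) w :
  exists2 h, (Dp r p * w) \Po ('X + (c j)%:P) = 'X ^+ p j * h & h`_0 = (cofac p j).[c j] * w.[c j].
Proof.
exists ((cofac p j * w) \Po ('X + (c j)%:P)).
  by rewrite (DpE p j) -mulrA rmorphM rmorphXn /= shiftXsub.
by rewrite -horner_coef0 horner_comp hornerD hornerX hornerC add0r hornerM.
Qed.

Lemma taylor_Dp r p (j : 'I_r.+1) v w : pv v r = Dp r p * w ->
  lf (taylor r j (p j)) v = (cofac p j).[c j] * w.[c j].
Proof.
move=> E; rewrite lf_taylor E; have [h -> <-] := shift_Dp p j w.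
by rewrite coefXnM ltnn subnn.
Qed.

Lemma size_Dp r p : size (Dp r p) = (\sum_(j < r.+1) p j).+1.
Proof.
rewrite /Dp; elim: (index_enum _) => [|j s IH]; first by rewrite !big_nil size_poly1.
have mn : \prod_(j <- s) ('X - (c j)%:P) ^+ p j \is monic.
  by apply: monic_prod => l _; apply/monic_exp/monicXsubC.
rewrite !big_cons size_Mmonic ?expf_neq0 ?polyXsubC_eq0 // IH.
by rewrite size_exp_XsubC addnS /= addSn.
Qed.

(** A node of the tree: the blocks after [r] are exhausted, and [pv v r] vanishes at each [c j] to
    order at least [p j]. *)
Definition Estate r p (v : 'I_n -> K) := (forall q, (r < q)%N -> pv v q = 0) /\ Dp r p %| pv v r.

Variable Pn : nat -> {mpoly K[n]}.
Hypothesis PnE : forall (i : 'I_n) v, (Pn i).@[v] = Rmin lam i (ymx lam n (hankel lam (pv v) c)).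

Fixpoint lst t := if t is t'.+1 then Pn t' :: lst t' else [::].

Lemma good_ext d (E E' : ('I_d -> K) -> Prop) ys : (forall x, E x <-> E' x) -> good E ys -> good E' ys.
Proof.
elim: ys E E' => [|y ys IH] E E' EE /=; first by move=> H x /EE; apply: H.
move=> [u [m [al [nzu yE nzal gd]]]]; exists u, m, al; split=> //.
- by move=> x /EE; apply: yE.
- by move=> i; have [w /EE Ew nz] := nzal i; exists w.
by move=> i; apply: IH (gd i) => x; split=> -[/EE].
Qed.

Lemma bl_ps_pred (i j : 'I_n) : i = j.+1 :> nat ->
  (bl i = bl j /\ ps i = (ps j).+1) \/ [/\ bl i = (bl j).+1, ps i = 0%N & ps j = (lm (bl j)).-1].
Proof.
move=> E; have pj := ps_lt lam_sum j.
case: (ltnP (ps j).+1 (lm (bl j))) => [lt|ge].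
  left; have : i = vtx lam_sum lt.
    by apply: val_inj; rewrite /= E [in LHS](vtxE lam_sum j) /= /flatten_index addnS.
  by move=> ->; rewrite bl_vtx ps_vtx.
have vi := val_bl_ps lam_sum i; have vj := val_bl_ps lam_sum j.
have Ej : ps j = (lm (bl j)).-1.
  by move: ge pj; move: (ps j) (lm (bl j)) => x y; lia.
right; have Ei : (i = \sum_(l < (bl j).+1) lm l :> nat)%N.
  rewrite big_ord_recr /= E; move: vj pj; rewrite Ej.
  by move: (lm (bl j)) (\sum_(l < bl j) lm l)%N => x y; lia.
have bi := bl_lt lam_sum i.
have widen a b : (a <= b)%N -> (\sum_(l < a) lm l <= \sum_(l < b) lm l)%N.
  move=> le; rewrite (big_ord_widen b (fun l => lm l) le) big_mkcond.
  by apply: leq_sum => l _; case: ifP.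
case: (ltngtP (bl i) (bl j).+1) => [lt|gt|Eb].
- have lt_i : (i < \sum_(l < (bl i).+1) lm l)%N.
    by rewrite big_ord_recr /= {1}vi ltn_add2l ps_lt.
  by have := leq_trans lt_i (widen _ _ lt); rewrite -Ei ltnn.
- have ge_i : (\sum_(l < (bl j).+2) lm l <= i)%N.
    by rewrite [X in (_ <= X)%N]vi (leq_trans (widen _ _ gt)) ?leq_addr.
  move: ge_i; rewrite big_ord_recr /= -Ei; have := lm_gt0 lam_pos (ltn_trans gt bi).
  by move: (lm (bl j).+1) => x; lia.
by split=> //; move: vi; rewrite Eb -Ei; move: (ps i) => x; lia.
Qed.

(** If [pv v r = Dp r p * w], its Taylor coefficient of order [p j] at [c j] is [w.[c j]] times the
    value of the other factors, which is nonzero since the points are distinct. *)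
Lemma Estate_step r (p : nat -> nat) (j : 'I_r.+1) v :
  Estate r (fun l : nat => p l + (l == j :> nat))%N v <-> Estate r p v /\ lf (taylor r j (p j)) v = 0.
Proof.
have DS : Dp r (fun l : nat => p l + (l == j :> nat))%N = Dp r p * ('X - (c j)%:P).
  rewrite (DpE _ j) (DpE p j) eqxx addn1 exprS /cofac.
  rewrite (eq_bigr (fun l : 'I_r.+1 => ('X - (c l)%:P) ^+ p l)) => [|l /negbTE ne]; first by ring.
  by rewrite val_eqE ne addn0.
rewrite /Estate DS; split=> [[v0 /dvdpP[w E]]|[[v0 /dvdpP[w E]] tj]].
  split; first by split=> //; apply: (dvdp_trans (dvdp_mulr _ (dvdpp _))); rewrite E dvdp_mull.
  rewrite (@taylor_Dp r p j v (('X - (c j)%:P) * w)); last by rewrite E; ring.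
  by rewrite hornerM hornerXsubC subrr mul0r mulr0.
split=> //; have E' : pv v r = Dp r p * w by rewrite E mulrC.
move: tj; rewrite (taylor_Dp j E') => /eqP; rewrite mulf_eq0 (negbTE (cofac_neq0 p j)) /= => wj.
by rewrite E' dvdp_mul2l ?dvdp_XsubCl //; rewrite -size_poly_eq0 size_Dp.
Qed.

(** The witness has [pv w r = Dp r p], which fits into the block because its degree is below
    [lm r]. *)
Lemma Estate_nonzero r (p : nat -> nat) (j : 'I_r.+1) : (\sum_(l < r.+1) p l < lm r)%N ->
  exists2 w, Estate r p w & lf (taylor r j (p j)) w != 0.
Proof.
move=> lt_s; pose f q := if q == r then Dp r p else 0.
have size_f q : (size (f q) <= lm q)%N.
  by rewrite /f; case: eqP => [->|_]; rewrite ?size_poly0 // size_Dp.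
exists (fun a => (f (bl a))`_(ps a)).
  split=> [q lt_q|]; first by rewrite pvK // /f gtn_eqF.
  by rewrite pvK // /f eqxx dvdpp.
rewrite (@taylor_Dp r p j _ 1) ?hornerC ?mulr1 ?cofac_neq0 //.
by rewrite pvK // /f eqxx.
Qed.

(** A polynomial of degree below [lm r] divisible by one of degree [lm r] is zero. *)
Lemma Estate_last r (p : nat -> nat) v : (\sum_(l < r.+1) p l = lm r)%N ->
  Estate r p v <-> (forall q, (r <= q)%N -> pv v q = 0).
Proof.
move=> Es; split=> [[v0 dv] q|v0].
  rewrite leq_eqVlt => /orP[/eqP <-|]; last exact: v0.
  apply/eqP; apply: contraT => nz; have := dvdp_leq nz dv.
  by rewrite size_Dp Es ltnNge size_pv.
by split=> [q /ltnW/v0//|]; rewrite v0 ?dvdp0.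
Qed.

(** On the node the factor at [c j] is divisible by ['X ^+ p j]. The coefficient read by [Rmin] has
    index [\sum_j p j], hence is the product of the lowest coefficients of the factors, and these
    are the Taylor forms. *)
Lemma good_step (i : 'I_n) (p : nat -> nat) : (\sum_(j < (bl i).+1) p j = (lm (bl i)).-1 - ps i)%N ->
  (forall j : 'I_(bl i).+1, good (Estate (bl i) (fun l : nat => p l + (l == j :> nat))%N) (lst i)) ->
  good (Estate (bl i) p) (lst i.+1).
Proof.
move=> Ep gd; have [u nzu H] := Rmin_hankel K_inf lam_sum lam_sorted lam_pos i.
exists u, (bl i).+1, (fun j => taylor (bl i) j (p j)); split.
- by [].
- move=> v [v0 /dvdpP[w E]]; rewrite PnE H //; last exact: size_pv.
  congr (u * _); have E' : pv v (bl i) = Dp (bl i) p * w by rewrite E mulrC.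
  rewrite -Ep E'.
  have /fin_all_exists2[h Hh h0] (j : 'I_(bl i).+1) : exists2 h : {poly K},
      (Dp (bl i) p * w) \Po ('X + (c j)%:P) = 'X ^+ p j * h & h`_0 = (cofac p j).[c j] * w.[c j].
    exact: shift_Dp.
  rewrite (eq_bigr (fun j : 'I_(bl i).+1 => 'X ^+ p j * h j)) // big_split /= prodrXr.
  rewrite coefXnM ltnn subnn -horner_coef0 horner_prod; apply: eq_bigr => j _.
  by rewrite horner_coef0 h0 (taylor_Dp j E').
- move=> j; apply: Estate_nonzero; rewrite Ep.
  by have := ps_lt lam_sum i; move: (lm (bl i)) (ps i); lia.
by move=> j; apply: good_ext (gd j) => v; apply: Estate_step.
Qed.

Lemma Estate0 r v : Estate r (fun=> 0%N) v <-> (forall q, (r < q)%N -> pv v q = 0).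
Proof.
split=> [[//]|v0]; split=> //; rewrite /Dp big1 ?dvd1p // => j _; exact: expr0.
Qed.

(** As [i] decreases inside a block, the index read by [Rmin] and the total order both grow by one.
    After the vertex with [ps i = 0] the total order is the block size, and the previous block
    starts with all orders 0. *)
Theorem hankel_tree : good (fun=> True) (lst n).
Proof.
have step t : forall (i : 'I_n) (p : nat -> nat), i = t :> nat ->
    (\sum_(j < (bl i).+1) p j = (lm (bl i)).-1 - ps i)%N -> good (Estate (bl i) p) (lst i.+1).
  elim: t => [|t IH] i p Ei Ep; apply: good_step => // j.
    have [bi pi0] : bl i = 0%N /\ ps i = 0%N.
      have lt_bl := bl_lt lam_sum i.
      have : (\sum_(l < bl i) lm l + ps i == 0)%N by rewrite -(val_bl_ps lam_sum i) Ei.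
      rewrite addn_eq0 => /andP[/eqP sum0 /eqP ->]; split=> //.
      case: (posnP (bl i)) => [//|gt]; move/eqP: sum0; rewrite (bigD1 (Ordinal gt)) //= addn_eq0.
      by rewrite gtn_eqF // lm_gt0 // (ltn_trans gt lt_bl).
    have -> : lst i = [::] by rewrite Ei.
    move=> v /Estate_last v0 a; apply: pv_eq0 => q; apply: v0; last by rewrite bi.
    rewrite big_split /= Ep; have := lm_gt0 lam_pos (bl_lt lam_sum i); rewrite pi0.
    rewrite (bigD1 j) //= eqxx big1 => [|l /negbTE ne]; last by rewrite val_eqE ne.
    by move: (lm (bl i)) => x; lia.
  have lt_t : (t < n)%N by rewrite -Ei ltnW.
  pose i' := Ordinal lt_t; have Ei' : i = i'.+1 :> nat by rewrite Ei.
  have Ep' : (\sum_(l < (bl i).+1) (p l + (l == j :> nat)) = ((lm (bl i)).-1 - ps i).+1)%N.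
    rewrite big_split /= Ep (bigD1 j) //= eqxx big1 ?addn1 // => l /negbTE ne; by rewrite val_eqE ne.
  have -> : lst i = lst i'.+1 by rewrite -Ei'.
  case: (bl_ps_pred Ei') => [[Eb Eps]|[Eb E0 E1]].
    rewrite Eb in j Ep' *; apply: IH => //; rewrite Ep' Eps.
    by have := ps_lt lam_sum i; rewrite Eb Eps; move: (lm _) (ps _) => x y; lia.
  have H := IH i' (fun=> 0%N) erefl; apply: good_ext (H _) => [v|]; last first.
    by rewrite E1 subnn big1.
  rewrite Estate0 Estate_last; first by rewrite Eb.
  rewrite Ep' E0 subn0 prednK // lm_gt0 // ; exact: bl_lt.
have [n0|n_gt0] := posnP n.
  by rewrite [X in lst X]n0 => v _ a; have := ltn_ord a; rewrite {2}n0.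
have lt_i : (n.-1 < n)%N by rewrite prednK.
pose i := Ordinal lt_i.
have -> : lst n = lst i.+1 by congr lst; rewrite /= prednK.
have Ebl : (bl i).+1 = k /\ ps i = (lm (bl i)).-1.
  have k_gt0 : (0 < k)%N by exact: leq_ltn_trans (bl_lt lam_sum i).
  have lt_k : (k.-1 < k)%N by rewrite prednK.
  have lt_p : ((lm k.-1).-1 < lm k.-1)%N by rewrite prednK // lm_gt0.
  have -> : i = vtx lam_sum lt_p.
    apply: val_inj; rewrite [RHS](val_bl_ps lam_sum) bl_vtx ps_vtx /=.
    have -> : n = (\sum_(l < k.-1.+1) lm l)%N.
      by rewrite -lam_sum sumnE (big_nth 0%N) -[X in index_iota _ X](prednK k_gt0) big_mkord.
    rewrite big_ord_recr /=.
    by move: lt_p; move: (lm k.-1) (\sum_(l < k.-1) lm l)%N => x y; lia.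
  by rewrite bl_vtx ps_vtx prednK.
apply: good_ext (step _ i (fun=> 0%N) erefl _) => [v|].
  rewrite Estate0; split=> // _ q lt_q; apply/eqP; rewrite -size_poly_eq0 -leqn0.
  by apply: (leq_trans (size_pv _ _)); rewrite nth_default // -(proj1 Ebl).
by rewrite (proj2 Ebl) subnn big1.
Qed.

End HankelTree.

(** * Transfer to the dual of the centralizer *)

Section Transfer.
Variables (K : fieldType) (n d : nat) (M : 'M[K]_(n, d)).

Definition lmap (v : 'I_n -> K) (j : 'I_d) : K := \sum_a v a * M a j.
Definition pull (p : {mpoly K[d]}) : {mpoly K[n]} := msub (fun j => \sum_a M a j *: 'X_a) p.

Lemma pull_meval p v : (pull p).@[v] = p.@[lmap v].
Proof.
rewrite /pull msub_meval; apply: meval_eq => j; rewrite rmorph_sum; apply: eq_bigr => a _ /=.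
by rewrite mevalZ mevalXi mulrC.
Qed.

(** Where the head vanishes, one of its linear factors does, so the point stays in a child node
    until only the origin is left. *)
Lemma good_zero (E : ('I_n -> K) -> Prop) ys v : good E ys -> E v -> (forall y, y \in ys -> y.@[v] = 0) ->
  forall a, v a = 0.
Proof.
elim: ys E => [|y ys IH] E /=; first by move=> H /H.
move=> [c [m [al [nzc yE nzal gd]]]] Ev y0.
have /eqP := y0 y (mem_head _ _); rewrite yE // mulf_eq0 (negbTE nzc) /= => /prodf_eq0[i _ /eqP al0].
by apply: (IH _ (gd i)) => // z z_in; apply: y0; rewrite inE z_in orbT.
Qed.

(** Since [M] is injective, every linear form on the source extends to the target through the
    pseudo-inverse. *)
Lemma good_image (E : ('I_n -> K) -> Prop) ys : row_free M ->
  good E (map pull ys) -> good (fun x => exists2 v, E v & x = lmap v) ys.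
Proof.
move=> freeM; elim: ys E => [|y ys IH] E /=.
  move=> E0 x [v /E0 v0 ->] j; rewrite /lmap big1 // => a _; by rewrite v0 mul0r.
move=> [c [m [al [nzc yE nzal gd]]]].
pose al' i j : K := \sum_a pinvmx M j a * al i a.
have al'E i v : lf (al' i) (lmap v) = lf (al i) v.
  have MV := mulmxVp freeM.
  rewrite /lf /lmap /al'; under eq_bigr do rewrite mulr_suml; rewrite exchange_big.
  apply: eq_bigr => a _ /=; under eq_bigr do rewrite mulrAC mulr_sumr mulr_suml.
  rewrite exchange_big (bigD1 a) //= [X in _ + X]big1 ?addr0 => [|b ne].
    transitivity ((M *m pinvmx M) a a * (al i a * v a)); last by rewrite MV mxE eqxx mul1r.
    rewrite mxE mulr_suml; apply: eq_bigr => j _; ring.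
  transitivity ((M *m pinvmx M) b a * (al i a * v b)); last by rewrite MV mxE (negbTE ne) mul0r.
  rewrite mxE mulr_suml; apply: eq_bigr => j _; ring.
exists c, m, al'; split=> //.
- move=> x [v Ev ->]; rewrite -pull_meval yE //; congr (_ * _).
  by apply: eq_bigr => i _; rewrite al'E.
- by move=> i; have [w Ew nz] := nzal i; exists (lmap w); [exists w|rewrite al'E].
move=> i; apply: good_ext (IH _ (gd i)) => x; split=> [[v [Ev v0] ->]|[[v Ev ->] v0]].
  by split; [exists v|rewrite al'E].
by exists v => //; split=> //; rewrite -al'E.
Qed.

Lemma good_cut N (L : 'I_N -> 'I_d -> K) (s : seq 'I_N) zs : uniq s ->
  forall E, (forall i, i \in s -> exists w, [/\ E w, lf (L i) w != 0 & forall l, l \in s -> l != i -> lf (L l) w = 0]) ->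
  good (fun x => E x /\ forall i, i \in s -> lf (L i) x = 0) zs -> good E ([seq lfp (L i) | i <- s] ++ zs).
Proof.
elim: s => [|i s IH] /=; first by move=> _ E _; apply: good_ext => x; split=> [[]|].
move=> /andP[nis us] E dual gd; exists 1, 1%N, (fun=> L i); split.
- exact: oner_neq0.
- by move=> x _; rewrite big_ord1 mul1r meval_lfp.
- by move=> _; have [w [Ew nz _]] := dual i (mem_head _ _); exists w.
move=> _; apply: IH => // [l l_in|].
  have [|w [Ew nz w0]] := dual l _; first by rewrite inE l_in orbT.
  exists w; split=> //; last by move=> l' l'_in; apply: w0; rewrite inE l'_in orbT.
  split=> //; apply: w0; first exact: mem_head.
  by apply: contraNneq nis => ->.
apply: good_ext gd => x; split=> [[Ex x0]|[[Ex xi] x0]].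
  by split=> [|l l_in]; [split=> //; apply: x0; apply: mem_head|apply: x0; rewrite inE l_in orbT].
by split=> // l; rewrite inE => /predU1P[->//|]; apply: x0.
Qed.

End Transfer.

(** * Regularity and codimension from the tree *)

Section Assembly.
Variables (K : closedFieldType) (lam : seq nat) (n d : nat).
Hypothesis K_inf : exists u : nat -> K, injective u.
Hypothesis lam_sum : sumn lam = n.
Hypothesis lam_sorted : sorted geq lam.
Hypothesis lam_pos : all (fun l => 0 < l)%N lam.
Variables (P : 'I_n -> {mpoly K[d]}) (M : 'M[K]_(n, d)) (c : nat -> K).
Hypothesis c_inj : injective c.
Hypothesis PM : forall i v, (P i).@[lmap M v] = Rmin lam i (ymx lam n (hankel lam (pv lam v) c)).
Hypothesis P_hom : forall i, exists2 e, (0 < e)%N & P i \is e.-homog.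
Hypothesis P0 : forall i, (P i).@[fun=> 0] = 0.

Let Pn t := if insub t is Some i then pull M (P i) else 0.

Let rev_Ps : lst Pn n = map (pull M) (rev [seq P i | i <- enum 'I_n]).
Proof.
have E t : lst Pn t = rev [seq Pn l | l <- iota 0 t].
  by elim: t => // t IH; rewrite -[in RHS]addn1 iotaD map_cat rev_cat -IH.
rewrite E map_rev -val_enum_ord -map_comp -[in RHS]map_comp; congr rev.
by apply: eq_map => i /=; rewrite /Pn valK.
Qed.

Let tree_v : good (fun=> True) (lst Pn n).
Proof.
apply: (hankel_tree K_inf lam_sum lam_sorted lam_pos c_inj) => i v.
by rewrite /Pn valK pull_meval PM.
Qed.

(** At a vector killed by [M] all the pulled-back polynomials take their value at the origin, which
    is 0; such a common zero is 0 by the tree. *)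
Lemma lmap_row_free : row_free M.
Proof.
rewrite -kermx_eq0; apply/eqP/row_matrixP => i; rewrite row0.
set x := row i _; have xM : x *m M = 0 by rewrite -row_mul mulmx_ker row0.
apply/rowP => a; rewrite [RHS]mxE; move: a; apply: (good_zero tree_v) => // y.
rewrite rev_Ps => /mapP[p]; rewrite mem_rev => /mapP[j _ ->] ->.
rewrite pull_meval -(P0 j); apply: meval_eq => b.
by have /rowP/(_ b) := xM; rewrite !mxE.
Qed.

(** A basis of the linear forms vanishing on the image of [M]; these are the [d - n] additional
    members of the regular sequence. *)
Let B := row_base (kermx M^T).
Let N := \rank (kermx M^T).

Lemma codim_sum : (N + n = d)%N.
Proof.
rewrite /N mxrank_ker mxrank_tr (eqP lmap_row_free) subnK //.
by rewrite -(eqP lmap_row_free) rank_leq_col.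
Qed.

Lemma full_tree : good (fun=> True) ([seq lfp (fun j => B i j) | i <- enum 'I_N] ++ rev [seq P i | i <- enum 'I_n]).
Proof.
have freeB : row_free B by apply: row_base_free.
have BM : B *m M^T = 0 by apply/sub_kermxP; rewrite eq_row_base.
apply: good_cut; first exact: enum_uniq.
  move=> i _; exists (fun j => pinvmx B j i); split=> //.
    have /matrixP/(_ i i) := mulmxVp freeB; rewrite !mxE eqxx => E.
    by rewrite (_ : lf _ _ = 1) ?oner_neq0 // -E.
  move=> l _ ne; have /matrixP/(_ l i) := mulmxVp freeB; rewrite !mxE (negbTE ne).
  exact.
have := tree_v; rewrite rev_Ps => /(good_image lmap_row_free); apply: good_ext => x; split.
  move=> [v _ ->]; split=> // i _; rewrite /lf /lmap.
  under eq_bigr do rewrite mulr_sumr; rewrite exchange_big big1 // => a _.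
  have /matrixP/(_ i a) := BM; rewrite !mxE => E.
  transitivity (v a * \sum_j B i j * M^T j a); last by rewrite E mulr0.
  by rewrite mulr_sumr; apply: eq_bigr => j _; rewrite [M^T _ _]mxE; ring.
move=> [_ x0]; pose xr : 'rV[K]_d := \row_j x j.
have /submxP[v Ev] : (xr <= M)%MS.
  have sub : (M <= kermx B^T)%MS.
    by apply/sub_kermxP; apply: trmx_inj; rewrite trmx_mul trmxK BM trmx0.
  have : (xr <= kermx B^T)%MS.
    apply/sub_kermxP/rowP => i; rewrite mxE [RHS]mxE; apply: etrans (x0 i (mem_enum _ _)).
    by rewrite /lf; apply: eq_bigr => j _; rewrite [xr _ _]mxE [B^T _ _]mxE mulrC.
  move/submx_trans; apply; rewrite -(geq_leqif (mxrank_leqif_sup sub)).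
  by rewrite mxrank_ker mxrank_tr (eqP freeB) (eqP lmap_row_free) leq_subLR codim_sum.
exists (fun a => v 0 a) => //; apply: boolp.funext => j.
by have /rowP/(_ j) := Ev; rewrite !mxE.
Qed.

Theorem assembled_regular : regular_seq P.
Proof. exact: (regular_family K_inf P_hom full_tree). Qed.

Theorem assembled_codim (V : aset K d) Z : (forall x, V x <-> forall i, (P i).@[x] = 0) ->
  irreducible_component V Z -> has_codim Z n.
Proof. move=> VE; exact: (component_codim K_inf codim_sum P_hom full_tree VE). Qed.

End Assembly.

(** * The sl2-triple *)

Section Sl2.
Variables (K : fieldType) (V : lmodType K).
Hypothesis char0 : forall m : nat, m.+1%:R != 0 :> K.

Section Chain.
Variables A B H : {linear V -> V}.
Hypothesis AB : forall x, B (A x) = A (B x) - H x.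
Hypothesis HA : forall x, A (H x) = H (A x) - 2%:R *: A x.
Hypothesis BH : forall x, H (B x) = B (H x) - 2%:R *: B x.

(** The operators [H - a] for [a] in [s], applied successively. A zero result says that only the
    weights in [s] occur in [x], with no need to decompose [V] into eigenspaces. *)
Definition kill (s : seq K) (x : V) := foldr (fun a y => H y - a *: y) x s.

Lemma kill_linear s : linear (kill s).
Proof.
elim: s => [|a s IH] c x y //=; rewrite -!/(kill _ _) IH linearP /= scalerDr scalerBr !scalerA.
by rewrite [a * c]mulrC opprD addrACA.
Qed.

Lemma kill0 s : kill s 0 = 0.
Proof. by elim: s => //= a s ->; rewrite linear0 scaler0 subr0. Qed.

Lemma killZ s c x : kill s (c *: x) = c *: kill s x.
Proof. by have := kill_linear s c x 0; rewrite kill0 !addr0. Qed.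

Lemma kill_comm a s x : kill s (H x - a *: x) = H (kill s x) - a *: kill s x.
Proof.
elim: s => //= b s ->; rewrite ![H (_ - _)]linearB ![H (_ *: _)]linearZ /= !scalerBr !scalerA [b * a]mulrC.
move: (H (H _)) (a *: _) (b *: _) ((_ * _) *: _) => p q r t.
rewrite !opprB !addrA -!(addrA p) ![p + _]addrC -!addrA [LHS]addrCA [RHS]addrCA.
congr (_ + _); exact: addrCA.
Qed.

Lemma kill_B s x : kill s (B x) = B (kill [seq a + 2%:R | a <- s] x).
Proof.
by elim: s => //= a s ->; rewrite BH [B (_ - _)]linearB [B (_ *: _)]linearZ /= [(a + _) *: _]scalerDl opprD addrA addrAC.
Qed.

(** The classical string formula. It is stated under [A (B u) = 0] because this is what is known of
    a preimage [z] of an element in the kernel of [E]. *)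
Lemma chain_step u r : A (B u) = 0 ->
  B (iter r.+1 A u) = - r.+1%:R *: (H (iter r A u) - r%:R *: iter r A u).
Proof.
move=> u0; elim: r => [|r IH]; first by rewrite /= AB u0 sub0r scale0r subr0 scaleN1r.
rewrite [iter r.+2 A u]/= AB -/(iter r.+1 A u) IH.
rewrite [A (_ *: _)]linearZ [A (_ - _)]linearB [A (_ *: _)]linearZ /= HA.
move: (A (iter r A u)) => y; move: (H y) => z; rewrite !scalerBr !scalerA.
have -> : - r.+2%:R *: z = - r.+1%:R *: z - z :> V.
  by rewrite -[in LHS]addn1 natrD opprD scalerDl scaleN1r.
have -> : (- r.+2%:R * r.+1%:R) *: y = (- r.+1%:R * 2%:R) *: y + (- r.+1%:R * r%:R) *: y.
  by rewrite -scalerDl -mulrDr -natrD !mulNr mulrC.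
by move: (_ *: z) (_ *: y) (_ *: y) => p q r0; rewrite [in RHS]opprD !addrA [LHS]addrAC; congr (_ - _); exact: addrAC.
Qed.

(** Starting from [iter p A u = 0] and going down the string, [B] lowers the weights by 2 and the
    string formula adds one factor [H - r]; the scalar [r.+1] is invertible. *)
Lemma chain_kill u p : A (B u) = 0 -> iter p A u = 0 -> kill [seq - j%:R | j <- iota 0 p] u = 0.
Proof.
move=> u0 up.
suff aux r l : (r + l = p)%N -> kill [seq r%:R - j%:R | j <- iota 0 l] (iter r A u) = 0.
  by have := aux 0%N p erefl; rewrite (eq_map (g := fun j => - j%:R)) // => j; rewrite sub0r.
elim: l r => [|l IH] r; first by rewrite addn0 => -> /=.
rewrite addnS -addSn => E; have {IH} := IH r.+1 E.
move=> k0.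
have E2 : [seq a + 2%:R | a <- [seq r%:R - 1 - j%:R | j <- iota 0 l]] = [seq r.+1%:R - j%:R | j <- iota 0 l] :> seq K.
  by rewrite -map_comp; apply: eq_map => j /=; rewrite -[r.+1%:R]natr1; ring.
have := kill_B [seq r%:R - 1 - j%:R | j <- iota 0 l] (iter r.+1 A u); rewrite E2.
rewrite k0 linear0 chain_step // killZ => /eqP; rewrite scaler_eq0 oppr_eq0 (negbTE (char0 _)) /=.
rewrite kill_comm subr0 => /eqP <-.
set s1 := map _ _; set s2 := map _ _; suff -> : s1 = s2 by [].
rewrite /s1 /s2 (iotaDl 1 0) -map_comp; apply: eq_map => j /=.
by rewrite -[j.+1%:R]natr1; ring.
Qed.

(** Two coprime polynomials in [H] have no common kernel. *)
Lemma kill_disjoint s t x : (forall a b, a \in s -> b \in t -> a != b) ->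
  kill s x = 0 -> kill t x = 0 -> x = 0.
Proof.
elim: s x => //= a s IH x dis; rewrite -kill_comm => ks kt.
have Hx : H x - a *: x = 0.
  apply: IH => //; first by move=> b c' b_in; apply: dis; rewrite inE b_in orbT.
  by rewrite kill_comm kt linear0 scaler0 subr0.
elim: t dis kt {IH ks} => //= b t IHt dis; rewrite -kill_comm.
have -> : H x - b *: x = (a - b) *: x by rewrite scalerBl -{1}(subrK (a *: x) (H x)) Hx add0r.
rewrite killZ => /eqP; rewrite scaler_eq0 subr_eq0 (negbTE (dis a b _ _)) ?mem_head //= => /eqP.
by apply: IHt => a' b' a_in b_in; apply: dis => //; rewrite inE b_in orbT.
Qed.

End Chain.

(* x = F z with E x = 0: the weights of x are <= -2 because of the E-string through z,
   and >= 0 because of the F-string through x. *)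
Lemma sl2_ker_im (E H F : {linear V -> V}) p x z :
  (forall x, E (F x) = F (E x) + H x) -> (forall x, H (E x) = E (H x) + 2%:R *: E x) ->
  (forall x, H (F x) = F (H x) - 2%:R *: F x) ->
  (forall y, iter p E y = 0) -> (forall y, iter p F y = 0) ->
  x = F z -> E x = 0 -> x = 0.
Proof.
move=> EF HE HF Ep Fp xz Ex.
(* With [-H], the roles of [E] and [F] can be exchanged in the string argument. *)
pose H' : {linear V -> V} := -%R \o H.
have k1 : kill H [seq - j%:R | j <- iota 0 p] z = 0.
  apply: (@chain_kill E F H) => // [y|y|]; last by rewrite -xz.
  - by rewrite EF addrK.
  - by rewrite HE addrK.
have k2 : kill H' [seq - j%:R | j <- iota 0 p] x = 0.
  apply: (@chain_kill F E H') => // [y|y|y|]; last by rewrite Ex linear0.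
  - by rewrite /= opprK EF.
  - by rewrite /= linearN HF opprB addrAC subrr add0r.
  - by rewrite /= HE opprD linearN.
have k1' : kill H [seq - j%:R - 2%:R | j <- iota 0 p] x = 0.
  rewrite xz (kill_B HF) -map_comp -[RHS](linear0 F) -[in RHS]k1; congr (F (kill _ _ _)).
  by apply: eq_map => j /=; rewrite subrK.
have k2' : kill H [seq j%:R | j <- iota 0 p] x = 0.
  have aux s y : kill H' [seq - a | a <- s] y = (-1) ^+ size s *: kill H s y.
    elim: s => [|a s IH] /=; first by rewrite scale1r.
    by rewrite IH /= [H (_ *: _)]linearZ /= [(- a) *: _]scaleNr opprK exprS mulN1r scaleNr scalerBr opprB addrC !scalerA [a * _]mulrC.
  have := aux [seq j%:R | j <- iota 0 p] x; rewrite -map_comp k2 => /esym/eqP.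
  by rewrite scaler_eq0 expf_eq0 oppr_eq0 oner_eq0 andbF => /eqP.
apply: (kill_disjoint _ k1' k2') => _ _ /mapP[i _ ->] /mapP[j _ ->].
rewrite -subr_eq0 -!opprD oppr_eq0 -!natrD addn2 addSn; exact: char0.
Qed.

End Sl2.



(** * Trace duality for commutators *)

Section TraceDuality.
Variables (K : fieldType).

Lemma row_full_dual m p (A : 'M[K]_(m, p)) : (forall v : 'cV_p, A *m v = 0 -> v = 0) -> row_full A.
Proof.
move=> H; rewrite -cokermx_eq0; apply/eqP/matrixP => i j.
have /matrixP/(_ i 0) : col j (cokermx A) = 0 by apply: H; rewrite colE mulmxA mulmx_coker mul0mx.
by rewrite !mxE.
Qed.

Lemma ker_dual m p (A : 'M[K]_(m, p)) (v : 'cV_m) : kermx A *m v = 0 -> exists u, v = A *m u.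
Proof.
move=> kv; exists (pinvmx A *m v); apply/eqP; rewrite -subr_eq0 mulmxA -[X in X - _]mul1mx -mulmxBl.
have /submxP[D ->] : (1%:M - A *m pinvmx A <= kermx A)%MS.
  by apply/sub_kermxP; rewrite mulmxBl mul1mx mulmxKpV ?subrr.
by rewrite -mulmxA kv mulmx0.
Qed.

Variable n : nat.
Implicit Types a x : 'M[K]_n.

Definition trv a : 'cV[K]_(n * n) := (mxvec a^T)^T.

Lemma trvK (v : 'cV_(n * n)) : trv (vec_mx v^T)^T = v.
Proof. by rewrite /trv trmxK vec_mxK trmxK. Qed.

Lemma trvP a x : mxvec x *m trv a = (\tr (a *m x))%:M.
Proof.
rewrite [LHS]mx11_scalar; congr _%:M; rewrite mxE (reindex _ (curry_mxvec_bij n n)) /=.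
rewrite mxtrace_mulC /mxtrace [RHS](eq_bigr (fun i => \sum_j x i j * a j i)); last by move=> i _; rewrite mxE.
by rewrite pair_bigA; apply: eq_bigr => [[i j]] _ /=; rewrite !mxE !mxvecE mxE.
Qed.

Lemma trace_mul_eq0 a : (forall x, \tr (a *m x) = 0) -> a = 0.
Proof.
move=> a0; apply/matrixP => i j; rewrite [RHS]mxE -[RHS](a0 (delta_mx j i)) mxtrace_mulC.
rewrite /mxtrace (bigD1 j) //= big1 ?addr0 => [|k /negbTE kj].
  rewrite mxE (bigD1 i) //= mxE !eqxx mul1r big1 ?addr0 // => k /negbTE ki.
  by rewrite mxE ki andbF mul0r.
by rewrite mxE big1 // => l _; rewrite mxE kj mul0r.
Qed.

Definition adm a x := a *m x - x *m a.
Lemma adm_linear a : linear (adm a).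
Proof.
move=> c x y; rewrite /adm mulmxDr mulmxDl -scalemxAr -scalemxAl scalerBr opprD !addrA.
by congr (_ - _); rewrite addrAC.
Qed.
HB.instance Definition _ a := GRing.isLinear.Build K _ _ _ (adm a) (adm_linear a).

Lemma adm_trace a w x : \tr (a *m adm w x) = \tr (adm a w *m x).
Proof.
by rewrite /adm mulmxBr mulmxBl !mulmxA !(raddfB mxtrace) /= (mxtrace_mulC (a *m x)) mulmxA.
Qed.

(** By duality: a matrix orthogonal under the trace form to the kernel of [adm f] and to the image
    of [adm e] lies in the image of [adm f] and in the kernel of [adm e], hence is 0. *)
Lemma slice_decomposition e f : (forall a w, adm a e = 0 -> a = adm f w -> a = 0) ->
  forall x, exists y w, adm f y = 0 /\ x = y + adm e w.
Proof.
move=> H x; pose A := col_mx (kermx (lin_mx (adm f))) (lin_mx (adm e)).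
have /(submx_full (mxvec x))/submxP[D xE] : row_full A.
  apply: row_full_dual => v; rewrite mul_col_mx -[0]vsubmxK linear0 linear0.
  move=> /eq_col_mx[/ker_dual[u vu] ve]; rewrite -[v]trvK; set a := (vec_mx _)^T.
  suff -> : a = 0 by rewrite /trv !linear0.
  apply: (H _ (- (vec_mx u^T)^T)).
    apply: trace_mul_eq0 => y; rewrite -adm_trace; have := trvP a (adm e y).
    by rewrite trvK -mul_vec_lin -mulmxA ve mulmx0 => /matrixP/(_ 0 0); rewrite !mxE mulr1n.
  set u' := (vec_mx _)^T; have trE y : \tr (u' *m adm f y) = \tr (a *m y).
    have := trvP a y; rewrite trvK vu mulmxA mul_vec_lin -[u]trvK trvP => /matrixP/(_ 0 0).
    by rewrite !mxE !mulr1n.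
  apply/eqP; rewrite -subr_eq0; apply/eqP/trace_mul_eq0 => y.
  rewrite [adm f _]raddfN opprK mulmxDl [\tr _]raddfD /= -trE adm_trace.
  by rewrite /adm -[u' *m f - _]opprB mulNmx [\tr (- _)]raddfN addNr.
exists (vec_mx (lsubmx D *m kermx (lin_mx (adm f)))), (vec_mx (rsubmx D)); split.
  apply: (can_inj mxvecK); rewrite -mul_vec_lin vec_mxK -mulmxA mulmx_ker mulmx0.
  by rewrite linear0.
apply: (can_inj mxvecK); rewrite linearD /= -[mxvec (adm e _)]mul_vec_lin !vec_mxK -mul_row_col hsubmxK; exact: xE.
Qed.

End TraceDuality.

(** * The decomposition attached to an sl2-triple *)

Section Triple.
Variables (K : fieldType) (n : nat).
Hypothesis char0 : forall m : nat, m.+1%:R != 0 :> K.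
Implicit Types e f h x : 'M[K]_n.

Lemma adm_jacobi e f x : adm e (adm f x) = adm f (adm e x) + adm (adm e f) x.
Proof.
rewrite /adm !(mulmxBl, mulmxBr) !mulmxA.
by apply/matrixP => i j; rewrite !mxE; ring.
Qed.

Lemma admZl c e x : adm (c *: e) x = c *: adm e x.
Proof. by rewrite /adm -scalemxAl -scalemxAr scalerBr. Qed.

Lemma adm_mxpow h f c k : adm h f = c *: f -> adm h (mxpow f k) = (k%:R * c) *: mxpow f k.
Proof.
move=> hf; elim: k => [|k IH]; first by rewrite /adm mul0r scale0r mulmx1 mul1mx subrr.
rewrite mxpowS -natr1 mulrDl mul1r scalerDl.
have -> : adm h (f *m mxpow f k) = adm h f *m mxpow f k + f *m adm h (mxpow f k).
  by rewrite /adm !(mulmxBl, mulmxBr) !mulmxA addrA subrK.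
by rewrite hf IH -scalemxAl -scalemxAr addrC.
Qed.

(** Nonzero powers [f^k] are eigenvectors of [adm h] for the pairwise distinct eigenvalues [k c],
    and there are at most [n * n] of these. *)
Lemma weight_nilpotent h f c : c != 0 -> adm h f = c *: f -> exists k, mxpow f k = 0.
Proof.
move=> c0 hf; pose M := lin_mx (adm h); pose s := [seq k%:R * c | k <- iota 0 (n * n).+1].
case: (boolP [forall k : 'I_(n * n).+1, mxpow f k != 0]); last first.
  by rewrite negb_forall => /existsP[k /negPn/eqP fk]; exists k.
move=> /forallP nz.
have us : uniq s.
  rewrite map_inj_uniq ?iota_uniq // => i j /(mulIf c0).
  wlog ij : i j / (i <= j)%N => [W|/eqP].
    by case: (leqP i j) => [/W//|/ltnW/W{}W /esym/W].
  rewrite -subr_eq0 -opprB oppr_eq0 -natrB // => /eqP d0.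
  case: (posnP (j - i)) => [|]; first by move=> /eqP; rewrite subn_eq0 => ji; apply/eqP; rewrite eqn_leq ij.
  by case: (j - i)%N d0 => // m /eqP; rewrite (negbTE (char0 m)).
have rs : all (root (char_poly M)) s.
  apply/allP => _ /mapP[k k_in ->]; rewrite -eigenvalue_root_char.
  apply/eigenvalueP; exists (mxvec (mxpow f k)).
    by rewrite mul_vec_lin /= (adm_mxpow _ hf) linearZ.
  move: k_in; rewrite mem_iota add0n.
  by move=> k_lt; have := nz (Ordinal k_lt); apply: contraNneq => m0; apply/eqP/(can_inj mxvecK); rewrite m0 linear0.
have := max_poly_roots _ rs us; rewrite size_char_poly size_map size_iota ltnn.
by move=> /(_ (monic_neq0 (char_poly_monic _))).
Qed.

Lemma adm_nilpotent f k x : mxpow f k = 0 -> iter (k + k) (adm f) x = 0.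
Proof.
move=> fk.
suff aux m : forall a b, (k + k <= a + b + m)%N -> mxpow f a *m iter m (adm f) x *m mxpow f b = 0.
  by have := aux (k + k)%N 0%N 0%N (leqnn _); rewrite mul1mx mulmx1.
elim: m => [|m IH] a b ab /=.
  have [ka|ak] := leqP k a; first by rewrite (mxpow_eq0 fk ka) !mul0mx.
  by rewrite (@mxpow_eq0 _ _ f k b fk) ?mulmx0 //; lia.
rewrite /adm mulmxBr mulmxBl mulmxA -mxpowSr IH; last by lia.
by rewrite mulmxA -mulmxA -mxpowS IH ?subrr //; lia.
Qed.

Lemma triple_decomposition e h f : mxnilpotent e -> (e = 0 -> f = 0) ->
  (e != 0 -> [/\ lie h e = 2 *: e, lie h f = - (2 *: f) & lie e f = h]) ->
  forall x, exists y w, adm f y = 0 /\ x = y + adm e w.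
Proof.
move=> [k ek] f0 tri; have [e0|/tri[he hf ef]] := eqVneq e 0.
  by move=> x; exists x, 0; rewrite f0 // e0 /adm !mul0mx !mulmx0 subrr addr0.
have two0 : - 2%:R != 0 :> K by rewrite oppr_eq0.
have [l fl] : exists k, mxpow f k = 0.
  by apply: (@weight_nilpotent h f _ two0); rewrite scaleNr.
apply: slice_decomposition => a w ae aw.
pose p := ((k + l) + (k + l))%N.
apply: (@sl2_ker_im K 'M[K]_n char0 (adm e) (adm h) (adm f) p a w) => // [x|x|x|x|x|].
- by rewrite /= adm_jacobi; congr (_ + adm _ _).
- by rewrite /= adm_jacobi -admZl; congr (_ + adm _ _).
- by rewrite /= adm_jacobi -scaleNr -admZl scaleNr; congr (_ + adm _ _).
- by apply: adm_nilpotent; rewrite mxpowD [mxpow e k]ek mul0mx.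
- by apply: adm_nilpotent; rewrite mxpowD fl mulmx0.
- by move: ae; rewrite /= /adm => /eqP; rewrite subr_eq0 => /eqP ->; rewrite subrr.
Qed.
End Triple.

(** * Transversality of the companion slice *)

Section Transversal.
Variables (K : fieldType) (lam : seq nat) (n : nat).
Hypothesis lam_sum : sumn lam = n.
Hypothesis lam_sorted : sorted geq lam.
Local Notation k := (size lam).
Local Notation lm j := (nth 0%N lam j).
Local Notation bl a := (bl lam a).
Local Notation ps a := (ps lam a).
Local Notation J := (Jmx lam n K).
Local Notation y0 := (ymx lam n (compan (fun=> 0))).

Lemma big_jedge_l (F : 'I_n -> K) (x x' : 'I_n) : jedge lam x x' ->
  \sum_z F z * (jedge lam z x')%:R = F x.
Proof.
move=> xx'; rewrite (bigD1 x) //= xx' mulr1 big1 ?addr0 // => z zx.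
case: (boolP (jedge lam z x')) => [/andP[/eqP Eb /eqP Ep]|]; last by rewrite mulr0.
case/andP: xx' => /eqP Eb' /eqP Ep'; case/eqP: zx; apply: (bl_ps_inj (lam := lam)); first by rewrite -Eb.
by apply: succn_inj; rewrite -Ep.
Qed.

Lemma big_jedge_r (F : 'I_n -> K) (x x' : 'I_n) : jedge lam x x' ->
  \sum_z (jedge lam x z)%:R * F z = F x'.
Proof.
move=> xx'; rewrite (bigD1 x') //= xx' mul1r big1 ?addr0 // => z zx.
case: (boolP (jedge lam x z)) => [/andP[/eqP Eb /eqP Ep]|]; last by rewrite mul0r.
case/andP: xx' => /eqP Eb' /eqP Ep'; case/eqP: zx; apply: (bl_ps_inj (lam := lam)); first by rewrite Eb.
by rewrite Ep.
Qed.

Lemma big_nojedge_l (F : 'I_n -> K) (y : 'I_n) : ps y = 0%N ->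
  \sum_z F z * (jedge lam z y)%:R = 0.
Proof. by move=> y0; rewrite big1 // => z _; rewrite /jedge y0 andbF mulr0. Qed.

Lemma big_nojedge_r (F : 'I_n -> K) (x : 'I_n) : (ps x).+1 = lm (bl x) ->
  \sum_z (jedge lam x z)%:R * F z = 0.
Proof.
move=> xl; rewrite big1 // => z _; case: (boolP (jedge _ _ _)) => [/andP[/eqP Eb /eqP Ep]|]; last by rewrite mul0r.
by have := ps_lt lam_sum z; rewrite Ep Eb xl ltnn.
Qed.

Section Centralizer.
Variable a : 'M[K]_n.
Hypothesis aJ : a *m J = J *m a.

Lemma centE x y : \sum_z a x z * (jedge lam z y)%:R = \sum_z (jedge lam x z)%:R * a z y.
Proof.
have /matrixP/(_ x y) := aJ; rewrite !mxE.
under eq_bigr do rewrite mxE. move->.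
by under eq_bigr do rewrite mxE.
Qed.

(** In each pair of blocks an element of the centralizer is constant along diagonals. Sliding to the
    first column or to the last row then shows which diagonals vanish. *)
Lemma cent_shift d (x y x' y' : 'I_n) : bl x' = bl x -> bl y' = bl y ->
  ps x' = (ps x + d)%N -> ps y' = (ps y + d)%N -> a x y = a x' y'.
Proof.
elim: d x y => [|d IH] x y Ex Ey Px Py.
  rewrite addn0 in Px; rewrite addn0 in Py.
  by have -> : x' = x; [exact: (bl_ps_inj (lam := lam)) | have -> : y' = y; first exact: (bl_ps_inj (lam := lam))].
have ltx : ((ps x).+1 < lm (bl x))%N by have := ps_lt lam_sum x'; rewrite Ex Px; lia.
have lty : ((ps y).+1 < lm (bl y))%N by have := ps_lt lam_sum y'; rewrite Ey Py; lia.
rewrite -(IH (vtx lam_sum ltx) (vtx lam_sum lty)) ?bl_vtx ?ps_vtx ?addSnnS //.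
have ex : jedge lam x (vtx lam_sum ltx) by rewrite /jedge bl_vtx ps_vtx !eqxx.
have ey : jedge lam y (vtx lam_sum lty) by rewrite /jedge bl_vtx ps_vtx !eqxx.
by rewrite -(big_jedge_l (a x) ey) centE (big_jedge_r _ ex).
Qed.

Lemma cent_lower (x y : 'I_n) : (ps y < ps x)%N -> a x y = 0.
Proof.
move=> yx; have lx := ps_lt lam_sum x; have ly := ps_lt lam_sum y.
have lt1 : ((ps x - ps y).-1 < lm (bl x))%N by lia.
have lt2 : (ps x - ps y < lm (bl x))%N by lia.
have lt3 : (0 < lm (bl y))%N by lia.
rewrite -(@cent_shift (ps y) (vtx lam_sum lt2) (vtx lam_sum lt3)) ?bl_vtx ?ps_vtx //; last by lia.
have e : jedge lam (vtx lam_sum lt1) (vtx lam_sum lt2).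
  by rewrite /jedge !bl_vtx !ps_vtx eqxx /=; apply/eqP; lia.
by rewrite -(big_jedge_r (fun z => a z _) e) -centE big_nojedge_l ?ps_vtx.
Qed.

Lemma cent_upper (x y : 'I_n) : (ps y + lm (bl x) < lm (bl y) + ps x)%N -> a x y = 0.
Proof.
move=> yx; have lx := ps_lt lam_sum x; have ly := ps_lt lam_sum y.
have lt1 : ((lm (bl x)).-1 < lm (bl x))%N by lia.
have lt2 : (ps y + (lm (bl x) - (ps x).+1) < lm (bl y))%N by lia.
have lt3 : ((ps y + (lm (bl x) - (ps x).+1)).+1 < lm (bl y))%N by lia.
rewrite (@cent_shift (lm (bl x) - (ps x).+1) x y (vtx lam_sum lt1) (vtx lam_sum lt2)) ?bl_vtx ?ps_vtx //; last by lia.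
have e : jedge lam (vtx lam_sum lt2) (vtx lam_sum lt3) by rewrite /jedge !bl_vtx !ps_vtx !eqxx.
by rewrite -(big_jedge_l (a _) e) centE big_nojedge_r ?bl_vtx ?ps_vtx //; lia.
Qed.

End Centralizer.

(** For [lm j <= lm i + r] these are the usual spanning elements of the centralizer of [J], each
    supported on one diagonal of the block at [i], [j]. *)
Definition shiftmx i j r : 'M[K]_n :=
  \matrix_(p, q) ((bl p == i) && (bl q == j) && (ps q == ps p + r)%N)%:R.

Lemma shiftmx_cent i j r : (lm j <= lm i + r)%N -> shiftmx i j r *m J = J *m shiftmx i j r.
Proof.
move=> le; apply/matrixP => p q; rewrite !mxE.
under eq_bigr => z _ do rewrite !mxE.
under [RHS]eq_bigr => z _ do rewrite !mxE.
have lp := ps_lt lam_sum p; have lq := ps_lt lam_sum q.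
have [q0|q_gt0] := posnP (ps q).
  rewrite big_nojedge_l // big1 // => z _; case: (boolP (jedge _ _ _)) => [/andP[_ /eqP Ep]|]; last by rewrite mul0r.
  by rewrite q0 Ep addSn andbF mulr0.
have lt1 : ((ps q).-1 < lm (bl q))%N by lia.
have e1 : jedge lam (vtx lam_sum lt1) q by rewrite /jedge bl_vtx ps_vtx eqxx prednK /=.
rewrite (big_jedge_l (fun z => ((bl p == i) && (bl z == j) && (ps z == ps p + r)%N)%:R) e1) bl_vtx ps_vtx.
have [pl|pl] := eqVneq (ps p).+1 (lm (bl p)).
  rewrite (big_nojedge_r (fun z => ((bl z == i) && (bl q == j) && (ps q == ps z + r)%N)%:R)) //.
  case: (bl p =P i) => //= Ei; case: (bl q =P j) => //= Ej; case: eqP => //= E.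
  by move: lq le E pl; rewrite Ei Ej; lia.
have lt2 : ((ps p).+1 < lm (bl p))%N by lia.
have e2 : jedge lam p (vtx lam_sum lt2) by rewrite /jedge bl_vtx ps_vtx !eqxx.
rewrite (big_jedge_r (fun z => ((bl z == i) && (bl q == j) && (ps q == ps z + r)%N)%:R) e2) bl_vtx ps_vtx.
by congr (_ && _)%:R; apply/eqP/eqP; lia.
Qed.

(** The arrows of [y0] lead from the last vertex of a block to the first vertex of the next one. *)
Definition dedge (s p : 'I_n) := [&& ps s == (lm (bl s)).-1, bl p == (bl s).+1 & ps p == 0%N].

Lemma y0E s p : (y0 : 'M[K]_n) s p = (dedge s p)%:R.
Proof.
rewrite mxE /dedge /compan; case: eqP => //= _.
case: (bl p =P 0%N) => [->|_] /=; first by rewrite coef0.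
by case: eqP => _ /=; rewrite ?coef0 // coef1.
Qed.

Lemma trace_shift (i j r : nat) (X : 'M[K]_n) :
  \tr (shiftmx i j r *m X) = \sum_(p : 'I_n) \sum_(q : 'I_n) (if (bl p == i) && (bl q == j) && (ps q == ps p + r)%N then X q p else 0).
Proof.
apply: eq_bigr => p _; rewrite mxE; apply: eq_bigr => q _; rewrite mxE.
by case: ifP => _; rewrite ?mul1r ?mul0r.
Qed.

Lemma sum2_single (F : 'I_n -> 'I_n -> K) p0 q0 : (forall p q, F p q != 0 -> p = p0 /\ q = q0) ->
  \sum_p \sum_q F p q = F p0 q0.
Proof.
move=> H; rewrite (bigD1 p0) //= [X in _ + X]big1 ?addr0 => [|p np]; last first.
  by apply: big1 => q _; apply: contra_eq np => /H[-> _]; rewrite eqxx.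
rewrite (bigD1 q0) //= big1 ?addr0 // => q nq.
by apply: contra_eq nq => /H[_ ->]; rewrite eqxx.
Qed.

Variable a : 'M[K]_n.

Lemma sum_dedge_l (F : 'I_n -> K) s p : dedge s p -> \sum_z F z * (dedge z p)%:R = F s.
Proof.
move=> sp; rewrite (bigD1 s) //= sp mulr1 big1 ?addr0 // => z zs.
case: (boolP (dedge z p)) => [/and3P[/eqP P1 /eqP B1 _]|]; last by rewrite mulr0.
case/and3P: sp => /eqP P2 /eqP B2 _.
have Eb : bl z = bl s by apply: succn_inj; rewrite -B1.
by case/eqP: zs; apply: (bl_ps_inj Eb); rewrite P1 P2 Eb.
Qed.

Lemma sum_dedge_r (F : 'I_n -> K) s p : dedge s p -> \sum_z (dedge s z)%:R * F z = F p.
Proof.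
move=> sp; rewrite (bigD1 p) //= sp mul1r big1 ?addr0 // => z zs.
case: (boolP (dedge s z)) => [/and3P[_ /eqP B1 /eqP P1]|]; last by rewrite mul0r.
case/and3P: sp => _ /eqP B2 /eqP P2.
by case/eqP: zs; apply: (bl_ps_inj (lam := lam)); rewrite ?B1 ?B2 ?P1 ?P2.
Qed.

Lemma trace_shift_l i j r (x y : 'I_n) : bl x = j -> ps x = r -> (bl y).+1 = i -> ps y = (lm (bl y)).-1 ->
  (i < k)%N -> (forall l, (l < k)%N -> 0 < lm l)%N -> \tr (shiftmx i j r *m (a *m y0)) = a x y.
Proof.
move=> xj xr yi yl ik pos; rewrite trace_shift.
pose p0 := vtx lam_sum (pos i ik).
rewrite (@sum2_single _ p0 x) => [|p q].
  rewrite bl_vtx ps_vtx xj xr !eqxx mxE; under eq_bigr do rewrite y0E.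
  by rewrite (@sum_dedge_l _ y) // /dedge bl_vtx ps_vtx yl yi !eqxx.
case: ifP => [/andP[/andP[/eqP Ei /eqP Ej] /eqP Er]|]; last by rewrite eqxx.
have [p00|p_gt0] := eqVneq (ps p) 0%N.
  move=> _; split; apply: (bl_ps_inj (lam := lam)); rewrite ?bl_vtx ?ps_vtx //; first by rewrite Ej.
  by rewrite Er p00.
rewrite mxE big1 ?eqxx // => z _; rewrite y0E /dedge (negbTE p_gt0) !andbF; exact: mulr0.
Qed.

Lemma trace_shift_r i j r (x y : 'I_n) : bl x = j.+1 -> ps x = 0%N -> bl y = i -> (ps y + r).+1 = lm j ->
  \tr (shiftmx i j r *m (y0 *m a)) = a x y.
Proof.
move=> xj x0 yi yr; rewrite trace_shift.
have lt0 : ((lm j).-1 < lm j)%N by lia.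
pose q0 := vtx lam_sum lt0.
rewrite (@sum2_single _ y q0) => [|p q].
  rewrite bl_vtx ps_vtx yi !eqxx -yr /= eqxx mxE; under eq_bigr do rewrite y0E.
  by rewrite (@sum_dedge_r _ _ x) // /dedge bl_vtx ps_vtx xj x0 !eqxx.
case: ifP => [/andP[/andP[/eqP Ei /eqP Ej] /eqP Er]|]; last by rewrite eqxx.
have [ql|q_nl] := eqVneq (ps q) (lm (bl q)).-1.
  move=> _; split; apply: (bl_ps_inj (lam := lam)); rewrite ?bl_vtx ?ps_vtx ?Ei ?yi //; last by rewrite ql Ej.
  by move: Er; rewrite ql Ej -yr /= => /addIn.
by rewrite mxE big1 ?eqxx // => z _; rewrite y0E /dedge (negbTE q_nl) /= mul0r.
Qed.

Lemma trace_shift_r0 i j r : (k <= j.+1)%N -> \tr (shiftmx i j r *m (y0 *m a)) = 0.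
Proof.
move=> kj; rewrite trace_shift; apply: big1 => p _; apply: big1 => q _; case: ifP => // /andP[/andP[_ /eqP Ej] _].
rewrite mxE big1 // => z _; rewrite y0E /dedge Ej.
case: (bl z =P j.+1) => [E|]; last by rewrite andbF mul0r.
by have := bl_lt lam_sum z; rewrite E ltnNge kj.
Qed.

Hypothesis lam_pos : all (fun l => 0 < l)%N lam.
Hypothesis aJ : a *m J = J *m a.
Hypothesis a_orb : forall u : 'M[K]_n, u *m J = J *m u -> \tr ((u *m a - a *m u) *m y0) = 0.
Hypothesis a_slice : forall x y : 'I_n, bl x = 0%N -> ps y = (lm (bl y)).-1 -> (ps x < lm (bl y))%N -> a x y = 0.

Let pos l : (l < k)%N -> (0 < lm l)%N.
Proof. by move=> lk; apply: (all_nthP 0%N lam_pos). Qed.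

(** Orthogonality to the orbit directions, tested on one spanning element of the centralizer.
    Together with the two trace evaluations it equates an entry of [a] in the blocks [(j, i-1)] with
    one in the blocks [(j+1, i)]. *)
Lemma shift_rel i j r : (lm j <= lm i + r)%N ->
  \tr (shiftmx i j r *m (a *m y0)) = \tr (shiftmx i j r *m (y0 *m a)).
Proof.
move=> /shiftmx_cent/a_orb; rewrite mulmxBl (raddfB mxtrace) /= => /eqP; rewrite subr_eq0 => /eqP.
by rewrite mulmxA => ->; rewrite -mulmxA mxtrace_mulC -mulmxA.
Qed.

(** On and above the block diagonal the entries are moved up to block row 0, where the slice
    condition makes them vanish. *)
Lemma transversal_ge m : forall x y : 'I_n, bl x = m -> (m <= bl y)%N -> a x y = 0.
Proof.
elim: m => [|m IH] x y xm my; have lx := ps_lt lam_sum x; have ly := ps_lt lam_sum y;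
  have [yx|xy] := ltnP (ps y) (ps x); try by rewrite (cent_lower aJ).
- have le : (lm (bl y) <= lm (bl x))%N by rewrite xm; apply: nth_lam_anti.
  have lt1 : (ps x + ((lm (bl y)).-1 - ps y) < lm (bl x))%N by lia.
  have lt2 : ((lm (bl y)).-1 < lm (bl y))%N by lia.
  rewrite (cent_shift aJ (d := ((lm (bl y)).-1 - ps y)%N) (x' := vtx lam_sum lt1) (y' := vtx lam_sum lt2)) ?bl_vtx ?ps_vtx //; last by lia.
  by apply: a_slice; rewrite ?bl_vtx ?ps_vtx //; lia.
have lt1 : (0 < lm (bl x))%N by lia.
have lt2 : (ps y - ps x < lm (bl y))%N by lia.
rewrite -(cent_shift aJ (d := ps x) (x := vtx lam_sum lt1) (y := vtx lam_sum lt2)) ?bl_vtx ?ps_vtx ?subnK //.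
have le := nth_lam_anti lam_sum lam_sorted my; have le' := nth_lam_anti lam_sum lam_sorted (leqnSn m).
pose i' := (bl y).-1; have Ei : bl y = i'.+1 by rewrite /i' prednK // (leq_trans _ my).
have i'k : (i' < k)%N by rewrite -ltnS -Ei ltnS ltnW // bl_lt.
have le2 := nth_lam_anti lam_sum lam_sorted (leqnSn i').
have lt3 : (lm m - (ps y - ps x).+1 < lm m)%N by rewrite xm in lt1; lia.
have lt4 : ((lm i').-1 < lm i')%N by have := pos i'k; lia.
rewrite -(@trace_shift_r (bl y) m (lm m - (ps y - ps x).+1)) ?bl_vtx ?ps_vtx //; last by lia.
rewrite -shift_rel; last by lia.
rewrite (@trace_shift_l _ _ _ (vtx lam_sum lt3) (vtx lam_sum lt4)) ?bl_vtx ?ps_vtx // ?bl_lt //.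
by apply: IH; rewrite ?bl_vtx //; rewrite Ei in my.
Qed.

(** Below the block diagonal the entries are moved down to the last block row, from which [y0] leads
    nowhere and the trace is 0. *)
Lemma transversal_lt d : forall x y : 'I_n, (k <= bl x + d)%N -> (bl y < bl x)%N -> a x y = 0.
Proof.
elim: d => [|d IH] x y kx yx; first by have := bl_lt lam_sum x; rewrite addn0 ltnNge in kx *; rewrite kx.
have lx := ps_lt lam_sum x; have ly := ps_lt lam_sum y.
have [up|le] := ltnP (ps y + lm (bl x)) (lm (bl y) + ps x); first exact: (cent_upper aJ).
have lt1 : (ps x + ((lm (bl y)).-1 - ps y) < lm (bl x))%N by lia.
have lt2 : ((lm (bl y)).-1 < lm (bl y))%N by lia.
rewrite (cent_shift aJ (d := ((lm (bl y)).-1 - ps y)%N) (x' := vtx lam_sum lt1) (y' := vtx lam_sum lt2)) ?bl_vtx ?ps_vtx //; last by lia.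
have yk : ((bl y).+1 < k)%N by apply: leq_trans (bl_lt lam_sum x).
have le2 := nth_lam_anti lam_sum lam_sorted yx.
rewrite -(@trace_shift_l (bl y).+1 (bl x) (ps x + ((lm (bl y)).-1 - ps y))) ?bl_vtx ?ps_vtx //.
rewrite shift_rel; last by lia.
have [xk|xk] := ltnP (bl x).+1 k; last exact: trace_shift_r0.
have lt3 : (lm (bl x) - (ps x + ((lm (bl y)).-1 - ps y)).+1 < lm (bl y).+1)%N by lia.
rewrite (@trace_shift_r _ _ _ (vtx lam_sum (pos xk)) (vtx lam_sum lt3)) ?bl_vtx ?ps_vtx //; last by lia.
by apply: IH; rewrite !bl_vtx //; lia.
Qed.

(* No nonzero a in g_e is orthogonal both to [g_e, y0] and to the directions of the slice
   y0 + W of companion type. *)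
Lemma slice_transversal : a = 0.
Proof.
apply/matrixP => x y; rewrite mxE.
have [le|lt] := leqP (bl x) (bl y); first exact: (transversal_ge (erefl (bl x))).
by apply: (@transversal_lt k) => //; rewrite leq_addl.
Qed.

End Transversal.

(** * Invariants and transversal slices *)

Section HomComp.
Variables (R : comNzRingType) (d : nat).
Implicit Types p q : {mpoly R[d]}.

Lemma mcoeff_mhomcomp k p m : (mhomcomp k p)@_m = if mdeg m == k then p@_m else 0.
Proof.
rewrite raddf_sum /= -big_filter; under eq_bigr do rewrite mcoeffZ mcoeffX.
have [m_in|m_out] := boolP (m \in [seq i <- msupp p | mdeg i == k]).
  rewrite (big_rem m m_in) /= eqxx mulr1 big_seq big1 ?addr0 => [|m' /=].
    by move: m_in; rewrite mem_filter => /andP[->].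
  rewrite mem_rem_uniq ?filter_uniq ?msupp_uniq // inE => /andP[/negbTE -> _]; exact: mulr0.
rewrite big_seq big1 => [|m' m'_in].
  by move: m_out; rewrite mem_filter; case: eqP => //= _ /memN_msupp_eq0.
by case: eqP => [E|_]; rewrite ?mulr0 //; rewrite -E m'_in in m_out.
Qed.

Lemma mhomcomp_deriv j k p : mhomcomp k (mderiv j p) = mderiv j (mhomcomp k.+1 p).
Proof.
apply/mpolyP => m; rewrite mcoeff_mhomcomp !mcoeff_deriv mcoeff_mhomcomp mdegD mdeg1 addn1 eqSS.
by case: eqP; rewrite ?mul0rn.
Qed.

Lemma mhomcomp_linear k : linear (@mhomcomp R d k).
Proof.
move=> c p q; apply/mpolyP => m; rewrite mcoeffD mcoeffZ !mcoeff_mhomcomp mcoeffD mcoeffZ.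
by case: ifP => _ //; rewrite mulr0 addr0.
Qed.
HB.instance Definition _ k := GRing.isLinear.Build R _ _ _ (@mhomcomp R d k) (@mhomcomp_linear k).

(** Homogeneous components are the coefficients of the restriction to a line through the origin;
    they are always accessed this way. *)
Lemma coef_mmap_scaleX (t : 'I_d -> R) p k :
  (mmap polyC (fun j => t j *: 'X) p)`_k = (mhomcomp k p).@[t].
Proof.
rewrite /mmap /mhomcomp raddf_sum coef_sum /= [RHS]big_mkcond /=; apply: eq_bigr => m _.
have -> : mmap1 (fun j => t j *: 'X) m = (\prod_i t i ^+ m i) *: 'X^(mdeg m) :> {poly R}.
  rewrite /mmap1 mdegE -prodrXr -scaler_prod; apply: eq_bigr => i _; exact: exprZn.
by rewrite mul_polyC !coefZ coefXn mevalZ mevalX eq_sym; case: eqP; rewrite ?mulr1 // !mulr0.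
Qed.

Lemma mhomcomp_mulX k i p t : (mhomcomp k ('X_i * p)).@[t] =
  if k is l.+1 then t i * (mhomcomp l p).@[t] else 0.
Proof.
rewrite -coef_mmap_scaleX rmorphM /= mmapXU -scalerAl coefZ coefXM.
by case: k => [|k] /=; rewrite ?mulr0 // coef_mmap_scaleX.
Qed.

Lemma mderiv_mhomcomp0 j p : mderiv j (mhomcomp 0 p) = 0.
Proof.
by apply/mpolyP => m; rewrite mcoeff_deriv mcoeff_mhomcomp mdegD mdeg1 addn1 mul0rn mcoeff0.
Qed.

Lemma mlowdeg_eq p m : (forall k, (k < m)%N -> mhomcomp k p = 0) -> mhomcomp m p != 0 ->
  mlowdeg p = m.
Proof.
move=> lo nz; have [m0 m0_in m0_deg] : exists2 m0, m0 \in msupp p & mdeg m0 = m.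
  have [m0] : exists m0, (mhomcomp m p)@_m0 != 0.
    case E : (msupp (mhomcomp m p)) => [|m0 s].
      by move/eqP: E; rewrite msupp_eq0 (negbTE nz).
    by exists m0; rewrite -mcoeff_msupp E mem_head.
  rewrite mcoeff_mhomcomp; case: ifP => [/eqP Ed nz0|]; last by rewrite eqxx.
  by exists m0 => //; rewrite mcoeff_msupp.
apply/eqP; rewrite eqn_leq; apply/andP; split.
  rewrite /mlowdeg -m0_deg; elim: (msupp p) m0_in => //= m1 s IHs; rewrite big_cons inE.
  by case/predU1P => [->|/IHs]; rewrite geq_min ?leqnn // => ->; rewrite orbT.
rewrite /mlowdeg big_seq; elim/big_ind: _ => [|x y|m' m'_in].
(* The default value [msize p] of the minimum exceeds every degree that occurs. *)
- by rewrite ltnW // -m0_deg msize_mdeg_lt.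
- by rewrite leq_min => -> ->.
rewrite leqNgt; apply/negP => /lo /(congr1 (mcoeff m')).
by rewrite mcoeff_mhomcomp eqxx mcoeff0 => /eqP; rewrite mcoeff_eq0 m'_in.
Qed.

Lemma mderivXU i j : mderiv i ('X_j : {mpoly R[d]}) = (i == j)%:R.
Proof.
rewrite mderivX mnm1E eq_sym; case: eqP => [->|_]; last by rewrite scale0r.
suff -> : (U_(j) - U_(j) = 0)%MM by rewrite mpolyX0 scale1r.
by apply/mnmP => k; rewrite mnmBE mnm0E subnn.
Qed.

Lemma deriv_mmap (h : 'I_d -> {poly R}) p :
  (mmap polyC h p)^`() = \sum_j (h j)^`() * mmap polyC h (mderiv j p).
Proof.
elim/mpoly_ring_ind: p => [c|i|p q IHp IHq|p q IHp IHq].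
- by rewrite mmapC derivC big1 // => j _; rewrite mderivC rmorph0 mulr0.
- rewrite mmapXU (bigD1 i) //= mderivXU eqxx rmorph1 mulr1.
  by rewrite big1 ?addr0 // => j ji; rewrite mderivXU (negbTE ji) rmorph0 mulr0.
- rewrite rmorphD derivD IHp IHq -big_split; apply: eq_bigr => j _.
  by rewrite mderivD rmorphD mulrDr.
rewrite rmorphM derivM IHp IHq mulr_suml mulr_sumr -big_split; apply: eq_bigr => j _ /=.
rewrite mderivM rmorphD !rmorphM /=; ring.
Qed.

End HomComp.

Section Charp0.
Variables (K : fieldType) (d : nat).
Hypothesis char0 : forall m : nat, m.+1%:R != 0 :> K.
Implicit Types p q : {mpoly K[d]}.

Lemma natr_injective : injective (fun n => n%:R : K).
Proof.
move=> i j; wlog ij : i j / (i <= j)%N => [W|/eqP].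
  by case: (leqP i j) => [/W//|/ltnW/W{}W /esym/W].
rewrite eq_sym -subr_eq0 -natrB //; case E : (j - i)%N => [|m]; last by rewrite (negbTE (char0 m)).
by move=> _; apply/eqP; rewrite eqn_leq ij -subn_eq0 E.
Qed.

Lemma K_infinite : exists u : nat -> K, injective u.
Proof. by exists (fun n => n%:R); apply: natr_injective. Qed.

Lemma deriv_eq0 (p : {poly K}) : p^`() = 0 -> p = (p`_0)%:P.
Proof.
move=> p0; apply/polyP => -[|k]; rewrite coefC //=.
have /polyP/(_ k) := p0; rewrite coef_deriv coef0 => /eqP.
by rewrite -mulr_natr mulf_eq0 (negbTE (char0 _)) orbF => /eqP.
Qed.

Lemma horner_mmap_line (v w : 'I_d -> K) p s :
  (mmap polyC (fun j => (v j)%:P + w j *: 'X) p).[s] = p.@[fun j => v j + s * w j].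
Proof.
rewrite -horner_evalE (rmorph_mmap (f' := idfun) (h' := fun j => v j + s * w j)) // => [c|j].
  by rewrite /= ?/horner_eval hornerC.
by rewrite /= ?/horner_eval !hornerE mulrC.
Qed.

Lemma coef1_mmap_line (v w : 'I_d -> K) p :
  (mmap polyC (fun j => (v j)%:P + w j *: 'X) p)`_1 = \sum_j w j * (mderiv j p).@[v].
Proof.
set P := mmap _ _ p; have -> : P`_1 = P^`().[0] by rewrite horner_coef0 coef_deriv.
rewrite deriv_mmap horner_sum; apply: eq_bigr => j _.
rewrite hornerM horner_mmap_line derivD derivC add0r derivZ derivX alg_polyC hornerC; congr (_ * _).
by apply: meval_eq => l; rewrite mul0r addr0.
Qed.

Lemma translation_invariant (w : 'I_d -> K) p : \sum_j (w j)%:MP * mderiv j p = 0 ->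
  forall v s, p.@[fun j => v j + s * w j] = p.@[v].
Proof.
move=> p0 v s; rewrite -horner_mmap_line; set P := mmap _ _ _.
have dP : P^`() = 0.
  rewrite deriv_mmap -[RHS](rmorph0 (mmap polyC (fun j => (v j)%:P + w j *: 'X))) -p0 rmorph_sum.
  apply: eq_bigr => j _; by rewrite rmorphM /= mmapC derivD derivC add0r derivZ derivX alg_polyC.
rewrite (deriv_eq0 dP) hornerC -horner_coef0 horner_mmap_line.
by apply: meval_eq => l; rewrite mul0r addr0.
Qed.


Lemma mderiv_translate (xi : 'I_d -> K) j p :
  mderiv j (msub (fun l => 'X_l + (xi l)%:MP) p) = msub (fun l => 'X_l + (xi l)%:MP) (mderiv j p).
Proof.
elim/mpoly_ring_ind: p => [c|i|p q IHp IHq|p q IHp IHq].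
- by rewrite msubC !mderivC rmorph0.
- by rewrite msubX mderivD mderivC addr0 !mderivXU rmorph_nat.
- by rewrite msubD !mderivD IHp IHq msubD.
by rewrite msubM !mderivM IHp IHq msubD !msubM.
Qed.

Section Transversality.
Variables (gam : 'I_d -> 'I_d -> 'I_d -> K) (xi : 'I_d -> K) (m : nat) (W : 'M[K]_(m, d)).

(** For fixed [i] this is the vector of the values [xi [b_i, b_j]], a tangent direction at [xi] of
    its coadjoint orbit. *)
Definition orb i j := \sum_k gam i j k * xi k.

Hypothesis transversal : forall v : 'cV[K]_d, (forall i, \sum_j orb i j * v j 0 = 0) -> W *m v = 0 -> v = 0.

Lemma transversal_decomposition (v : 'I_d -> K) :
  exists (s : 'I_d -> K) (w : 'rV_m), forall j, v j = (w *m W) 0 j + \sum_i s i * orb i j.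
Proof.
pose C : 'M[K]_d := \matrix_(i, j) orb i j.
have /(submx_full (\row_j v j))/submxP[D vE] : row_full (col_mx W C).
  apply: row_full_dual => u; rewrite mul_col_mx -[0]vsubmxK !linear0 => /eq_col_mx[Wu Cu].
  apply: transversal => // i; have /matrixP/(_ i 0) := Cu; rewrite !mxE => E.
  by rewrite -[RHS]E; apply: eq_bigr => j _; rewrite mxE.
exists (fun i => rsubmx D 0 i), (lsubmx D) => j; have /matrixP/(_ 0 j) := vE.
rewrite mxE => ->; rewrite -[D in LHS]hsubmxK mul_row_col mxE; congr (_ + _).
by rewrite mxE; apply: eq_bigr => i _; rewrite !mxE.
Qed.

(* Expand p around xi: its lowest term is killed by the directions tangent to the orbit
   of xi, and it vanishes on the complementary directions W. *)
Lemma invariant_eq0 p : is_invariant gam p ->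
  (forall w : 'rV_m, p.@[fun j => (w *m W) 0 j + xi j] = 0) -> p = 0.
Proof.
move=> p_inv p0; pose q := msub (fun l => 'X_l + (xi l)%:MP) p.
have qE v : q.@[v] = p.@[fun j => v j + xi j].
  by rewrite msub_meval; apply: meval_eq => j; rewrite mevalD mevalXi mevalC.
have q_inv i : \sum_j (\sum_k gam i j k *: 'X_k + (orb i j)%:MP) * mderiv j q = 0.
  transitivity (msub (fun l => 'X_l + (xi l)%:MP) (\sum_j (\sum_k gam i j k *: 'X_k) * mderiv j p)); last first.
    by rewrite p_inv rmorph0.
  rewrite rmorph_sum; apply: eq_bigr => j _; rewrite rmorphM /= mderiv_translate; congr (_ * _).
  rewrite rmorph_sum /orb rmorph_sum -big_split; apply: eq_bigr => k _ /=.
  by rewrite -mul_mpolyC msubM msubC msubX mulrDr mpolyCM.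
suff q0 k : mhomcomp k q = 0.
  have {}q0 : q = 0 by apply/mpolyP => l; rewrite mcoeff0 -[RHS](mcoeff0 _ l) -(q0 (mdeg l)) mcoeff_mhomcomp eqxx.
  apply: (mpoly_all0 K_infinite) => v.
  transitivity (q.@[fun j => v j - xi j]); last by rewrite q0 meval0.
  by rewrite qE; apply: meval_eq => j; rewrite subrK.
elim/ltn_ind: k => k IH; apply: (mpoly_all0 K_infinite) => v.
have [s [w vE]] := transversal_decomposition v.
transitivity ((mhomcomp k q).@[fun j => (w *m W) 0 j]); last first.
  rewrite -coef_mmap_scaleX; suff -> : mmap polyC (fun j => (w *m W) 0 j *: 'X) q = 0 by rewrite coef0.
  apply: (poly_all0 K_infinite) => t.
  rewrite -horner_evalE (rmorph_mmap (f' := idfun) (h' := fun j => ((t *: w) *m W) 0 j)) => [|c|j].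
  - by rewrite -[LHS]/(q.@[_]) qE.
  - by rewrite /= ?/horner_eval hornerC.
  by rewrite /= ?/horner_eval hornerZ hornerX -scalemxAl [RHS]mxE mulrC.

transitivity ((mhomcomp k q).@[fun j => (w *m W) 0 j + \sum_i s i * orb i j]); first exact: meval_eq.
 elim: (index_enum _) => [|i r IHr].
  by apply: meval_eq => j; rewrite big_nil addr0.
rewrite -{}IHr -[RHS](translation_invariant (w := orb i) _ _ (s i)); last first.
  case: k IH => [|k] IH; first by rewrite big1 // => j _; rewrite mderiv_mhomcomp0 mulr0.
  (* In this degree the linear coefficients meet derivatives of lower components of [q], which are 0
     by induction; only the constant coefficients [orb i j] are left. *)
  have := congr1 (mhomcomp k) (q_inv i); rewrite linear0 linear_sum /= => E.
  apply: (mpoly_all0 K_infinite) => t; rewrite -[RHS](@meval0 d K t) -[in RHS]E !raddf_sum /=; apply: eq_bigr => j _.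
  have lin0 : (mhomcomp k ((\sum_l gam i j l *: 'X_l) * mderiv j q)).@[t] = 0.
    rewrite mulr_suml [mhomcomp k _]linear_sum /= [LHS]raddf_sum; apply: big1 => l _ /=.
    rewrite -scalerAl [mhomcomp _ (_ *: _)]linearZ /= mevalZ mhomcomp_mulX.
    case: k IH {E} => [|k] IH; first exact: mulr0.
    by rewrite mhomcomp_deriv IH // mderiv0 meval0 !mulr0.
  rewrite mulrDl [mhomcomp _ (_ + _)]linearD /= mevalD lin0 add0r !mul_mpolyC.
  by rewrite [mhomcomp _ (_ *: _)]linearZ /= mhomcomp_deriv.
by apply: meval_eq => j; rewrite big_cons addrCA addrC.
Qed.


End Transversality.
End Charp0.

(** * Nilpotent matrices in Jordan form *)

Section JordanCase.
Variables (K : closedFieldType) (lam : seq nat) (n : nat).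
Hypothesis char0 : forall m : nat, m.+1%:R != 0 :> K.
Hypothesis lam_sum : sumn lam = n.
Hypothesis lam_sorted : sorted geq lam.
Hypothesis lam_pos : all (fun l => 0 < l)%N lam.
Local Notation lm j := (nth 0%N lam j).
Local Notation bl a := (bl lam a).
Local Notation ps a := (ps lam a).
Local Notation J := (Jmx lam n K).
Let K_inf := K_infinite char0.

Definition unitv (a : 'I_n) : 'I_n -> K := fun q => (q == a)%:R.

Lemma pv_unitv a q : pv lam (unitv a) q = if bl a == q then 'X^(ps a) else 0.
Proof.
rewrite /pv big_mkcond (bigD1 a) //= big1 ?addr0 => [|p pa]; first by rewrite /unitv eqxx scale1r.
by case: ifP => // _; rewrite /unitv (negbTE pa) scale0r.
Qed.

Lemma pvE v q : pv lam v q = \sum_a v a *: pv lam (unitv a) q.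
Proof.
rewrite /pv big_mkcond; apply: eq_bigr => a _; rewrite -/(pv lam (unitv a) q) pv_unitv.
by case: ifP; rewrite ?scaler0.
Qed.

Lemma ymx_ext x y : (forall i j, x i j = y i j) -> ymx lam n x = ymx lam n y :> 'M[K]_n.
Proof. by move=> E; apply/matrixP => p q; rewrite !mxE E. Qed.

Lemma ymx_sum (v : 'I_n -> K) x :
  ymx lam n (fun i j => \sum_a v a *: x a i j) = \sum_a v a *: ymx lam n (x a) :> 'M[K]_n.
Proof.
apply/matrixP => p q; rewrite summxE mxE coef_sum; case: ifP => E.
  by apply: eq_bigr => a _; rewrite coefZ !mxE E.
by rewrite big1 // => a _; rewrite !mxE E mulr0.
Qed.

Variables (d d' : nat) (c0 : K) (f : 'M[K]_n) (b : 'I_d -> 'M[K]_n) (c : 'I_d' -> 'M[K]_n).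
Variables (gam : 'I_d -> 'I_d -> 'I_d -> K) (P : 'I_n -> {mpoly K[d]}).
Hypothesis c0_neq0 : c0 != 0.
Hypothesis b_basis : is_basis_of (centralizes J) b.
Hypothesis c_basis : is_basis_of (centralizes f) c.
Hypothesis gamP : struct_consts b gam.
Hypothesis decomposition : forall x, exists y w, adm f y = 0 /\ x = y + adm J w.
Hypothesis P_eF : forall i : 'I_n, is_eF c0 J b c i.+1 (P i).

(* The point (x, .) of g_e^*, in the coordinates given by b. *)
Definition pairing x k := c0 * \tr (b k *m x).

Lemma pairing_line x s y k : pairing (x + s *: y) k = pairing x k + s * pairing y k.
Proof. by rewrite /pairing mulmxDr -scalemxAr mxtraceD mxtraceZ mulrDr mulrCA. Qed.

Lemma pairing_sum m (v : 'I_m -> K) F k : pairing (\sum_a v a *: F a) k = \sum_a v a * pairing (F a) k.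
Proof.
rewrite /pairing mulmx_sumr raddf_sum mulr_sumr; apply: eq_bigr => a _ /=.
by rewrite -scalemxAr mxtraceZ mulrCA.
Qed.

Lemma b_comm k : b k *m J = J *m b k.
Proof. by case: b_basis => H _ _; apply: H. Qed.

Lemma pairing_tangent w k : pairing (adm J w) k = 0.
Proof. by rewrite /pairing adm_trace /adm b_comm subrr mul0mx mxtrace0 mulr0. Qed.

Lemma b_free (v : 'I_d -> K) : \sum_k v k *: b k = 0 -> forall k, v k = 0.
Proof. by case: b_basis => _ + _; apply. Qed.

Lemma pairing_surj xi : exists x, forall k, xi k = pairing x k.
Proof.
pose A : 'M[K]_(n * n, d) := \matrix_(l, k) (c0 * trv (b k) l 0).
have AE x k : (mxvec x *m A) 0 k = pairing x k.
  have := trvP (b k) x => /matrixP/(_ 0 0); rewrite !mxE mulr1n => E.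
  rewrite /pairing -E mulr_sumr; apply: eq_bigr => l _; rewrite !mxE; ring.
have /(submx_full (\row_k xi k))/submxP[D xiE] : row_full A.
  apply: row_full_dual => v Av; apply/matrixP => k j; rewrite (ord1 j) [RHS]mxE.
  apply: (@b_free (fun k => v k 0)) => {k j}; apply: trace_mul_eq0 => x; apply: (mulfI c0_neq0).
  have /matrixP/(_ 0 0) : mxvec x *m A *m v = 0 by rewrite -mulmxA Av mulmx0.
  rewrite !mxE mulr0 => E; rewrite -[RHS]E mulmx_suml raddf_sum mulr_sumr; apply: eq_bigr => k _ /=.
  by rewrite AE /pairing -scalemxAl mxtraceZ; ring.
exists (vec_mx D) => k; rewrite -AE vec_mxK -xiE mxE //.
Qed.

Lemma psiF_line (i : 'I_n) (t : 'I_d' -> K) : mmap polyC (fun j => t j *: 'X) (psiF J c i.+1) =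
  'X ^+ (bl i).+1 * Qmin lam i 'X (map_mx polyC (\sum_j t j *: c j)).
Proof.
rewrite -pminors_sum_Jmx // /psiF -pminors_sum_map; congr (pminors_sum _ _).
rewrite map_mxD; congr (_ + _).
  by rewrite -(Jmx_map lam n (polyC : {rmorphism K -> {poly K}})); apply/matrixP => p q; rewrite !mxE /= mmapC.
apply/matrixP => p q; rewrite !mxE !summxE [in RHS]rmorph_sum mulr_sumr [LHS]rmorph_sum; apply: eq_bigr => j _ /=.
by rewrite !mxE rmorphM /= mmapXU mmapC rmorphM /= -mul_polyC; ring.
Qed.

Lemma psiF_comp (i : 'I_n) (t : 'I_d' -> K) k : (k <= (bl i).+1)%N -> (mhomcomp k (psiF J c i.+1)).@[t] =
  if k == (bl i).+1 then Rmin lam i (\sum_j t j *: c j) else 0.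
Proof.
move=> le; rewrite -coef_mmap_scaleX psiF_line coefXnM ltn_neqAle le andbT.
by case: eqP => //= ->; rewrite subnn -horner_coef0 Qmin_horner0 map_mx_hornerC.
Qed.

Lemma Rmin_adm (i : 'I_n) x w : Rmin lam i (x + adm J w) = Rmin lam i x.
by rewrite -(Rmin_translate lam_sum lam_sorted i x (- w)) mulNmx mulmxN opprK [- _ + _]addrC.
Qed.

Lemma cent_f_span y : adm f y = 0 -> exists t : 'I_d' -> K, y = \sum_j t j *: c j.
Proof.
move=> /eqP; rewrite subr_eq0 => /eqP fy; case: c_basis => _ _; apply.
by rewrite /centralizes fy.
Qed.

(** The candidate for the lowest term is nonzero: [Rmin] does not vanish at a suitable point of the
    companion slice, and this point can be moved into the centralizer of [f] along the image of
    [adm J]. *)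
Lemma psiF_lowdeg (i : 'I_n) : mlowdeg (psiF J c i.+1) = (bl i).+1.
Proof.
apply: mlowdeg_eq => [l lt|].
  by apply: (mpoly_all0 K_inf) => t; rewrite psiF_comp 1?ltnW // (ltn_eqF lt).
have [u nzu H] := Rmin_compan K_inf lam_sum lam_sorted lam_pos i.
pose r := ((lm (bl i)).-1 - ps i)%N; have lti := ps_lt lam_sum i.
pose z q : {poly K} := if q == bl i then 'X^r else 0.
have nz : Rmin lam i (ymx lam n (compan z)) != 0.
  rewrite H => [|q]; first by rewrite /z eqxx coefXn eqxx mulr1.
  rewrite /z; case: eqP => [->|_]; last by rewrite size_poly0.
  by rewrite size_polyXn /r; lia.
have [y [w [/cent_f_span[t yt] xE]]] := decomposition (ymx lam n (compan z)).
apply: contraNneq nz => m0; rewrite xE Rmin_adm yt.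
by have := psiF_comp t (leqnn (bl i).+1); rewrite eqxx m0 meval0 => <-.
Qed.

Lemma P_eval i x : (P i).@[pairing x] = Rmin lam i x.
Proof.
have [y [w [/cent_f_span[t yt] ->]]] := decomposition x.
rewrite Rmin_adm yt; have := psiF_comp t (leqnn (bl i).+1); rewrite eqxx => <-.
rewrite -psiF_lowdeg -/(minit _) -(P_eF i) comp_mpoly_msub msub_meval; apply: meval_eq => k.
rewrite tnth_mktuple -[adm J w]scale1r pairing_line pairing_tangent mulr0 addr0 pairing_sum raddf_sum.
by apply: eq_bigr => j _ /=; rewrite mevalM mevalC mevalXi mulrC.
Qed.

Lemma P_line i x y : mmap polyC (fun k => (pairing x k)%:P + pairing y k *: 'X) (P i) =
  Rmin lam i (map_mx polyC x + 'X *: map_mx polyC y).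
Proof.
apply/subr0_eq/(poly_all0 K_inf) => s; rewrite hornerD hornerN horner_mmap_line.
rewrite -[X in _ - X]/(horner_eval s _) -Rmin_map; apply/eqP; rewrite subr_eq0; apply/eqP.
transitivity ((P i).@[pairing (x + s *: y)]); first by apply: meval_eq => k; rewrite pairing_line.
rewrite P_eval; congr (Rmin _ _ _); apply/matrixP => p q.
by rewrite !mxE /= /horner_eval !hornerE.
Qed.

Lemma P_homog i : P i \is (bl i).+1.-homog.
Proof.
apply/dhomogP => m m_in; apply/eqP; apply: contraTT m_in => md.
suff E : mhomcomp (mdeg m) (P i) = 0.
  by have := mcoeff_mhomcomp (mdeg m) (P i) m; rewrite E mcoeff0 eqxx mcoeff_msupp negbK => <-.
apply: (mpoly_all0 K_inf) => xi; have [x xiE] := pairing_surj xi.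
rewrite -coef_mmap_scaleX.
have -> : mmap polyC (fun j => xi j *: 'X) (P i) = (Rmin lam i x) *: 'X^((bl i).+1); last first.
  by rewrite coefZ coefXn (negbTE md) mulr0.
apply/subr0_eq/(poly_all0 K_inf) => s; rewrite hornerD hornerN.
apply/eqP; rewrite subr_eq0 hornerZ hornerXn mulrC -(RminZ lam_sum lam_sorted) -P_eval; apply/eqP.
rewrite -horner_evalE (rmorph_mmap (f' := idfun) (h' := pairing (s *: x))) => [|a|j] //=.
  by rewrite /horner_eval hornerC.
by rewrite /horner_eval hornerZ hornerX xiE -[s *: x]add0r pairing_line /pairing mulmx0 mxtrace0 mulr0 add0r mulrC.
Qed.

Lemma P_at0 i : (P i).@[fun=> 0] = 0.
Proof.
transitivity ((P i).@[pairing 0]).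
  by apply: meval_eq => k; rewrite /pairing mulmx0 mxtrace0 mulr0.
by rewrite P_eval -(scale0r (0 : 'M[K]_n)) RminZ // expr0n mul0r.
Qed.

Lemma gam_pairing i j x : \sum_k gam i j k * pairing x k = c0 * \tr (lie (b i) (b j) *m x).
Proof.
rewrite gamP mulmx_suml raddf_sum mulr_sumr; apply: eq_bigr => k _ /=.
by rewrite -scalemxAl mxtraceZ /pairing mulrCA.
Qed.

(** Up to sign, the derivative of [P i] along a coadjoint direction is the linear coefficient of
    [Rmin] under infinitesimal conjugation by [b l], which vanishes. *)
Lemma P_invariant i : is_invariant gam (P i).
Proof.
move=> l; apply: (mpoly_all0 K_inf) => xi; have [x xiE] := pairing_surj xi.
have [r Er] := Rmin_adjoint lam_sum lam_sorted i x (b_comm l).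
have /polyP/(_ 1%N) := P_line i x (b l *m x - x *m b l).
rewrite Er coef1_mmap_line coefD coefC coefXnM /= addr0 => E.
apply: oppr_inj; rewrite oppr0 -[RHS]E rmorph_sum -sumrN; apply: eq_bigr => j _ /=.
rewrite mevalM -mulNr; congr (_ * _); last exact: meval_eq.
have -> : (\sum_k gam l j k *: 'X_k).@[xi] = \sum_k gam l j k * pairing x k.
  by rewrite rmorph_sum; apply: eq_bigr => k _; rewrite /= mevalZ mevalXi xiE.
rewrite gam_pairing /lie mulmxBl (raddfB mxtrace) /= /pairing mulmxBr (raddfB mxtrace) /= -mulrN opprB.
by rewrite !mulmxA [\tr (b j *m x *m b l)]mxtrace_mulC mulmxA.
Qed.

Local Notation y0 := (ymx lam n (compan (fun=> 0)) : 'M[K]_n).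
Definition wmx (a : 'I_n) : 'M[K]_n :=
  ymx lam n (fun i j => if j == 0%N then pv lam (unitv a) i else 0).

Lemma slice_pointE v : ymx lam n (compan (pv lam v)) = y0 + \sum_a v a *: wmx a.
Proof.
rewrite /wmx -ymx_sum; apply/matrixP => p q; rewrite !mxE /compan; case: ifP => _; last by rewrite addr0.
case: (bl q =P 0%N) => _; first by rewrite coef0 add0r -pvE.
by rewrite big1 ?coef0 ?addr0 // => a _; rewrite scaler0.
Qed.

Lemma trace_wmx (a : 'M[K]_n) (x y q : 'I_n) : bl x = 0%N -> ps y = (lm (bl y)).-1 ->
  bl q = bl y -> ps q = ps x -> \tr (a *m wmx q) = a x y.
Proof.
move=> x0 yl qy qx; rewrite /mxtrace; under eq_bigr do rewrite mxE.
rewrite (@sum2_single K n (fun p r => a p r * wmx q r p) x y) => [|p r].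
  by rewrite mxE yl x0 !eqxx pv_unitv qy eqxx coefXn qx eqxx mulr1.
rewrite mxE; case: (ps r =P _) => [rl|]; last by rewrite mulr0 eqxx.
case: (bl p =P 0%N) => [p0|]; last by rewrite coef0 mulr0 eqxx.
rewrite pv_unitv; case: (bl q =P _) => [qr|]; last by rewrite coef0 mulr0 eqxx.
rewrite coefXn; case: (ps p =P _) => [pq|]; last by rewrite mulr0 eqxx.
move=> _; split; apply: (bl_ps_inj (lam := lam)); rewrite ?p0 ?x0 ?pq ?qx //; first by rewrite -qr.
by rewrite rl yl -qr qy.
Qed.

(** The vector [v] is read as the element [a] of the centralizer with coordinates [v]; both
    hypotheses then become trace conditions on [a]. *)
Lemma transversal_pairing (v : 'cV[K]_d) :
  (forall i, \sum_j orb gam (pairing y0) i j * v j 0 = 0) ->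
  (\matrix_(a < n, k < d) pairing (wmx a) k) *m v = 0 -> v = 0.
Proof.
move=> v_orb v_W; pose a := \sum_k v k 0 *: b k.
suff a0 : a = 0 by apply/matrixP => k j; rewrite (ord1 j) mxE; exact: (b_free a0 k).
have aJ : a *m J = J *m a.
  rewrite mulmx_suml mulmx_sumr; apply: eq_bigr => k _.
  by rewrite -scalemxAl -scalemxAr b_comm.
apply: (slice_transversal lam_sum lam_sorted lam_pos aJ) => [u uJ|x y x0 yl xy].
  have [_ _ /(_ u uJ)[s ->]] := b_basis.
  rewrite mulmx_suml mulmx_sumr -sumrB mulmx_suml raddf_sum big1 // => i _ /=.
  rewrite -scalemxAl -scalemxAr -scalerBr -scalemxAl mxtraceZ.
  suff -> : \tr ((b i *m a - a *m b i) *m y0) = 0 by rewrite mulr0.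
  apply: (mulfI c0_neq0); rewrite mulr0 -[RHS](v_orb i).
  rewrite mulmx_sumr mulmx_suml -sumrB mulmx_suml raddf_sum mulr_sumr; apply: eq_bigr => j _ /=.
  rewrite /orb gam_pairing -scalemxAl -scalemxAr -scalerBr -scalemxAl mxtraceZ /lie; ring.
pose q := vtx lam_sum xy.
rewrite -(@trace_wmx a x y q) ?bl_vtx ?ps_vtx //; apply: (mulfI c0_neq0); rewrite mulr0.
have /matrixP/(_ q 0) := v_W; rewrite !mxE => E; rewrite -[RHS]E.
rewrite mulmx_suml raddf_sum mulr_sumr; apply: eq_bigr => k _ /=.
by rewrite !mxE -scalemxAl mxtraceZ /pairing; ring.
Qed.

Lemma is_invariantB p q : is_invariant gam p -> is_invariant gam q -> is_invariant gam (p - q).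
Proof.
move=> ip iq i; transitivity (\sum_j (\sum_k gam i j k *: 'X_k) * mderiv j p -
  \sum_j (\sum_k gam i j k *: 'X_k) * mderiv j q); last by rewrite ip iq subr0.
rewrite -sumrB.
by apply: eq_bigr => j _; rewrite mderivB mulrBr.
Qed.

Lemma is_invariant_msub (G : {mpoly K[n]}) : is_invariant gam (msub P G).
Proof.
elim/mpoly_ring_ind: G => [a|l|p q ip iq|p q ip iq] i.
- by rewrite big1 // => j _; rewrite msubC mderivC mulr0.
- by rewrite msubX; apply: P_invariant.
- transitivity (\sum_j (\sum_k gam i j k *: 'X_k) * mderiv j (msub P p) +
    \sum_j (\sum_k gam i j k *: 'X_k) * mderiv j (msub P q)); last by rewrite ip iq addr0.
  by rewrite -big_split; apply: eq_bigr => j _; rewrite /= msubD mderivD mulrDr.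
transitivity (msub P q * (\sum_j (\sum_k gam i j k *: 'X_k) * mderiv j (msub P p)) +
   msub P p * (\sum_j (\sum_k gam i j k *: 'X_k) * mderiv j (msub P q))); last by rewrite ip iq !mulr0 addr0.
rewrite !mulr_sumr -big_split; apply: eq_bigr => j _ /=; rewrite msubM mderivM.
by move: (\sum_k _) => z; ring.
Qed.

Lemma invariant_algebraic phi : is_invariant gam phi -> exists G, phi = msub P G.
Proof.
move=> inv.
have opp_subproof (i : 'I_n) : ((lm (bl i)).-1 - ps i < lm (bl i))%N.
  by have := ps_lt lam_sum i; lia.
(* On the companion slice [P i] reads the coefficient at [(lm (bl i)).-1 - ps i], so [tau] reverses
   the positions within each block. *)
pose tau (i : 'I_n) := vtx lam_sum (opp_subproof i).
have bl_tau i : bl (tau i) = bl i by exact: bl_vtx.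
have ps_tau i : ps (tau i) = ((lm (bl i)).-1 - ps i)%N by exact: ps_vtx.
have tauK i : tau (tau i) = i.
  apply: (bl_ps_inj (lam := lam)); rewrite ?ps_tau !bl_tau //.
  by have := ps_lt lam_sum i; lia.
have [u Hu] : exists u : 'I_n -> K, forall i, u i != 0 /\
    forall v, (P i).@[pairing (ymx lam n (compan (pv lam v)))] = u i * v (tau i).
  apply: (@fin_all_exists _ (fun=> K) (fun i ui => ui != 0 /\
    forall v, (P i).@[pairing (ymx lam n (compan (pv lam v)))] = ui * v (tau i))) => i.
  have [ui nz H] := Rmin_compan K_inf lam_sum lam_sorted lam_pos i.
  exists ui; split=> // v; rewrite P_eval H; last by move=> q; apply: size_pv.
  by congr (_ * _); rewrite -(coef_pv lam v (tau i)) bl_tau ps_tau.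
(* The coordinates of a slice point, expressed through the values of the [P i] there. *)
pose g k : {mpoly K[n]} := (pairing y0 k)%:MP + \sum_a (pairing (wmx a) k / u (tau a)) *: 'X_(tau a).
exists (msub g phi); apply/subr0_eq.
apply: (invariant_eq0 char0 transversal_pairing) => [|w].
  by apply: is_invariantB => //; apply: is_invariant_msub.
pose v a := w 0 a; pose pt := ymx lam n (compan (pv lam v)) : 'M[K]_n.
have ptE k : pairing pt k = pairing y0 k + \sum_a v a * pairing (wmx a) k.
  by rewrite /pt slice_pointE -[X in y0 + X]scale1r pairing_line mul1r pairing_sum.
transitivity ((phi - msub P (msub g phi)).@[pairing pt]).
  by apply: meval_eq => k; rewrite ptE mxE addrC; congr (_ + _); apply: eq_bigr => a _; rewrite mxE.
rewrite mevalB !msub_meval; apply/eqP; rewrite subr_eq0; apply/eqP/meval_eq => k.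
rewrite ptE mevalD mevalC; congr (_ + _).
rewrite raddf_sum; apply: eq_bigr => a _ /=; rewrite mevalZ mevalXi.
have [nz ->] := Hu (tau a).
by rewrite tauK [RHS]mulrA mulfVK // mulrC.
Qed.

Lemma nullconeE xi : nullcone gam xi <-> forall i, (P i).@[xi] = 0.
Proof.
split=> [H i|P0 phi inv phi0]; first by apply: H; [exact: P_invariant|exact: P_at0].
have [G phiE] := invariant_algebraic inv; rewrite -[RHS]phi0 phiE !msub_meval.
by apply: meval_eq => i; rewrite P0 P_at0.
Qed.

(** The points of the Hankel slice must be distinct, and the natural numbers are so in
    characteristic 0. *)
Let cs (j : nat) : K := j%:R.
Let M : 'M[K]_(n, d) := \matrix_(a, k) pairing (ymx lam n (hankel lam (pv lam (unitv a)) cs)) k.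

Lemma P_hankel i v : (P i).@[lmap M v] = Rmin lam i (ymx lam n (hankel lam (pv lam v) cs)).
Proof.
rewrite -P_eval; apply: meval_eq => k; rewrite /lmap; under eq_bigr do rewrite mxE.
rewrite -pairing_sum; congr (pairing _ k); rewrite -ymx_sum; apply: ymx_ext => p q.
rewrite /hankel; case: ifP => _; last by rewrite big1 // => a _; rewrite scaler0.
rewrite pvE linear_sum; apply: eq_bigr => a _ /=; by rewrite comp_polyZ.
Qed.

Theorem Jordan_case :
  (forall Z : aset K d, irreducible_component (nullcone gam) Z -> has_codim Z n) /\ regular_seq P.
Proof.
have cs_inj : injective cs := natr_injective char0.
have hom i : exists2 e, (0 < e)%N & P i \is e.-homog by exists (bl i).+1 => //; apply: P_homog.
split=> [Z|].
  exact: (assembled_codim K_inf lam_sum lam_sorted lam_pos cs_inj P_hankel hom P_at0 nullconeE).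
exact: (assembled_regular K_inf lam_sum lam_sorted lam_pos cs_inj P_hankel hom P_at0).
Qed.

End JordanCase.

(** * Conjugation *)

Section Conjugation.
Variables (K : fieldType) (n : nat) (g g' : 'M[K]_n).
Hypothesis g'g : g' *m g = 1%:M.
Implicit Types x y : 'M[K]_n.

Let gg' : g *m g' = 1%:M. Proof. exact: mulmx1C. Qed.

Definition conjm x := g *m x *m g'.

Lemma conjmM x y : conjm x *m conjm y = conjm (x *m y).
Proof. by rewrite /conjm !mulmxA -(mulmxA _ g' g) g'g mulmx1. Qed.

Lemma conjm_linear : linear conjm.
Proof. by move=> a x y; rewrite /conjm mulmxDr mulmxDl -scalemxAr -scalemxAl. Qed.
HB.instance Definition _ := GRing.isLinear.Build K _ _ _ conjm conjm_linear.

Lemma conjmK x : conjm (g' *m x *m g) = x.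
Proof. by rewrite /conjm !mulmxA gg' mul1mx -mulmxA gg' mulmx1. Qed.

Lemma conjm_inj : injective conjm.
Proof.
move=> x y E; have := congr1 (fun z => g' *m z *m g) E.
by rewrite /conjm !mulmxA g'g !mul1mx -!mulmxA g'g !mulmx1.
Qed.

Lemma lie_conjm x y : lie (conjm x) (conjm y) = conjm (lie x y).
Proof. by rewrite /lie !conjmM linearB. Qed.

Lemma adm_conjm x y : adm (conjm x) (conjm y) = conjm (adm x y).
Proof. exact: lie_conjm. Qed.

Lemma centralizes_conjm e x : centralizes e x <-> centralizes (conjm e) (conjm x).
Proof. by rewrite /centralizes !conjmM; split=> [->|/conjm_inj]. Qed.

Lemma basis_conjm e m (b : 'I_m -> 'M[K]_n) : is_basis_of (centralizes e) b ->
  is_basis_of (centralizes (conjm e)) (fun i => conjm (b i)).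
Proof.
case=> bP b_free b_span; split=> [i|a|x].
- exact: (proj1 (centralizes_conjm e (b i)) (bP i)).
- move=> a0; apply: b_free; apply: conjm_inj; rewrite linear0 linear_sum -[RHS]a0.
  by apply: eq_bigr => i _; rewrite linearZ.
move=> xe; have [a xE] : exists a : 'I_m -> K, g' *m x *m g = \sum_i a i *: b i.
  by apply/b_span/centralizes_conjm; rewrite conjmK.
exists a; rewrite -[LHS]conjmK xE.
by rewrite linear_sum; apply: eq_bigr => i _; rewrite linearZ.
Qed.

Lemma struct_consts_conjm m (b : 'I_m -> 'M[K]_n) gam : struct_consts b gam ->
  struct_consts (fun i => conjm (b i)) gam.
Proof.
move=> bgam i j; rewrite lie_conjm bgam linear_sum; apply: eq_bigr => k _; exact: linearZ.
Qed.

Lemma psiF_conjm e m (c : 'I_m -> 'M[K]_n) i : psiF (conjm e) (fun j => conjm (c j)) i = psiF e c i.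
Proof.
pose G : 'M[{mpoly K[m]}]_n := map_mx (@mpolyC m K) g; pose G' : 'M[{mpoly K[m]}]_n := map_mx (@mpolyC m K) g'.
have G'G : G' *m G = 1%:M by rewrite -map_mxM g'g map_mx1.
rewrite /psiF -[RHS](pminors_sum_conj i _ G'G); congr (pminors_sum i _); rewrite mulmxDr mulmxDl; congr (_ + _); first by rewrite /conjm !map_mxM.
rewrite mulmx_sumr mulmx_suml; apply: eq_bigr => j _.
by rewrite -scalemxAr -scalemxAl /conjm !map_mxM.
Qed.

(** The same [P] serves after conjugation, because minor sums and the trace pairing of the two bases
    do not change. *)
Lemma is_eF_conjm d d' c0 e (b : 'I_d -> 'M[K]_n) (c : 'I_d' -> 'M[K]_n) i P :
  is_eF c0 e b c i P -> is_eF c0 (conjm e) (fun k => conjm (b k)) (fun j => conjm (c j)) i P.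
Proof.
rewrite /is_eF psiF_conjm => <-; congr (_ \mPo _); apply: eq_mktuple => k.
by apply: eq_bigr => j _; rewrite conjmM /conjm [\tr (g *m _ *m g')]mxtrace_mulC !mulmxA g'g mul1mx.
Qed.

End Conjugation.

Theorem theorem5p4 (K : closedFieldType) (hK : [pchar K] =i pred0)
    (n : nat) (hn : (2 <= n)%N)
    (e h f : 'M[K]_n) (c0 : K)
    (d d' : nat) (b : 'I_d -> 'M[K]_n) (c : 'I_d' -> 'M[K]_n)
    (gam : 'I_d -> 'I_d -> 'I_d -> K) (P : 'I_n -> {mpoly K[d]}) :
  mxnilpotent e ->
  c0 != 0 ->
  (e = 0 -> f = 0) ->
  (e != 0 -> [/\ lie h e = 2 *: e, lie h f = - (2 *: f), lie e f = h
               & c0 * \tr (e *m f) = 1]) ->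
  is_basis_of (centralizes e) b ->
  is_basis_of (centralizes f) c ->
  struct_consts b gam ->
  (forall i : 'I_n, is_eF c0 e b c i.+1 (P i)) ->
  (forall Z : aset K d, irreducible_component (nullcone gam) Z -> has_codim Z n)
  /\ regular_seq P.
Proof.
move=> e_nil c0_neq0 f0 triple b_basis c_basis gamP P_eF.
have char0 m : m.+1%:R != 0 :> K by rewrite (proj1 (pcharf0P K) hK).
have [k ek] := e_nil.
have [lam [lam_sum lam_sorted lam_pos [_ [g g_unit ge]]]] := nilpotent_Jordan ek.
have g'g : invmx g *m g = 1%:M by rewrite mulVmx.
have eJ : conjm g (invmx g) e = Jmx lam n K by rewrite /conjm ge -mulmxA mulmxV // mulmx1.
(* The decomposition is established for the given triple and then transported, so only [e] and [f]
   are conjugated. *)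
have dec : forall x, exists y w, adm (conjm g (invmx g) f) y = 0 /\ x = y + adm (Jmx lam n K) w.
  move=> x; have [|y [w [fy xE]]] := triple_decomposition char0 e_nil f0 (h := h) _ (invmx g *m x *m g).
    by move=> /triple[].
  exists (conjm g (invmx g) y), (conjm g (invmx g) w); rewrite -eJ !adm_conjm // fy linear0; split=> //.
  by rewrite -[LHS](conjmK g'g) xE linearD.
have b'_basis : is_basis_of (centralizes (Jmx lam n K)) (fun k => conjm g (invmx g) (b k)).
  by rewrite -eJ; apply: (basis_conjm g'g b_basis).
have P_eF' (i : 'I_n) : is_eF c0 (Jmx lam n K) (fun k => conjm g (invmx g) (b k)) (fun j => conjm g (invmx g) (c j)) i.+1 (P i).
  by rewrite -eJ; apply: (is_eF_conjm g'g (P_eF i)).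
exact: (Jordan_case char0 lam_sum lam_sorted lam_pos c0_neq0 b'_basis (basis_conjm g'g c_basis)
  (struct_consts_conjm g'g gamP) dec P_eF').
Qed.
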